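(* With the notation below, $$\Phi_0(u,v,w)=\frac{1}{1-v}\int_0^1(1-z)^{-\beta}F\left({1-\gamma_1-\beta,\,1-\gamma_2-\beta\atop 2-v};z\right)dz=\frac{1}{(1-v)(1-\beta)}\;{}_3F_2\left({1-\gamma_1-\beta,\,1-\gamma_2-\beta,\,1\atop 2-v,\,2-\beta};1\right),$$ where $\alpha,\beta$ are determined by $\alpha+\beta=u+vt$, $\alpha\beta=t(uv-w^2)$, and $\gamma_1,\gamma_2$ by $\gamma_1+\gamma_2=-u-(t-1)v$, $\gamma_1\gamma_2=(t-1)(uv-w^2)$.
   Context: For positive integers $k_1\ge2,k_2,\dots,k_n$, $\zeta(k_1,\dots,k_n)=\sum_{m_1>\cdots>m_n>0}m_1^{-k_1}\cdots m_n^{-k_n}$, and for a parameter $t$, $\zeta^t(k_1,\dots,k_n)=\sum_{\mathbf p}t^{n-\operatorname{dep}(\mathbf p)}\zeta(\mathbf p)$, where $\mathbf p$ runs over all indices obtained from $(k_1\Box\cdots\Box k_n)$ by filling each $\Box$ with a comma or a plus sign, and $\operatorname{dep}(\mathbf p)$ is the number of entries of $\mathbf p$. An index $(k_1,\dots,k_n)$ of positive integers has weight $\sum k_i$, depth $n$, height $\#\{i:k_i\ge2\}$, and is admissible if $k_1\ge2$. For positive integers $k,n,s$ with $k\ge n+s$, $n\ge s$, let $X_0(k,n,s)$ be the sum of $\zeta^t(\mathbf k)$ over all admissible indices $\mathbf k$ of weight $k$, depth $n$ and height $s$, and let $\Phi_0(u,v,w)=\sum_{k\ge n+s,\ n\ge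 s\ge1}X_0(k,n,s)u^{k-n-s}v^{n-s}w^{2s-2}$, regarded as a function of the variables $u,v,w$. Standing assumption: $\Re(\alpha)<1$ and $\Re(\beta)<1$. Here $F\left({a,b\atop c};z\right)=\sum_{n\ge0}\frac{(a)_n(b)_n}{n!(c)_n}z^n$ is the Gauss hypergeometric function, ${}_3F_2\left({a_1,a_2,a_3\atop b_1,b_2};z\right)=\sum_{n\ge0}\frac{(a_1)_n(a_2)_n(a_3)_n}{n!(b_1)_n(b_2)_n}z^n$, and $(a)_n=a(a+1)\cdots(a+n-1)$, $(a)_0=1$. *)

(* Defs.v *)
From Stdlib Require Import Reals List Arith Lia FinFun.
From Coquelicot Require Import Coquelicot.
Import ListNotations.
Open Scope R_scope.

(* An index is a list of positive naturals.  [indices k n] enumerates, without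
   repetition, those of weight [k] and depth [n]: see [in_indices] and
   [NoDup_indices]. *)
Fixpoint indices (k n : nat) : list (list nat) :=
  match n with
  | O => if (k =? 0)%nat then [[]] else []
  | S n' =>
      flat_map (fun j => map (cons j) (indices (k - j) n')) (seq 1 k)
  end.

Lemma in_indices (k n : nat) (ks : list nat) :
  In ks (indices k n) <->
  (List.Forall (fun j => (1 <= j)%nat) ks /\ list_sum ks = k /\ length ks = n).
Proof.
revert k ks; induction n as [|n IH]; intros k ks; simpl.
- destruct (Nat.eqb_spec k 0) as [->|Hk]; simpl; split.
  + intros [<-|[]]; repeat split; constructor.
  + intros (_ & _ & H); destruct ks; [now left | discriminate].
  + intros [].
  + intros (_ & Hs & H); destruct ks; [simpl in Hs; lia | discriminate].
- rewrite in_flat_map; split.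
  + intros (j & Hj & H); apply in_map_iff in H; destruct H as (l & <- & Hl).
    apply in_seq in Hj; apply IH in Hl; destruct Hl as (H1 & H2 & H3).
    simpl; repeat split; [constructor; [lia | exact H1] | lia | lia].
  + intros (H1 & H2 & H3); destruct ks as [|j l]; [discriminate|].
    simpl in H2, H3; inversion H1; subst.
    exists j; split; [apply in_seq; lia|].
    apply in_map, IH; repeat split; [assumption | lia | lia].
Qed.

Lemma NoDup_indices (k n : nat) : NoDup (indices k n).
Proof.
revert k; induction n as [|n IH]; intros k; simpl.
- destruct (k =? 0)%nat; repeat constructor; intros [].
- assert (H : forall a m, NoDup
    (flat_map (fun j => map (cons j) (indices (k - j) n)) (seq a m))).
  { intros a m; revert a; induction m as [|m IHm]; intros a; simpl;
      [constructor|].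
    apply NoDup_app.
    - apply Injective_map_NoDup; [now intros x y [= ->] | apply IH].
    - apply IHm.
    - intros l Hl Hl'; apply in_map_iff in Hl; destruct Hl as (l1 & <- & _).
      apply in_flat_map in Hl'; destruct Hl' as (j & Hj & H).
      apply in_map_iff in H; destruct H as (l2 & [= -> _] & _).
      apply in_seq in Hj; lia. }
  apply H.
Qed.

Definition height (ks : list nat) : nat := length (filter (Nat.leb 2) ks).

Definition admissible (ks : list nat) : bool :=
  match ks with [] => false | k1 :: _ => (2 <=? k1)%nat end.

Definition adm_indices (k n s : nat) : list (list nat) :=
  filter (fun ks => admissible ks && (height ks =? s)%nat)%bool (indices k n).

(* The finite sum over N > m_1 > ... > m_n > 0. *)
Fixpoint mzv_trunc (ks : list nat) (N : nat) : R :=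
  match ks with
  | [] => 1
  | k :: ks' =>
      sum_n_m (fun m => / INR m ^ k * mzv_trunc ks' m) 1 (pred N)
  end.

Definition mzv (ks : list nat) : R := real (Lim_seq (mzv_trunc ks)).

(* [fillings k1 [k2; ...; kn]] lists the 2^(n-1) indices obtained from
   k1 [] k2 [] ... [] kn by putting a comma or a plus sign in each box. *)
Fixpoint fillings (k1 : nat) (ks : list nat) : list (list nat) :=
  match ks with
  | [] => [[k1]]
  | k2 :: ks' => map (cons k1) (fillings k2 ks') ++ fillings (k1 + k2) ks'
  end.

Definition Csum {A : Type} (f : A -> C) (l : list A) : C :=
  fold_right Cplus (RtoC 0) (map f l).

(* The value at the empty index is irrelevant: admissible indices are nonempty. *)
Definition mzv_t (t : C) (ks : list nat) : C :=
  match ks with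
  | [] => RtoC 1
  | k1 :: ks' =>
      Csum (fun p => t ^ (length ks - length p) * RtoC (mzv p))%C
           (fillings k1 ks')
  end.

Definition X0 (t : C) (k n s : nat) : C := Csum (mzv_t t) (adm_indices k n s).

Definition Phi0_term (t u v w : C) (k n s : nat) : C :=
  (X0 t k n s * u ^ (k - n - s) * v ^ (n - s) * w ^ (2 * s - 2))%C.

(* The pairs (n, s) with k >= n + s and n >= s >= 1, a finite set for given k. *)
Definition depth_heights (k : nat) : list (nat * nat) :=
  filter (fun p => (fst p + snd p <=? k)%nat && (snd p <=? fst p)%nat)%bool
         (list_prod (seq 1 k) (seq 1 k)).

(* Absolute convergence of the triple series over (k, n, s). *)
Definition Phi0_abs_conv (t u v w : C) : Prop :=
  ex_series (fun k =>
    fold_right Rplus 0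
      (map (fun p => Cmod (Phi0_term t u v w k (fst p) (snd p)))
           (depth_heights k))).

Definition CSeries (a : nat -> C) : C :=
  (Series (fun n => Re (a n)), Series (fun n => Im (a n))).

(* Summed by increasing weight; under [Phi0_abs_conv] the order is immaterial. *)
Definition Phi0 (t u v w : C) : C :=
  CSeries (fun k =>
    Csum (fun p => Phi0_term t u v w k (fst p) (snd p)) (depth_heights k)).

Fixpoint poch (a : C) (n : nat) : C :=
  match n with
  | O => RtoC 1
  | S n' => (poch a n' * (a + RtoC (INR n')))%C
  end.

Definition F21_term (a b c z : C) (n : nat) : C :=
  (poch a n * poch b n / (RtoC (INR (fact n)) * poch c n) * z ^ n)%C.

Definition F21 (a b c z : C) : C := CSeries (F21_term a b c z).

Definition F32_term (a1 a2 a3 b1 b2 z : C) (n : nat) : C :=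
  (poch a1 n * poch a2 n * poch a3 n
     / (RtoC (INR (fact n)) * poch b1 n * poch b2 n) * z ^ n)%C.

Definition F32 (a1 a2 a3 b1 b2 z : C) : C :=
  CSeries (F32_term a1 a2 a3 b1 b2 z).

Definition Cexp (z : C) : C :=
  (exp (Re z) * cos (Im z), exp (Re z) * sin (Im z)).

(* x^s for real x > 0. *)
Definition Rcpow (x : R) (s : C) : C := Cexp (s * RtoC (ln x))%C.

(* z |-> (1 - z)^(-beta) F(1 - gamma1 - beta, 1 - gamma2 - beta; 2 - v; z). *)
Definition Phi0_integrand (v beta gamma1 gamma2 : C) (z : R) : C :=
  (Rcpow (1 - z) (- beta)
     * F21 (1 - gamma1 - beta) (1 - gamma2 - beta) (2 - v) (RtoC z))%C.

(* Main.v *)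
(* Proof idea.  For truncated sums the weights factor over the largest summation
   index m: a block of l equal indices m contributes t^(l-1) f(m)^l with
   f(m) = v/m + w^2/(m(m-u)), and 1 - t f(m), 1 + (1-t) f(m) are
   (m-alpha)(m-beta)/(m(m-u)) and (m+gamma1)(m+gamma2)/(m(m-u)).  So, for small u, v, w,
     Phi_0 = 1/((1-alpha)(1-beta)) 3F2(1+gamma1, 1+gamma2, 1; 2-beta, 2-alpha; 1).
   Iterating K times a contiguous relation that raises 2-beta by one (Thomae's
   transformation, one step at a time) turns this into the first K terms of the required
   series plus a multiple of 3F2(1+gamma1, 1+gamma2, 1; 2-beta+K, 2-alpha; 1).

   At the given point the original 3F2 may diverge.  Scale (u, v, w) by x in [-1, 1]: for
   K large both sides are quotients of absolutely summable power series in x whose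
   denominators do not vanish at x = 1.  They agree near x = 0, so the cross-multiplied
   power series coincide and the quotients agree at x = 1.  Then K tends to infinity.  The integral is
   obtained by integrating the 2F1 series termwise against (1-z)^(-beta). *)

Require Import Defs.
From Stdlib Require Import Reals List Arith Lia Lra IndefiniteDescription.
From Coquelicot Require Import Coquelicot.
Import ListNotations.
Open Scope R_scope.

(** The exchange of the truncation limit with the sum over weights needs bounds uniform in the
    truncation. Inner sums may diverge, so they are bounded by a multiple of [sqrt N]: this growth
    reproduces itself when summed against [1 / m] and becomes bounded when summed against
    [1 / m ^ 2], which is where admissibility enters. The first [3F2] has parameter excess [1 - v],
    the required one [1 - alpha]; only the real part of the latter is positive by assumption. Each
    contiguous step adds one to a lower parameter, so the remainder series converges after enough
    steps. Absolute convergence is assumed at the given point only, hence the scaled [Phi0] is known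
    on a closed interval ending at [x = 1] and not around that point: summable coefficients replace
    analytic continuation. The relations for [alpha], [beta], [gamma1], [gamma2] are homogeneous, so
    these numbers scale by [x] as well and no roots have to be chosen anew. At intermediate [x]
    factors such as [1 - v * x] may vanish, so the quotients are used only near 0 and at 1. *)

Lemma Re_Csum {A} (f : A -> C) l :
  Re (Csum f l) = fold_right Rplus 0 (map (fun x => Re (f x)) l).
Proof.
unfold Csum; induction l as [|x l IH]; [reflexivity|].
change (Re (f x) + Re (fold_right Cplus (RtoC 0) (map f l)) = Re (f x) + fold_right Rplus 0 (map (fun x => Re (f x)) l)).
now rewrite IH.
Qed.

Lemma Im_Csum {A} (f : A -> C) l :
  Im (Csum f l) = fold_right Rplus 0 (map (fun x => Im (f x)) l).
Proof.
unfold Csum; induction l as [|x l IH]; [reflexivity|].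
change (Im (f x) + Im (fold_right Cplus (RtoC 0) (map f l)) = Im (f x) + fold_right Rplus 0 (map (fun x => Im (f x)) l)).
now rewrite IH.
Qed.

Lemma Rfold_app (l1 l2 : list R) :
  fold_right Rplus 0 (l1 ++ l2) = fold_right Rplus 0 l1 + fold_right Rplus 0 l2.
Proof. induction l1 as [|x l1 IH]; simpl; [ring|rewrite IH; ring]. Qed.

Lemma fold_seq_sum (f : nat -> R) n :
  fold_right Rplus 0 (map f (seq 0 (S n))) = sum_f_R0 f n.
Proof.
induction n as [|n IH]; [simpl; ring|].
rewrite seq_S, map_app, Rfold_app, IH, tech5; simpl; ring.
Qed.

Lemma Csum_cons {A} (f : A -> C) x l : Csum f (x :: l) = (f x + Csum f l)%C.
Proof. reflexivity. Qed.

Lemma Csum_app {A} (f : A -> C) l1 l2 :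
  Csum f (l1 ++ l2) = (Csum f l1 + Csum f l2)%C.
Proof.
induction l1 as [|x l1 IH]; simpl app; [unfold Csum; simpl; ring|].
rewrite !Csum_cons, IH; ring.
Qed.

Lemma Csum_map {A B} (g : A -> B) (f : B -> C) l :
  Csum f (map g l) = Csum (fun x => f (g x)) l.
Proof. unfold Csum; now rewrite map_map. Qed.

Lemma Csum_flat_map {A B} (g : A -> list B) (f : B -> C) l :
  Csum f (flat_map g l) = Csum (fun x => Csum f (g x)) l.
Proof.
induction l as [|x l IH]; [reflexivity|].
simpl flat_map; now rewrite Csum_app, Csum_cons, IH.
Qed.

Lemma Csum_ext {A} (f g : A -> C) l :
  (forall x, In x l -> f x = g x) -> Csum f l = Csum g l.
Proof.
intros H; unfold Csum; f_equal; now apply map_ext_in.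
Qed.

Lemma Csum_plus {A} (f g : A -> C) l :
  Csum (fun x => f x + g x)%C l = (Csum f l + Csum g l)%C.
Proof.
induction l as [|x l IH]; [unfold Csum; simpl; ring|].
rewrite !Csum_cons, IH; ring.
Qed.

Lemma Csum_scal {A} (c : C) (f : A -> C) l :
  Csum (fun x => c * f x)%C l = (c * Csum f l)%C.
Proof.
induction l as [|x l IH]; [unfold Csum; simpl; ring|].
rewrite !Csum_cons, IH; ring.
Qed.

Lemma Csum_zero {A} (f : A -> C) l :
  (forall x, In x l -> f x = RtoC 0) -> Csum f l = RtoC 0.
Proof.
intros H; rewrite (Csum_ext f (fun _ => RtoC 0)); [|assumption].
induction l as [|x l IH]; [reflexivity|].
rewrite Csum_cons, IH; [ring|]; intros; apply H; now right.
Qed.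

Lemma Csum_swap {A B} (f : A -> B -> C) la lb :
  Csum (fun x => Csum (f x) lb) la = Csum (fun y => Csum (fun x => f x y) la) lb.
Proof.
induction la as [|x la IH].
- symmetry; now apply Csum_zero.
- rewrite Csum_cons, IH, <- Csum_plus; apply Csum_ext; intros; now rewrite Csum_cons.
Qed.

Lemma Csum_filter {A} (p : A -> bool) (f : A -> C) l :
  Csum f (filter p l) = Csum (fun x => if p x then f x else RtoC 0) l.
Proof.
induction l as [|x l IH]; [reflexivity|].
simpl filter; rewrite Csum_cons; destruct (p x); [rewrite Csum_cons|]; rewrite IH; ring.
Qed.

Lemma Csum_Cmod_le {A} (f : A -> C) l :
  Cmod (Csum f l) <= fold_right Rplus 0 (map (fun x => Cmod (f x)) l).
Proof.
induction l as [|x l IH]; [simpl; unfold Csum; simpl; rewrite Cmod_0; lra|].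
rewrite Csum_cons; simpl; eapply Rle_trans; [apply Cmod_triangle|lra].
Qed.

Lemma Rfold_le {A} (f g : A -> R) l :
  (forall x, In x l -> f x <= g x) ->
  fold_right Rplus 0 (map f l) <= fold_right Rplus 0 (map g l).
Proof.
induction l as [|x l IH]; intros H; simpl; [lra|].
apply Rplus_le_compat; [apply H; now left|apply IH; intros; apply H; now right].
Qed.

Lemma Csum_seq_S (f : nat -> C) a n :
  Csum f (seq a (S n)) = (Csum f (seq a n) + f (a + n)%nat)%C.
Proof. rewrite seq_S, Csum_app, Csum_cons; unfold Csum at 2; simpl; ring. Qed.

Lemma Csum_seq_shift (f : nat -> C) a n :
  Csum f (seq (S a) n) = Csum (fun j => f (S j)) (seq a n).
Proof. now rewrite <- seq_shift, Csum_map. Qed.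

(** * Complex limits and series *)

Lemma filterlim_C {T} (F : (T -> Prop) -> Prop) {FF : Filter F} (f : T -> C) (l : C) :
  filterlim f F (locally l) <->
  filterlim (fun x => Re (f x)) F (locally (Re l)) /\
  filterlim (fun x => Im (f x)) F (locally (Im l)).
Proof.
split.
- intros H; split; apply filterlim_locally; intros eps;
    generalize (proj1 (filterlim_locally f l) H eps);
    apply filter_imp; intros x Hx; apply Hx.
- intros [H1 H2]; apply filterlim_locally; intros eps.
  generalize (filter_and _ _ (proj1 (filterlim_locally _ _) H1 eps)
    (proj1 (filterlim_locally _ _) H2 eps)).
  apply filter_imp; intros x Hx; exact Hx.
Qed.

Lemma filterlim_Cmult {T} (F : (T -> Prop) -> Prop) {FF : Filter F} (f g : T -> C) (l m : C) :
  filterlim f F (locally l) -> filterlim g F (locally m) ->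
  filterlim (fun x => f x * g x)%C F (locally (l * m)%C).
Proof.
rewrite !filterlim_C by assumption; intros [f1 f2] [g1 g2]; split.
- change (filterlim (fun x => plus (mult (Re (f x)) (Re (g x))) (opp (mult (Im (f x)) (Im (g x))))) F
   (locally (plus (mult (Re l) (Re m)) (opp (mult (Im l) (Im m)))))).
  eapply filterlim_comp_2; [| |apply (filterlim_plus (V := R_NormedModule))].
  + eapply filterlim_comp_2; [exact f1|exact g1|apply (filterlim_mult (K := R_AbsRing))].
  + eapply filterlim_comp; [|apply (filterlim_opp (V := R_NormedModule))].
    eapply filterlim_comp_2; [exact f2|exact g2|apply (filterlim_mult (K := R_AbsRing))].
- change (filterlim (fun x => plus (mult (Re (f x)) (Im (g x))) (mult (Im (f x)) (Re (g x)))) F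
   (locally (plus (mult (Re l) (Im m)) (mult (Im l) (Re m))))).
  eapply filterlim_comp_2; [| |apply (filterlim_plus (V := R_NormedModule))].
  + eapply filterlim_comp_2; [exact f1|exact g2|apply (filterlim_mult (K := R_AbsRing))].
  + eapply filterlim_comp_2; [exact f2|exact g1|apply (filterlim_mult (K := R_AbsRing))].
Qed.

Lemma filterlim_Cplus {T} (F : (T -> Prop) -> Prop) {FF : Filter F} (f g : T -> C) (l m : C) :
  filterlim f F (locally l) -> filterlim g F (locally m) ->
  filterlim (fun x => f x + g x)%C F (locally (l + m)%C).
Proof.
intros Hf Hg; eapply filterlim_comp_2; [exact Hf|exact Hg|].
apply (filterlim_plus (V := C_NormedModule) l m).
Qed.

Lemma filterlim_C_0 {T} (F : (T -> Prop) -> Prop) {FF : Filter F} (f : T -> C) :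
  filterlim (fun x => Cmod (f x)) F (locally 0) -> filterlim f F (locally (RtoC 0)).
Proof.
intros H; apply filterlim_C; [assumption|].
assert (K : forall g : T -> R, (forall x, Rabs (g x) <= Cmod (f x)) -> filterlim g F (locally 0)).
{ intros g Hg; apply filterlim_locally; intros eps.
  generalize (proj1 (filterlim_locally _ _) H eps); apply filter_imp; intros x.
  unfold ball; simpl; unfold AbsRing_ball, abs, minus, plus, opp; simpl.
  rewrite !Ropp_0, !Rplus_0_r; intros Hx; eapply Rle_lt_trans; [apply Hg|].
  eapply Rle_lt_trans; [apply Rle_abs|exact Hx]. }
split; apply K; intros x; [apply re_le_Cmod|].
apply (Rle_trans _ (Rmax (Rabs (fst (f x))) (Rabs (snd (f x))))); [apply Rmax_r|apply Rmax_Cmod].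
Qed.

Lemma im_le_Cmod (z : C) : Rabs (Im z) <= Cmod z.
Proof. eapply Rle_trans; [apply Rmax_r|apply Rmax_Cmod]. Qed.

Lemma sum_n_C (a : nat -> C) n :
  sum_n (G := C_AbelianMonoid) a n = (sum_n (fun k => Re (a k)) n, sum_n (fun k => Im (a k)) n).
Proof.
induction n as [|n IH].
- rewrite !sum_O; now destruct (a O).
- rewrite !sum_Sn, IH; reflexivity.
Qed.

Notation is_Cseries := (is_series (V := C_NormedModule)).

Lemma is_Cseries_iff (a : nat -> C) (l : C) :
  is_Cseries a l <->
  is_series (fun n => Re (a n)) (Re l) /\ is_series (fun n => Im (a n)) (Im l).
Proof.
unfold is_series; rewrite filterlim_C by apply eventually_filter.
split; intros [H1 H2]; split.
- eapply filterlim_ext; [|exact H1]; intros n; exact (f_equal fst (sum_n_C a n)).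
- eapply filterlim_ext; [|exact H2]; intros n; exact (f_equal snd (sum_n_C a n)).
- eapply filterlim_ext; [|exact H1]; intros n; exact (f_equal fst (eq_sym (sum_n_C a n))).
- eapply filterlim_ext; [|exact H2]; intros n; exact (f_equal snd (eq_sym (sum_n_C a n))).
Qed.

Lemma CSeries_unique (a : nat -> C) l : is_Cseries a l -> CSeries a = l.
Proof.
intros H; apply is_Cseries_iff in H; destruct H as [H1 H2].
unfold CSeries; rewrite (is_series_unique _ _ H1), (is_series_unique _ _ H2).
now destruct l.
Qed.

Lemma CSeries_ext (a b : nat -> C) : (forall n, a n = b n) -> CSeries a = CSeries b.
Proof. intros H; unfold CSeries; f_equal; apply Series_ext; intros; now rewrite H. Qed.

Lemma Cseries_correct (a : nat -> C) :
  ex_series (fun n => Cmod (a n)) -> is_Cseries a (CSeries a).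
Proof.
intros H.
assert (Hex : ex_series (V := C_NormedModule) a).
{ apply (ex_series_le (V := C_CompleteNormedModule) a (fun n => Cmod (a n))); [|exact H].
  intros n; apply Rle_refl. }
destruct Hex as [l Hl]; now rewrite (CSeries_unique _ _ Hl).
Qed.

(** The factor 2 comes from bounding real and imaginary parts separately. *)
Lemma Cmod_CSeries_le (a : nat -> C) (b : nat -> R) :
  (forall n, Cmod (a n) <= b n) -> ex_series b -> Cmod (CSeries a) <= 2 * Series b.
Proof.
intros H Hb.
assert (K : forall g : nat -> R, (forall n, Rabs (g n) <= Cmod (a n)) -> Rabs (Series g) <= Series b).
{ intros g Hg.
  assert (E : ex_series (fun n => Rabs (g n))).
  { apply (ex_series_le (K := R_AbsRing) (V := R_CompleteNormedModule) _ b); [|exact Hb].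
    intros n; unfold norm; simpl; unfold abs; simpl; rewrite Rabs_Rabsolu.
    eapply Rle_trans; [apply Hg|apply H]. }
  eapply Rle_trans; [now apply Series_Rabs|].
  apply Series_le; [|exact Hb]; intros n; split; [apply Rabs_pos|].
  eapply Rle_trans; [apply Hg|apply H]. }
pose proof (K _ (fun n => re_le_Cmod (a n))).
pose proof (K _ (fun n => im_le_Cmod (a n))).
replace (CSeries a) with (RtoC (Re (CSeries a)) + Ci * RtoC (Im (CSeries a)))%C.
2:{ unfold CSeries, Ci, RtoC, Cplus, Cmult; simpl; f_equal; ring. }
eapply Rle_trans; [apply Cmod_triangle|].
rewrite Cmod_mult, !Cmod_R.
replace (Cmod Ci) with 1 by (unfold Cmod, Ci; simpl; rewrite <- sqrt_1 at 1; f_equal; ring).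
unfold CSeries; simpl; lra.
Qed.

Lemma is_Cseries_plus (a b : nat -> C) la lb :
  is_Cseries a la -> is_Cseries b lb -> is_Cseries (fun n => a n + b n)%C (la + lb)%C.
Proof. exact (is_series_plus (V := C_NormedModule) a b la lb). Qed.

Lemma is_Cseries_scal (c : C) (a : nat -> C) l :
  is_Cseries a l -> is_Cseries (fun n => c * a n)%C (c * l)%C.
Proof. exact (is_series_scal_l (V := C_NormedModule) c a l). Qed.

Lemma is_Cseries_ext (a b : nat -> C) l :
  (forall n, a n = b n) -> is_Cseries a l -> is_Cseries b l.
Proof. exact (is_series_ext (V := C_NormedModule) a b l). Qed.

Lemma is_Cseries_eq (a : nat -> C) l m : is_Cseries a l -> is_Cseries a m -> l = m.
Proof. intros H1 H2; now rewrite <- (CSeries_unique _ _ H1), (CSeries_unique _ _ H2). Qed.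

Lemma Csum_is_sum_n (a : nat -> C) n :
  Csum a (seq 0 (S n)) = sum_n (G := C_AbelianMonoid) a n.
Proof.
induction n as [|n IH].
- rewrite sum_O; unfold Csum; simpl; ring.
- rewrite Csum_seq_S, sum_Sn, IH; reflexivity.
Qed.

Lemma is_Cseries_Csum (a : nat -> C) l :
  is_Cseries a l <-> filterlim (fun n => Csum a (seq 0 n)) eventually (locally l).
Proof.
split; intros H.
- assert (H' : filterlim (fun n => Csum a (seq 0 (S n))) eventually (locally l)).
  { eapply filterlim_ext; [|exact H]; intros n; now rewrite Csum_is_sum_n. }
  intros P HP; destruct (H' P HP) as [N HN]; exists (S N); intros [|n] Hn; [lia|].
  apply HN; lia.
- eapply filterlim_ext; [intros n; apply Csum_is_sum_n|].
  intros P HP; destruct (H P HP) as [N HN]; exists N; intros n Hn; apply HN; lia.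
Qed.

(** * Cauchy products and dominated convergence of series *)

Definition Cconv (a b : nat -> C) (n : nat) : C :=
  Csum (fun k => a k * b (n - k)%nat)%C (seq 0 (S n)).

Lemma ex_series_Rabs_le (f g : nat -> R) :
  (forall n, Rabs (f n) <= g n) -> ex_series g -> ex_series (fun n => Rabs (f n)).
Proof.
intros H Hg; apply (ex_series_le (K := R_AbsRing) (V := R_CompleteNormedModule) _ g); [|exact Hg].
intros n; unfold norm; simpl; unfold abs; simpl; rewrite Rabs_Rabsolu; apply H.
Qed.

Lemma ex_series_pos_le (f g : nat -> R) :
  (forall n, 0 <= f n <= g n) -> ex_series g -> ex_series f.
Proof.
intros H Hg; apply ex_series_Rabs, (ex_series_Rabs_le _ g); [|exact Hg].
intros n; rewrite Rabs_pos_eq; apply H.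
Qed.

(** The real Cauchy product theorem is applied to the four products of real and imaginary parts. *)
Lemma is_Cseries_conv (a b : nat -> C) la lb :
  ex_series (fun n => Cmod (a n)) -> ex_series (fun n => Cmod (b n)) ->
  is_Cseries a la -> is_Cseries b lb -> is_Cseries (Cconv a b) (la * lb)%C.
Proof.
intros Aa Ab Ha Hb; apply is_Cseries_iff in Ha; apply is_Cseries_iff in Hb.
destruct Ha as [a1 a2], Hb as [b1 b2].
assert (Ra := ex_series_Rabs_le _ _ (fun n => re_le_Cmod (a n)) Aa).
assert (Ia := ex_series_Rabs_le _ _ (fun n => im_le_Cmod (a n)) Aa).
assert (Rb := ex_series_Rabs_le _ _ (fun n => re_le_Cmod (b n)) Ab).
assert (Ib := ex_series_Rabs_le _ _ (fun n => im_le_Cmod (b n)) Ab).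
apply is_Cseries_iff; split.
- generalize (is_series_minus _ _ _ _ (is_series_mult _ _ _ _ a1 b1 Ra Rb)
    (is_series_mult _ _ _ _ a2 b2 Ia Ib)).
  apply is_series_ext; intros n; unfold Cconv; rewrite Re_Csum, fold_seq_sum.
  unfold minus, plus, opp; simpl; fold (Rminus (sum_f_R0 (fun k => Re (a k) * Re (b (n-k)%nat)) n) (sum_f_R0 (fun k => Im (a k) * Im (b (n-k)%nat)) n)).
  now rewrite <- minus_sum.
- generalize (is_series_plus _ _ _ _ (is_series_mult _ _ _ _ a1 b2 Ra Ib)
    (is_series_mult _ _ _ _ a2 b1 Ia Rb)).
  apply is_series_ext; intros n; unfold Cconv; rewrite Im_Csum, fold_seq_sum.
  unfold plus; simpl; now rewrite <- plus_sum.
Qed.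

(** Submultiplicativity of the l1 norm under convolution; it makes power series with absolutely
    summable coefficients an algebra. *)
Lemma ex_series_Cmod_conv (a b : nat -> C) :
  ex_series (fun n => Cmod (a n)) -> ex_series (fun n => Cmod (b n)) ->
  ex_series (fun n => Cmod (Cconv a b n)) /\
  Series (fun n => Cmod (Cconv a b n)) <=
    Series (fun n => Cmod (a n)) * Series (fun n => Cmod (b n)).
Proof.
intros Aa Ab.
assert (H : is_series (fun n => sum_f_R0 (fun k => Cmod (a k) * Cmod (b (n - k)%nat)) n)
   (Series (fun n => Cmod (a n)) * Series (fun n => Cmod (b n)))).
{ apply (is_series_mult _ _ _ _ (Series_correct _ Aa) (Series_correct _ Ab)).
  - eapply ex_series_ext; [|exact Aa]; intros; now rewrite Rabs_pos_eq; [|apply Cmod_ge_0].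
  - eapply ex_series_ext; [|exact Ab]; intros; now rewrite Rabs_pos_eq; [|apply Cmod_ge_0]. }
assert (L : forall n, 0 <= Cmod (Cconv a b n) <= sum_f_R0 (fun k => Cmod (a k) * Cmod (b (n - k)%nat)) n).
{ intros n; split; [apply Cmod_ge_0|].
  unfold Cconv; eapply Rle_trans; [apply Csum_Cmod_le|].
  rewrite fold_seq_sum; apply Req_le, sum_eq; intros; apply Cmod_mult. }
split.
- eapply ex_series_pos_le; [exact L|]; eexists; exact H.
- rewrite <- (is_series_unique _ _ H); apply Series_le; [exact L|]; eexists; exact H.
Qed.

(** Dominated convergence for series along an arbitrary filter, so that one statement serves both
    for truncations tending to infinity and for an endpoint tending to 1 from the left. *)
Lemma tannery {T} (F : (T -> Prop) -> Prop) {FF : ProperFilter F}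
    (c : T -> nat -> R) (l M : nat -> R) :
  (forall k, filterlim (fun x => c x k) F (locally (l k))) ->
  F (fun x => forall k, Rabs (c x k) <= M k) -> ex_series M ->
  (forall k, Rabs (l k) <= M k) /\
  filterlim (fun x => Series (c x)) F (locally (Series l)).
Proof.
intros Hl HM EM.
assert (lM : forall k, Rabs (l k) <= M k).
{ intros k; apply (filterlim_le (F := F) (fun x => Rabs (c x k)) (fun _ => M k) (Rabs (l k)) (M k)).
  - revert HM; apply filter_imp; intros x Hx; apply Hx.
  - apply (filterlim_comp _ _ _ (fun x => c x k) Rabs _ (locally (l k))); [apply Hl|].
    apply (continuous_Rabs (l k)).
  - apply filterlim_const. }
split; [exact lM|].
apply filterlim_locally; intros eps.
assert (M0 : forall k, 0 <= M k) by (intros k; eapply Rle_trans; [apply Rabs_pos|apply lM]).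
pose proof (Series_correct _ EM) as HSM; set (SM := Series M) in HSM.
assert (Hsm : is_series M SM) by exact HSM.
assert (e8 : 0 < eps / 8) by (destruct eps; simpl; lra).
assert (e4 : 0 < eps / 4) by (destruct eps; simpl; lra).
(* [N] splits head from tail: the head contributes less than [eps / 4], the tail at most twice a
   tail of [M] that is below [eps / 8]. *)
destruct (proj1 (filterlim_locally _ _) HSM (mkposreal _ e8)) as [N HN]; specialize (HN N (Nat.le_refl N)).
assert (Hfin : F (fun x => sum_n (fun k => Rabs (c x k - l k)) N < eps / 4)).
{ assert (Hf : filterlim (fun x => sum_n (fun k => Rabs (c x k - l k)) N) F (locally 0)).
  { clear HN; induction N as [|N IH].
    - apply (filterlim_ext (fun x => Rabs (c x O - l O))); [intros x; now rewrite sum_O|].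
      assert (H0 : filterlim (fun x => plus (c x O) (opp (l O))) F (locally 0)).
      { replace 0 with (plus (l O) (opp (l O))) by (unfold plus, opp; simpl; ring).
        eapply filterlim_comp_2; [apply Hl|apply filterlim_const|].
        apply (filterlim_plus (V := R_NormedModule)). }
      rewrite <- Rabs_R0; eapply filterlim_comp; [exact H0|apply (continuous_Rabs 0)].
    - apply (filterlim_ext (fun x => plus (sum_n (fun k => Rabs (c x k - l k)) N) (Rabs (c x (S N) - l (S N))))); [intros x; now rewrite sum_Sn|].
      replace 0 with (plus 0 0) by (unfold plus; simpl; ring).
      eapply filterlim_comp_2; [exact IH| |apply (filterlim_plus (V := R_NormedModule))].
      assert (H0 : filterlim (fun x => plus (c x (S N)) (opp (l (S N)))) F (locally 0)).
      { replace 0 with (plus (l (S N)) (opp (l (S N)))) by (unfold plus, opp; simpl; ring).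
        eapply filterlim_comp_2; [apply Hl|apply filterlim_const|].
        apply (filterlim_plus (V := R_NormedModule)). }
      rewrite <- Rabs_R0; eapply filterlim_comp; [exact H0|apply (continuous_Rabs 0)]. }
  generalize (proj1 (filterlim_locally _ _) Hf (mkposreal _ e4)).
  apply filter_imp; intros x Hx; simpl in Hx.
  unfold ball in Hx; simpl in Hx; unfold AbsRing_ball, abs, minus, plus, opp in Hx; simpl in Hx.
  rewrite Ropp_0, Rplus_0_r in Hx; eapply Rle_lt_trans; [apply Rle_abs|exact Hx]. }
generalize (filter_and _ _ HM Hfin); apply filter_imp; clear HM Hfin Hl.
intros x [Hx Hs].
assert (Ec : ex_series (fun k => Rabs (c x k))) by (apply (ex_series_Rabs_le _ M); [exact Hx|exact EM]).
assert (El : ex_series (fun k => Rabs (l k))) by (apply (ex_series_Rabs_le _ M); [exact lM|exact EM]).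
assert (Ed : ex_series (fun k => Rabs (c x k - l k))).
{ apply (ex_series_Rabs_le _ (fun k => M k + M k)).
  - intros k; unfold Rminus; eapply Rle_trans; [apply Rabs_triang|].
    rewrite Rabs_Ropp; specialize (Hx k); specialize (lM k); lra.
  - apply (ex_series_plus M M); exact EM. }
unfold ball; simpl; unfold AbsRing_ball, abs, minus, plus, opp; simpl.
fold (Rminus (Series (c x)) (Series l)); rewrite <- Series_minus; [|now apply ex_series_Rabs|now apply ex_series_Rabs].
eapply Rle_lt_trans; [now apply Series_Rabs|].
rewrite (Series_incr_n _ (S N)); [|lia|exact Ed].
simpl Init.Nat.pred; rewrite <- sum_n_Reals.
assert (Htail : Series (fun k => Rabs (c x (S N + k)%nat - l (S N + k)%nat)) <= 2 * (SM - sum_n M N)).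
{ assert (Hm : is_series (fun k => M (S N + k)%nat) (SM - sum_n M N)).
  { apply (is_series_incr_n M (S N)); [lia|]; simpl Init.Nat.pred.
    replace (plus _ _) with SM; [exact Hsm|].
    change (SM = (SM - sum_n M N) + sum_n M N); ring. }
  rewrite <- (is_series_unique _ _ Hm), <- Series_scal_l.
  apply Series_le; [|apply (ex_series_scal_l (V := R_NormedModule) 2); eexists; exact Hm].
  intros k; split; [apply Rabs_pos|].
  unfold Rminus; eapply Rle_trans; [apply Rabs_triang|].
  rewrite Rabs_Ropp.
  specialize (Hx (S N + k)%nat); specialize (lM (S N + k)%nat); simpl in *; lra. }
assert (HN' : Rabs (sum_n M N - SM) < eps / 8) by exact HN.
apply Rabs_def2 in HN'; destruct HN'; lra.
Qed.

Lemma Ctannery {T} (F : (T -> Prop) -> Prop) {FF : ProperFilter F}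
    (c : T -> nat -> C) (l : nat -> C) (M : nat -> R) :
  (forall k, filterlim (fun x => c x k) F (locally (l k))) ->
  F (fun x => forall k, Cmod (c x k) <= M k) -> ex_series M ->
  filterlim (fun x => CSeries (c x)) F (locally (CSeries l)).
Proof.
intros Hl HM EM.
apply filterlim_C; [apply FF|].
assert (Hl' : forall k, _) by (intros k; exact (proj1 (filterlim_C F _ _) (Hl k))).
split.
- apply (tannery F (fun x k => Re (c x k)) (fun k => Re (l k)) M); [intros k; apply Hl'| |exact EM].
  revert HM; apply filter_imp; intros x Hx k; eapply Rle_trans; [apply re_le_Cmod|apply Hx].
- apply (tannery F (fun x k => Im (c x k)) (fun k => Im (l k)) M); [intros k; apply Hl'| |exact EM].
  revert HM; apply filter_imp; intros x Hx k; eapply Rle_trans; [apply im_le_Cmod|apply Hx].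
Qed.

(** * Raabe's test *)

Lemma INR_ge_eventually (x : R) : exists N : nat, forall n, (N <= n)%nat -> x <= INR n.
Proof.
destruct (nfloor_ex (Rmax x 0) (Rmax_r _ _)) as [N [_ HN]].
exists (S N); intros n Hn; apply le_INR in Hn; rewrite S_INR in Hn.
pose proof (Rmax_l x 0); lra.
Qed.

Lemma ex_series_bounded (a : nat -> R) (M : R) :
  (forall n, 0 <= a n) -> (forall n, sum_n a n <= M) -> ex_series a /\ Series a <= M.
Proof.
intros H0 HM.
assert (Hinc : forall n, sum_n a n <= sum_n a (S n)).
{ intros n; rewrite sum_Sn; unfold plus; simpl; specialize (H0 (S n)); lra. }
destruct (ex_finite_lim_seq_incr (sum_n a) M Hinc HM) as [l Hl].
assert (Hs : is_series a l) by exact Hl.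
split; [now exists l|].
rewrite (is_series_unique _ _ Hs).
apply (is_lim_seq_le (sum_n a) (fun _ => M) l M); [exact HM|exact Hl|apply is_lim_seq_const].
Qed.

(** The hypothesis says [delta * a k <= k * a k - (k + 1) * a (k + 1)]. Telescoping bounds the
    partial sums; moreover [k * a k] is eventually decreasing, which together with summability
    forces it to 0. *)
Lemma raabe (a : nat -> R) (delta : R) (K : nat) :
  0 < delta -> (forall k, 0 <= a k) ->
  (forall k, (K <= k)%nat -> INR (S k) * a (S k) <= (INR k - delta) * a k) ->
  ex_series a /\ is_lim_seq (fun k => INR k * a k) 0.
Proof.
intros Hd H0 HK.
assert (Ea : ex_series a).
{ apply (ex_series_incr_n (V := R_NormedModule) a K).
  apply (ex_series_bounded _ (INR K * a K / delta)); [intros n; apply H0|].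
  intros n.
  assert (B : delta * sum_n (fun k => a (K + k)%nat) n <= INR K * a K - INR (K + S n) * a (K + S n)%nat).
  { induction n as [|n IH].
    - rewrite sum_O, Nat.add_0_r.
      replace (K + 1)%nat with (S K) by lia; specialize (HK K (Nat.le_refl _)); lra.
    - rewrite sum_Sn; unfold plus; simpl Hierarchy.AbelianMonoid.plus.
      change (delta * (sum_n (fun k => a (K + k)%nat) n + a (K + S n)%nat) <= INR K * a K - INR (K + S (S n)) * a (K + S (S n))%nat).
      replace (K + S (S n))%nat with (S (K + S n)) by lia.
      specialize (HK (K + S n)%nat ltac:(lia)); lra. }
  apply (Rmult_le_reg_l delta); [exact Hd|].
  eapply Rle_trans; [exact B|].
  replace (delta * (INR K * a K / delta)) with (INR K * a K) by (field; lra).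
  pose proof (Rmult_le_pos _ _ (pos_INR (K + S n)) (H0 (K + S n)%nat)); lra. }
split; [exact Ea|].
assert (Hmon : forall j k, (K <= j)%nat -> (j <= k)%nat -> INR k * a k <= INR j * a j).
{ intros j k Hj Hk; induction Hk as [|k Hk IH]; [lra|].
  specialize (HK k ltac:(lia)); pose proof (Rmult_le_pos _ _ (Rlt_le _ _ Hd) (H0 k)); lra. }
(* dyadic blocks: for decreasing [k a_k], the block from n+1 to 2n is at least (2n a_2n)/2 *)
assert (Hblock : forall n m, (K <= n)%nat -> (1 <= n)%nat -> (m <= n)%nat ->
   INR m * a (2 * n)%nat <= sum_n a (n + m) - sum_n a n).
{ intros n m Hn H1; induction m as [|m IH]; intros Hm.
  - rewrite Nat.add_0_r; simpl; lra.
  - replace (n + S m)%nat with (S (n + m)) by lia; rewrite sum_Sn, S_INR.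
    change (plus (sum_n a (n + m)) (a (S (n + m)))) with (sum_n a (n + m) + a (S (n + m))).
    specialize (IH ltac:(lia)).
    assert (a (2 * n)%nat <= a (S (n + m))).
    { pose proof (Hmon (S (n + m)) (2 * n)%nat ltac:(lia) ltac:(lia)) as Hb.
      pose proof (le_INR (S (n+m)) (2 * n) ltac:(lia)).
      pose proof (lt_0_INR (S (n + m)) ltac:(lia)).
      pose proof (H0 (2 * n)%nat).
      apply (Rmult_le_reg_l (INR (S (n + m)))); [lra|]. nra. }
    lra. }
apply is_lim_seq_spec; intros eps.
destruct Ea as [l Hl].
assert (e4 : 0 < eps / 4) by (destruct eps; simpl; lra).
destruct (proj1 (filterlim_locally _ _) Hl (mkposreal _ e4)) as [N HN].
assert (HN' : forall n, (N <= n)%nat -> Rabs (sum_n a n - l) < eps / 4) by exact HN.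
set (n := S (N + K)).
exists (2 * n)%nat; intros k Hk.
pose proof (Hblock n n ltac:(lia) ltac:(lia) (Nat.le_refl n)) as Hb.
pose proof (Rabs_def2 _ _ (HN' n ltac:(lia))).
pose proof (Rabs_def2 _ _ (HN' (n + n)%nat ltac:(lia))).
pose proof (Hmon (2 * n)%nat k ltac:(lia) Hk) as Hm.
rewrite mult_INR in Hm; simpl (INR 2) in Hm.
pose proof (Rmult_le_pos _ _ (pos_INR k) (H0 k)).
rewrite Rminus_0_r, Rabs_pos_eq by assumption; lra.
Qed.

(** The imaginary part changes the modulus only by [O(1 / n)]: after squaring,
    [Im p ^ 2 <= 2 * eps * (n + Re p)] is enough. *)
Lemma Cmod_plus_INR_le (p : C) (eps : R) : 0 < eps ->
  exists N : nat, forall n, (N <= n)%nat -> 0 <= INR n + Re p + eps /\ Cmod (p + RtoC (INR n)) <= INR n + Re p + eps.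
Proof.
intros He; destruct (INR_ge_eventually (Rabs (Re p) + Im p ^ 2 / (2 * eps))) as [N HN].
exists N; intros n Hn; specialize (HN n Hn).
assert (0 <= Im p ^ 2 / (2 * eps)).
{ apply Rmult_le_pos; [apply pow2_ge_0|apply Rlt_le, Rinv_0_lt_compat; lra]. }
assert (- Re p <= Rabs (Re p)) by (rewrite <- Rabs_Ropp; apply Rle_abs).
split; [lra|].
unfold Cmod; rewrite <- (sqrt_pow2 (INR n + Re p + eps)) by lra.
apply sqrt_le_1_alt; destruct p as [x y]; simpl in *.
rewrite !Rmult_1_r in *.
assert (y * y <= 2 * eps * (INR n + x)).
{ replace (y * y) with (2 * eps * (y * y / (2 * eps))) by (field; lra).
  apply Rmult_le_compat_l; lra. }
rewrite Rplus_0_r; nra.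
Qed.

Lemma Cmod_plus_INR_ge (q : C) n : INR n + Re q <= Cmod (q + RtoC (INR n)).
Proof.
eapply Rle_trans; [|apply re_le_Cmod]; eapply Rle_trans; [|apply Rle_abs].
destruct q; simpl; lra.
Qed.

Lemma raabe_ratio (a : nat -> R) (p1 p2 q1 q2 : C) :
  (forall n, 0 <= a n) ->
  (forall n, a (S n) * (Cmod (q1 + RtoC (INR n)) * Cmod (q2 + RtoC (INR n))) =
             a n * (Cmod (p1 + RtoC (INR n)) * Cmod (p2 + RtoC (INR n)))) ->
  Re p1 + Re p2 + 1 < Re q1 + Re q2 ->
  ex_series a /\ is_lim_seq (fun k => INR k * a k) 0.
Proof.
intros H0 Hr Hlt.
(* The excess is [4 * eps]: one [eps] for each numerator modulus, one for the [delta] of Raabe's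
   test, and one left over as leading coefficient of the quadratic below. *)
set (eps := (Re q1 + Re q2 - Re p1 - Re p2 - 1) / 4).
assert (He : 0 < eps) by (unfold eps; lra).
destruct (Cmod_plus_INR_le p1 eps He) as [N1 H1].
destruct (Cmod_plus_INR_le p2 eps He) as [N2 H2].
destruct (INR_ge_eventually (1 + eps + Rabs (Re q1) + Rabs (Re q2))) as [N3 H3].
(* [B] and [D] are the lower coefficients of that quadratic [eps * k ^ 2 + B * k + D], the
   difference of the two sides of [Hpoly]; [N4] makes it nonnegative. *)
set (B := - eps * (Re q1 + Re q2) + Re q1 * Re q2
  - (Re p1 + eps) * (Re p2 + eps) - (Re p1 + eps + Re p2 + eps)).
set (D := - eps * (Re q1 * Re q2) - (Re p1 + eps) * (Re p2 + eps)).
destruct (INR_ge_eventually ((Rabs B + Rabs D) / eps + 1)) as [N4 H4].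
apply (raabe a eps (N1 + N2 + N3 + N4)); [exact He|exact H0|].
intros k Hk.
destruct (H1 k ltac:(lia)) as [H1a H1b]; destruct (H2 k ltac:(lia)) as [H2a H2b].
specialize (H3 k ltac:(lia)); specialize (H4 k ltac:(lia)).
pose proof (Cmod_plus_INR_ge q1 k) as G1; pose proof (Cmod_plus_INR_ge q2 k) as G2.
pose proof (Rle_abs (- Re q1)) as A1; pose proof (Rle_abs (- Re q2)) as A2; rewrite Rabs_Ropp in A1, A2.
pose proof (Rabs_pos (Re q1)); pose proof (Rabs_pos (Re q2)).
specialize (Hr k); specialize (H0 k).
assert (Hpoly : (INR k + Re p1 + eps) * (INR k + Re p2 + eps) * (INR k + 1)
   <= (INR k - eps) * ((INR k + Re q1) * (INR k + Re q2))).
{ assert (Hq : 0 <= eps * INR k ^ 2 + B * INR k + D).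
  { pose proof (Rle_abs (- B)) as AB; pose proof (Rle_abs (- D)) as AD; rewrite Rabs_Ropp in AB, AD.
    assert (HH : Rabs B + Rabs D + eps <= eps * INR k).
    { replace (Rabs B + Rabs D + eps) with (eps * ((Rabs B + Rabs D) / eps + 1)) by (field; lra).
      apply Rmult_le_compat_l; lra. }
    pose proof (Rabs_pos B); pose proof (Rabs_pos D).
    assert (1 <= INR k) by lra. nra. }
  assert (Hid : (INR k - eps) * ((INR k + Re q1) * (INR k + Re q2)) -
     (INR k + Re p1 + eps) * (INR k + Re p2 + eps) * (INR k + 1)
     = eps * INR k ^ 2 + B * INR k + D).
  { unfold B, D; replace (Re q1) with (4 * eps + Re p1 + Re p2 + 1 - Re q2) by (unfold eps; field); ring. }
  lra. }
set (Q := Cmod (q1 + RtoC (INR k)) * Cmod (q2 + RtoC (INR k))) in *.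
assert (HQ : (INR k + Re q1) * (INR k + Re q2) <= Q).
{ unfold Q; apply Rmult_le_compat; lra. }
assert (HQ0 : 0 < (INR k + Re q1) * (INR k + Re q2)) by (apply Rmult_lt_0_compat; lra).
assert (HP : Cmod (p1 + RtoC (INR k)) * Cmod (p2 + RtoC (INR k)) <= (INR k + Re p1 + eps) * (INR k + Re p2 + eps)).
{ apply Rmult_le_compat; try assumption; apply Cmod_ge_0. }
set (P := Cmod (p1 + RtoC (INR k)) * Cmod (p2 + RtoC (INR k))) in *.
apply (Rmult_le_reg_r Q); [lra|].
rewrite S_INR.
replace ((INR k + 1) * a (S k) * Q) with ((INR k + 1) * (a (S k) * Q)) by ring; rewrite Hr.
replace ((INR k + 1) * (a k * P)) with (a k * (P * (INR k + 1))) by ring.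
replace ((INR k - eps) * a k * Q) with (a k * ((INR k - eps) * Q)) by ring.
apply Rmult_le_compat_l; [exact H0|].
apply (Rle_trans _ ((INR k + Re p1 + eps) * (INR k + Re p2 + eps) * (INR k + 1))).
{ apply Rmult_le_compat_r; lra. }
eapply Rle_trans; [exact Hpoly|apply Rmult_le_compat_l; lra].
Qed.

(** * A contiguous relation for [3F2] at 1 *)

Definition no_pole (d : C) : Prop := forall n : nat, (d + RtoC (INR n) <> 0)%C.

Lemma no_pole_Re (d : C) : 0 < Re d -> no_pole d.
Proof.
intros H n E; pose proof (Cmod_plus_INR_ge d n) as G; rewrite E, Cmod_0 in G.
pose proof (pos_INR n); lra.
Qed.

Lemma no_pole_plus (d : C) k : no_pole d -> no_pole (d + RtoC (INR k)).
Proof.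
intros H n; rewrite <- Cplus_assoc, <- RtoC_plus, <- plus_INR; apply H.
Qed.

Lemma no_pole_S (d : C) : no_pole d -> no_pole (d + 1).
Proof. exact (no_pole_plus d 1). Qed.

Lemma no_pole_0 (d : C) : no_pole d -> d <> 0%C.
Proof. intros H E; apply (H 0%nat); rewrite E; simpl; ring. Qed.

Lemma poch_neq_0 (d : C) n : no_pole d -> poch d n <> 0%C.
Proof.
intros H; induction n as [|n IH]; [apply C1_nz|].
simpl; now apply Cmult_neq_0.
Qed.

Lemma poch_shift (d : C) n : (poch (d + 1) n * d = poch d n * (d + RtoC (INR n)))%C.
Proof.
induction n as [|n IH]; [simpl; ring|].
simpl poch; rewrite S_INR, RtoC_plus.
replace (poch (d + 1) n * (d + 1 + RtoC (INR n)) * d)%C with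
  ((poch (d + 1) n * d) * (d + 1 + RtoC (INR n)))%C by ring.
rewrite IH; ring.
Qed.

Lemma poch_Sl (d : C) n : poch d (S n) = (d * poch (d + 1) n)%C.
Proof. rewrite Cmult_comm, poch_shift; reflexivity. Qed.

Lemma poch_1 n : poch 1 n = RtoC (INR (fact n)).
Proof.
induction n as [|n IH]; [reflexivity|].
simpl poch; rewrite IH, fact_simpl, mult_INR, S_INR, RtoC_mult, RtoC_plus; ring.
Qed.

(** The summand of [3F2(b, c, 1; d, e; 1)], the factor [(1)_n] having cancelled [n!]. *)
Definition hyp_term (b c d e : C) (n : nat) : C :=
  (poch b n * poch c n / (poch d n * poch e n))%C.

Lemma hyp_term_S (b c d e : C) n : no_pole d -> no_pole e ->
  hyp_term b c d e (S n) =
  (hyp_term b c d e n * ((b + RtoC (INR n)) * (c + RtoC (INR n))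
     / ((d + RtoC (INR n)) * (e + RtoC (INR n)))))%C.
Proof.
intros Hd He; unfold hyp_term; simpl.
pose proof (poch_neq_0 d n Hd); pose proof (poch_neq_0 e n He).
specialize (Hd n); specialize (He n); field; tauto.
Qed.

Lemma hyp_term_raabe (b c d e : C) : no_pole d -> no_pole e ->
  Re b + Re c + 1 < Re d + Re e ->
  ex_series (fun n => Cmod (hyp_term b c d e n)) /\
  is_lim_seq (fun n => INR n * Cmod (hyp_term b c d e n)) 0.
Proof.
intros Hd He H; apply (raabe_ratio _ b c d e); [intros; apply Cmod_ge_0| |exact H].
intros n; rewrite <- !Cmod_mult, hyp_term_S by assumption; f_equal.
specialize (Hd n); specialize (He n); field; tauto.
Qed.

Lemma is_lim_seq_affine_0 (T : nat -> C) (x : C) :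
  ex_series (fun n => Cmod (T n)) -> is_lim_seq (fun n => INR n * Cmod (T n)) 0 ->
  filterlim (fun n => (x + RtoC (INR n)) * T n)%C eventually (locally (RtoC 0)).
Proof.
intros Ha Hl; apply filterlim_C_0; [apply eventually_filter|].
change (is_lim_seq (fun n => Cmod ((x + RtoC (INR n)) * T n)) 0).
apply (is_lim_seq_le_le (fun _ => 0) _ (fun n => Cmod x * Cmod (T n) + INR n * Cmod (T n))).
- intros n; split; [apply Cmod_ge_0|].
  rewrite Cmod_mult, <- Rmult_plus_distr_r; apply Rmult_le_compat_r; [apply Cmod_ge_0|].
  eapply Rle_trans; [apply Cmod_triangle|].
  rewrite Cmod_R, Rabs_pos_eq by apply pos_INR; lra.
- apply is_lim_seq_const.
- replace (Finite 0) with (Finite (Cmod x * 0 + 0)) by (f_equal; ring).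
  apply is_lim_seq_plus'; [|exact Hl].
  apply (is_lim_seq_scal_l _ (Cmod x) 0), ex_series_lim_0, Ha.
Qed.

Lemma hyp_term_Sd (b c d e : C) n : no_pole d -> no_pole e ->
  (hyp_term b c (d + 1) e n * (d + RtoC (INR n)) = hyp_term b c d e n * d)%C.
Proof.
intros Hd He; unfold hyp_term.
pose proof (poch_neq_0 d n Hd); pose proof (poch_neq_0 e n He).
pose proof (poch_neq_0 _ n (no_pole_S d Hd)).
assert (E : poch d n = (poch (d + 1) n * d / (d + RtoC (INR n)))%C).
{ rewrite poch_shift; field; apply Hd. }
pose proof (no_pole_0 d Hd); specialize (Hd n).
rewrite E; field; tauto.
Qed.

(* The relation between the summands is the difference of the Gosper certificate
   [G n = - (e + n - 1) T n]. *)
Lemma hyp_contiguous (b c d e s : C) : no_pole d -> no_pole e ->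
  s = (d + e - b - c - 1)%C -> 0 < Re s ->
  (s * CSeries (hyp_term b c d e) =
   (e - 1) + (d - b) * (d - c) / d * CSeries (hyp_term b c (d + 1) e))%C.
Proof.
intros Hd He Hs Hre.
assert (Hd1 := no_pole_S d Hd).
assert (Hre1 : Re b + Re c + 1 < Re d + Re e).
{ rewrite Hs in Hre; destruct b, c, d, e; simpl in *; lra. }
destruct (hyp_term_raabe b c d e Hd He Hre1) as [Ea Ea0].
destruct (hyp_term_raabe b c (d + 1) e Hd1 He) as [Eb _].
{ destruct d; simpl in *; lra. }
assert (La := proj1 (is_Cseries_Csum _ _) (Cseries_correct _ Ea)).
assert (Lb := proj1 (is_Cseries_Csum _ _) (Cseries_correct _ Eb)).
assert (Lg := is_lim_seq_affine_0 _ (e - 1) Ea Ea0).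
(* The telescoped sum: [e - 1] is [- G 0] and the last summand is [G N], which tends to 0 because
   [n * T n] does. *)
assert (Hfin : forall N, (s * Csum (hyp_term b c d e) (seq 0 N) =
   ((e - 1) + (d - b) * (d - c) / d * Csum (hyp_term b c (d + 1) e) (seq 0 N)) +
   (- (1)) * ((e - 1 + RtoC (INR N)) * hyp_term b c d e N))%C).
{ intros N; induction N as [|N IH].
  - unfold hyp_term, Csum; simpl; field; now apply no_pole_0.
  - rewrite !Csum_seq_S, !Nat.add_0_l, !Cmult_plus_distr_l, IH, hyp_term_S by assumption.
    assert (E : hyp_term b c (d + 1) e N = (hyp_term b c d e N * d / (d + RtoC (INR N)))%C).
    { rewrite <- hyp_term_Sd by assumption; field; apply Hd. }
    rewrite E, Hs, S_INR, RtoC_plus.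
    pose proof (no_pole_0 d Hd); specialize (Hd N); specialize (He N); field; tauto. }
assert (L1 := filterlim_Cmult _ _ _ _ _ (filterlim_const s) La).
assert (L2 := filterlim_Cplus _ _ _ _ _ (filterlim_Cplus _ _ _ _ _ (filterlim_const (e - 1)%C)
   (filterlim_Cmult _ _ _ _ _ (filterlim_const ((d - b) * (d - c) / d)%C) Lb))
   (filterlim_Cmult _ _ _ _ _ (filterlim_const (- (1))%C) Lg)).
assert (L3 := filterlim_ext _ _ (fun N => eq_sym (Hfin N)) L2).
rewrite (filterlim_locally_unique _ _ _ L1 L3); ring.
Qed.

(** Replacing [d] by [d + 1] also raises the excess [s] by one, so the factors of successive steps
    accumulate to Pochhammer symbols in [d - b], [d - c], [d] and [s]. *)
Lemma hyp_contiguous_iter (b c d e s : C) (K : nat) : no_pole d -> no_pole e ->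
  s = (d + e - b - c - 1)%C -> 0 < Re s ->
  CSeries (hyp_term b c d e) =
  ((e - 1) * Csum (fun k => poch (d - b) k * poch (d - c) k / (poch d k * poch s (S k))) (seq 0 K)
   + poch (d - b) K * poch (d - c) K / (poch d K * poch s K)
     * CSeries (hyp_term b c (d + RtoC (INR K)) e))%C.
Proof.
intros Hd He Hs Hre; induction K as [|K IH].
- simpl INR; rewrite Cplus_0_r; unfold Csum; simpl; field.
- assert (Hnp := no_pole_Re s Hre).
  assert (Hc := hyp_contiguous b c (d + RtoC (INR K)) e (s + RtoC (INR K)) (no_pole_plus d K Hd) He).
  rewrite IH, Csum_seq_S, Nat.add_0_l; clear IH.
  assert (E : CSeries (hyp_term b c (d + RtoC (INR (S K))) e) = CSeries (hyp_term b c (d + RtoC (INR K) + 1) e)).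
  { apply CSeries_ext; intros n; unfold hyp_term; now rewrite S_INR, RtoC_plus, Cplus_assoc. }
  rewrite E; clear E.
  assert (Hc' : CSeries (hyp_term b c (d + RtoC (INR K)) e) = (((e - 1) + (d + RtoC (INR K) - b) * (d + RtoC (INR K) - c) / (d + RtoC (INR K)) *
      CSeries (hyp_term b c (d + RtoC (INR K) + 1) e)) / (s + RtoC (INR K)))%C).
  { rewrite <- Hc; [field; apply Hnp| |].
    - rewrite Hs; ring.
    - rewrite re_plus, re_RtoC; pose proof (pos_INR K); lra. }
  rewrite Hc'; simpl poch.
  pose proof (poch_neq_0 d K Hd); pose proof (poch_neq_0 s K Hnp).
  specialize (Hnp K); specialize (Hd K); field; tauto.
Qed.

(** * Truncated multiple zeta values *)

Definition ztrunc (t : C) (ks : list nat) (N : nat) : C :=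
  match ks with
  | [] => RtoC 1
  | k1 :: ks' =>
      Csum (fun p => t ^ (length ks - length p) * RtoC (mzv_trunc p N))%C
           (fillings k1 ks')
  end.

(* With [ztrunc] summing over [N > m_1 >= ... >= m_n > 0] with a factor [t] per
   equality, this sums over [N >= m_1 >= ... >= m_n > 0], the case [m_1 = N]
   being given a further factor [t]. *)
Definition zjoin (t : C) (ks : list nat) (N : nat) : C :=
  (ztrunc t ks N + t * (ztrunc t ks (S N) - ztrunc t ks N))%C.

Lemma fillings_length p k ks : In p (fillings k ks) -> (1 <= length p <= S (length ks))%nat.
Proof.
revert p k; induction ks as [|k2 ks IH]; intros p k; simpl.
- intros [<-|[]]; simpl; lia.
- intros H; apply in_app_or in H; destruct H as [H|H].
  + apply in_map_iff in H; destruct H as (p' & <- & H); apply IH in H; simpl; lia.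
  + apply IH in H; lia.
Qed.

Lemma mzv_trunc_S k ks m : (1 <= m)%nat ->
  mzv_trunc (k :: ks) (S m) = mzv_trunc (k :: ks) m + / INR m ^ k * mzv_trunc ks m.
Proof.
intros Hm; destruct m as [|m]; [lia|].
cbn [mzv_trunc]; change (pred (S (S m))) with (S m); change (pred (S m)) with m.
rewrite sum_n_Sm by lia; reflexivity.
Qed.

Lemma mzv_trunc_1 k ks : mzv_trunc (k :: ks) 1 = 0.
Proof. cbn [mzv_trunc]; rewrite sum_n_m_zero by (simpl; lia); reflexivity. Qed.

Lemma mzv_trunc_0 k ks : mzv_trunc (k :: ks) 0 = 0.
Proof. cbn [mzv_trunc]; rewrite sum_n_m_zero by (simpl; lia); reflexivity. Qed.

Lemma ztrunc_cons2 t k k2 ks N :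
  ztrunc t (k :: k2 :: ks) N =
  (Csum (fun p => t ^ (length (k2 :: ks) - length p) * RtoC (mzv_trunc (k :: p) N)) (fillings k2 ks)
   + t * ztrunc t ((k + k2)%nat :: ks) N)%C.
Proof.
unfold ztrunc; simpl fillings; rewrite Csum_app, Csum_map; f_equal.
rewrite <- Csum_scal; apply Csum_ext; intros p Hp; apply fillings_length in Hp.
cbn [length]; replace (S (S (length ks)) - length p)%nat with (S (S (length ks) - length p)) by lia.
simpl Cpow; ring.
Qed.

(** Only the terms whose largest index is [m] are new. A comma after [k] leaves the other indices
    below [m]; a plus sign merges [k] with [k2], so that [m] occurs again with a factor [t]. [zjoin]
    collects both cases. *)
Lemma ztrunc_S t k ks m : (1 <= m)%nat ->
  ztrunc t (k :: ks) (S m) =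
  (ztrunc t (k :: ks) m + RtoC (/ INR m ^ k) * zjoin t ks m)%C.
Proof.
intros Hm; revert k; induction ks as [|k2 ks IH]; intros k.
- unfold zjoin, ztrunc; unfold Csum; cbn [map fold_right fillings length].
  rewrite mzv_trunc_S, RtoC_plus, RtoC_mult by assumption; cbn [mzv_trunc]; simpl Cpow; ring.
- rewrite !ztrunc_cons2, IH; unfold zjoin at 2; rewrite (IH k2).
  rewrite (Csum_ext _ (fun p => t ^ (length (k2 :: ks) - length p) * RtoC (mzv_trunc (k :: p) m) +
     RtoC (/ INR m ^ k) * (t ^ (length (k2 :: ks) - length p) * RtoC (mzv_trunc p m)))%C).
  2:{ intros p _; rewrite mzv_trunc_S, RtoC_plus, RtoC_mult by assumption; ring. }
  rewrite Csum_plus, Csum_scal.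
  change (Csum _ _) with (ztrunc t (k2 :: ks) m) at 2.
  rewrite pow_add, Rinv_mult, RtoC_mult; ring.
Qed.

Lemma ztrunc_1 t k ks : ztrunc t (k :: ks) 1 = RtoC 0.
Proof.
apply Csum_zero; intros p Hp; apply fillings_length in Hp.
destruct p as [|k' p]; [simpl in Hp; lia|]; rewrite mzv_trunc_1; ring.
Qed.

(** * Square-root bounds for truncated sums *)

Lemma sqrt_step (n : nat) :
  / INR (S n) * sqrt (INR (S n)) <= 2 * (sqrt (INR (S n)) - sqrt (INR n)).
Proof.
pose proof (lt_0_INR (S n) ltac:(lia)) as H1; pose proof (pos_INR n) as H0.
rewrite S_INR in *; set (x := INR n) in *.
pose proof (sqrt_lt_R0 _ H1) as S1; pose proof (sqrt_pos x) as S0.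
pose proof (sqrt_sqrt _ (Rlt_le _ _ H1)) as E1; pose proof (sqrt_sqrt _ H0) as E0.
assert (sqrt x <= sqrt (x + 1)) by (apply sqrt_le_1_alt; lra).
set (p := sqrt (x + 1)) in *; set (q := sqrt x) in *.
apply (Rmult_le_reg_l (x + 1)); [exact H1|].
replace ((x + 1) * (/ (x + 1) * p)) with p by (field; lra).
assert (p = p * ((p - q) * (p + q))) by (replace ((p - q) * (p + q)) with (p * p - q * q) by ring; rewrite E1, E0; ring).
assert (0 <= (p - q) * (p - q)) by apply Rle_0_sqr.
rewrite <- E1; nra.
Qed.

(** Comparison of [m^(-3/2)] with a difference of [m^(-1/2)]. The constant 4 works because
    [p * (p + q) <= 2 * (x + 1) <= 4 * x] for [p = sqrt (x + 1)], [q = sqrt x] and [x >= 1]. *)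
Lemma sqrt_inv_step (n : nat) :
  / INR (S n) ^ 2 * sqrt (INR (S n)) <= 4 * (/ sqrt (INR (S n)) - / sqrt (INR (S (S n)))).
Proof.
pose proof (lt_0_INR (S n) ltac:(lia)) as H1; pose proof (pos_INR n) as H0.
rewrite (S_INR (S n)), S_INR in *; set (x := INR n + 1) in *.
assert (Hx : 1 <= x) by (unfold x; lra).
pose proof (sqrt_lt_R0 x H1) as S1; assert (S0 : 0 < sqrt (x + 1)) by (apply sqrt_lt_R0; lra).
pose proof (sqrt_sqrt x ltac:(lra)) as E1; pose proof (sqrt_sqrt (x + 1) ltac:(lra)) as E0.
assert (Hpq : sqrt x <= sqrt (x + 1)) by (apply sqrt_le_1_alt; lra).
set (p := sqrt (x + 1)) in *; set (q := sqrt x) in *; clearbody p q x.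
replace (/ x ^ 2 * q) with (/ (q * q * q)) by (rewrite <- E1; field; lra).
replace (4 * (/ q - / p)) with (4 * ((p - q) * (p + q)) / (q * p * (p + q))) by (field; lra).
replace ((p - q) * (p + q)) with (p * p - q * q) by ring; rewrite E0, E1.
replace (x + 1 - x) with 1 by ring; rewrite Rmult_1_r.
apply (Rmult_le_reg_r (q * p * (p + q))); [apply Rmult_lt_0_compat; [apply Rmult_lt_0_compat; lra|lra]|].
replace (4 / (q * p * (p + q)) * (q * p * (p + q))) with 4 by (field; lra).
apply (Rmult_le_reg_l (x * q)); [apply Rmult_lt_0_compat; lra|].
replace (x * q * (/ (x * q) * (q * p * (p + q)))) with (q * (p * (p + q))) by (field; split; lra).
replace (x * q * 4) with (q * (4 * x)) by ring.
apply Rmult_le_compat_l; [lra|]. nra.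
Qed.

(** The increments model an outer entry 1 over an inner sum of size at most [a * sqrt m]: the
    square-root growth is preserved. In [sqrt_bounded] the outer entry is at least 2 and the result
    is bounded. *)
Lemma sqrt_growth (f : nat -> R) (a : R) : 0 <= a -> f 1%nat <= 0 ->
  (forall m, (1 <= m)%nat -> f (S m) <= f m + a * (/ INR m * sqrt (INR m))) ->
  forall n, f (S n) <= 2 * a * sqrt (INR n).
Proof.
intros Ha H1 Hf n; induction n as [|n IH]; [simpl INR; rewrite sqrt_0; lra|].
eapply Rle_trans; [apply Hf; lia|].
pose proof (Rmult_le_compat_l a _ _ Ha (sqrt_step n)); lra.
Qed.

Lemma sqrt_bounded (f : nat -> R) (a : R) : 0 <= a -> f 1%nat <= 0 ->
  (forall m, (1 <= m)%nat -> f (S m) <= f m + a * (/ INR m ^ 2 * sqrt (INR m))) ->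
  forall n, f (S n) <= 4 * a.
Proof.
intros Ha H1 Hf n.
assert (H : f (S n) <= 4 * a * (1 - / sqrt (INR (S n)))).
{ induction n as [|n IH]; [simpl INR; rewrite sqrt_1; lra|].
  eapply Rle_trans; [apply Hf; lia|].
  pose proof (Rmult_le_compat_l a _ _ Ha (sqrt_inv_step n)); lra. }
pose proof (Rinv_0_lt_compat _ (sqrt_lt_R0 _ (lt_0_INR (S n) ltac:(lia)))).
assert (0 <= a * / sqrt (INR (S n))) by (apply Rmult_le_pos; lra); lra.
Qed.

Notation pos_index := (List.Forall (fun j => (1 <= j)%nat)).

Lemma inv_pow_le (m j i : nat) : (1 <= m)%nat -> (i <= j)%nat -> 0 <= / INR m ^ j <= / INR m ^ i.
Proof.
intros Hm Hj; apply le_INR in Hm; simpl INR in Hm.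
assert (0 < INR m ^ i) by (apply pow_lt; lra).
assert (0 < INR m ^ j) by (apply pow_lt; lra).
split; [apply Rlt_le, Rinv_0_lt_compat; assumption|].
apply Rinv_le_contravar; [assumption|apply Rle_pow; assumption].
Qed.

Lemma mzv_trunc_pos ks N : 0 <= mzv_trunc ks N.
Proof.
revert N; induction ks as [|k ks IH]; intros N; [simpl; lra|].
destruct N as [|N]; [rewrite mzv_trunc_0; lra|].
induction N as [|N IHN]; [rewrite mzv_trunc_1; lra|].
rewrite mzv_trunc_S by lia.
pose proof (Rmult_le_pos _ _ (proj1 (inv_pow_le (S N) k k ltac:(lia) (le_n k))) (IH (S N))); lra.
Qed.

(** The actual growth is at most a power of [log N]; the cruder [sqrt N] passes through the
    induction at the cost of a factor 2 per entry. *)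
Lemma mzv_trunc_le_sqrt ks N : pos_index ks -> (1 <= N)%nat ->
  mzv_trunc ks N <= 2 ^ length ks * sqrt (INR N).
Proof.
intros Hp; revert N; induction Hp as [|k ks Hk Hp IH]; intros N HN.
- simpl; rewrite Rmult_1_l, <- sqrt_1; apply sqrt_le_1_alt; apply le_INR in HN; exact HN.
- destruct N as [|N]; [lia|].
  assert (H2 : 0 <= 2 ^ length ks) by (apply pow_le; lra).
  eapply Rle_trans.
  + apply (sqrt_growth (mzv_trunc (k :: ks)) (2 ^ length ks)); [exact H2|rewrite mzv_trunc_1; lra|].
    intros m Hm; rewrite mzv_trunc_S by assumption.
    apply Rplus_le_compat_l.
    replace (2 ^ length ks * (/ INR m * sqrt (INR m))) with (/ INR m * (2 ^ length ks * sqrt (INR m))) by ring.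
    destruct (inv_pow_le m k 1 Hm Hk) as [I1 I2]; rewrite pow_1 in I2.
    apply Rmult_le_compat; [exact I1|apply mzv_trunc_pos|exact I2|now apply IH].
  + simpl length; simpl pow; apply Rmult_le_compat_l; [lra|].
    apply sqrt_le_1_alt, le_INR; lia.
Qed.

Lemma mzv_trunc_bounded k ks N : (2 <= k)%nat -> pos_index ks ->
  mzv_trunc (k :: ks) N <= 4 * 2 ^ length ks.
Proof.
intros Hk Hp.
assert (H2 : 0 <= 2 ^ length ks) by (apply pow_le; lra).
destruct N as [|N]; [rewrite mzv_trunc_0; lra|].
apply (sqrt_bounded (mzv_trunc (k :: ks))); [exact H2|rewrite mzv_trunc_1; lra|].
intros m Hm; rewrite mzv_trunc_S by assumption.
apply Rplus_le_compat_l.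
replace (2 ^ length ks * (/ INR m ^ 2 * sqrt (INR m))) with (/ INR m ^ 2 * (2 ^ length ks * sqrt (INR m))) by ring.
destruct (inv_pow_le m k 2 Hm Hk) as [I1 I2].
apply Rmult_le_compat; [exact I1|apply mzv_trunc_pos|exact I2|now apply mzv_trunc_le_sqrt].
Qed.

Lemma mzv_trunc_cv k ks : (2 <= k)%nat -> pos_index ks ->
  is_lim_seq (mzv_trunc (k :: ks)) (mzv (k :: ks)).
Proof.
intros Hk Hp.
destruct (ex_finite_lim_seq_incr (mzv_trunc (k :: ks)) (4 * 2 ^ length ks)) as [l Hl].
- intros [|n]; [rewrite mzv_trunc_0, mzv_trunc_1; lra|].
  rewrite (mzv_trunc_S k ks (S n)) by lia.
  pose proof (Rmult_le_pos _ _ (proj1 (inv_pow_le (S n) k k ltac:(lia) (le_n k))) (mzv_trunc_pos ks (S n))); lra.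
- intros n; now apply mzv_trunc_bounded.
- unfold mzv; now rewrite (is_lim_seq_unique _ _ Hl).
Qed.

(** A plus sign can only enlarge the first entry, so all fillings of an admissible index have
    convergent zeta values. *)
Lemma fillings_adm p k ks : In p (fillings k ks) -> pos_index ks -> 
  exists k' p', p = k' :: p' /\ (k <= k')%nat /\ pos_index p'.
Proof.
revert p k; induction ks as [|k2 ks IH]; intros p k; simpl.
- intros [<-|[]] _; exists k, []; repeat split; [lia|constructor].
- intros H Hp; inversion Hp; subst; apply in_app_or in H; destruct H as [H|H].
  + apply in_map_iff in H; destruct H as (p' & <- & H); exists k, p'; repeat split; [lia|].
    destruct (IH _ _ H) as (k' & p'' & -> & Hk & Hp''); [assumption|].
    constructor; [lia|assumption].
  + destruct (IH _ _ H) as (k' & p'' & -> & Hk & Hp''); [assumption|].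
    exists k', p''; repeat split; [lia|assumption].
Qed.

Lemma filterlim_Csum {T A} (F : (T -> Prop) -> Prop) {FF : Filter F} (f : T -> A -> C) (l : A -> C) s :
  (forall x, In x s -> filterlim (fun N => f N x) F (locally (l x))) ->
  filterlim (fun N => Csum (f N) s) F (locally (Csum l s)).
Proof.
intros H; induction s as [|x s IH]; [apply filterlim_const|].
rewrite Csum_cons; eapply filterlim_ext; [intros N; symmetry; apply Csum_cons|].
apply filterlim_Cplus; [assumption|apply H; now left|apply IH; intros; apply H; now right].
Qed.

Lemma filterlim_RtoC {T} (F : (T -> Prop) -> Prop) {FF : Filter F} (f : T -> R) (l : R) :
  filterlim f F (locally l) -> filterlim (fun x => RtoC (f x)) F (locally (RtoC l)).
Proof. intros H; apply filterlim_C; [assumption|]; split; [exact H|apply filterlim_const]. Qed.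

Lemma ztrunc_cv t k ks : (2 <= k)%nat -> pos_index ks ->
  filterlim (ztrunc t (k :: ks)) eventually (locally (mzv_t t (k :: ks))).
Proof.
intros Hk Hp; unfold ztrunc, mzv_t.
apply (filterlim_Csum eventually (fun N p => t ^ (length (k :: ks) - length p) * RtoC (mzv_trunc p N))%C).
intros p Hin; destruct (fillings_adm _ _ _ Hin Hp) as (k' & p' & -> & Hk' & Hp').
apply filterlim_Cmult; [apply eventually_filter|apply filterlim_const|].
apply filterlim_RtoC; [apply eventually_filter|].
apply mzv_trunc_cv; [lia|assumption].
Qed.

(** * Sums over compositions *)

(** Summation over all compositions of [k]; none has more than [k] parts. *)
Definition comp_sum (g : list nat -> C) (k : nat) : C :=
  Csum (fun n => Csum g (indices k n)) (seq 0 (S k)).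

Lemma length_le_list_sum ks : pos_index ks -> (length ks <= list_sum ks)%nat.
Proof. induction 1; simpl; lia. Qed.

Lemma comp_sum_extend g k M : (k < M)%nat ->
  Csum (fun n => Csum g (indices k n)) (seq 0 M) = comp_sum g k.
Proof.
intros H; unfold comp_sum; replace M with (S k + (M - S k))%nat by lia.
rewrite seq_app, Csum_app.
rewrite (Csum_zero _ (seq (0 + S k) _)); [ring|].
intros n Hn; apply in_seq in Hn; apply Csum_zero; intros ks Hks.
apply in_indices in Hks; destruct Hks as (H1 & H2 & H3).
apply length_le_list_sum in H1; lia.
Qed.

(** The first part [j] is split off. The remaining depth range is longer than the weight [S k - j]
    requires, which [comp_sum_extend] absorbs. *)
Lemma comp_sum_S g k :
  comp_sum g (S k) =
  Csum (fun j => comp_sum (fun ks => g (j :: ks)) (S k - j)) (seq 1 (S k)).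
Proof.
unfold comp_sum at 1.
change (seq 0 (S (S k))) with (0%nat :: seq 1 (S k)); rewrite Csum_cons.
change (Csum g (indices (S k) 0)) with (RtoC 0); rewrite Cplus_0_l, Csum_seq_shift.
rewrite (Csum_ext _ (fun n => Csum (fun j => Csum (fun ks => g (j :: ks)) (indices (S k - j) n)) (seq 1 (S k)))).
2:{ intros n _; cbn [indices]; rewrite Csum_flat_map; apply Csum_ext; intros; apply Csum_map. }
rewrite Csum_swap; apply Csum_ext; intros j Hj; apply in_seq in Hj.
apply comp_sum_extend; lia.
Qed.

Lemma comp_sum_0 g : comp_sum g 0 = g [].
Proof. unfold comp_sum, Csum; simpl; ring. Qed.

Lemma comp_sum_ext f g k :
  (forall ks, pos_index ks -> list_sum ks = k -> f ks = g ks) -> comp_sum f k = comp_sum g k.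
Proof.
intros H; apply Csum_ext; intros n _; apply Csum_ext; intros ks Hks.
apply in_indices in Hks; now apply H.
Qed.

Lemma comp_sum_plus f g k : comp_sum (fun ks => f ks + g ks)%C k = (comp_sum f k + comp_sum g k)%C.
Proof.
unfold comp_sum; rewrite <- Csum_plus; apply Csum_ext; intros; apply Csum_plus.
Qed.

Lemma comp_sum_scal c f k : comp_sum (fun ks => c * f ks)%C k = (c * comp_sum f k)%C.
Proof.
unfold comp_sum; rewrite <- Csum_scal; apply Csum_ext; intros; apply Csum_scal.
Qed.

Definition mon (y : nat -> C) (ks : list nat) : C :=
  fold_right (fun k z => y k * z)%C (RtoC 1) ks.

(** The first entry has a weight of its own because admissibility restricts it alone. *)
Definition hmon (h y : nat -> C) (ks : list nat) : C :=
  match ks with [] => RtoC 0 | k :: ks' => (h k * mon y ks')%C end.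

Definition zgen (t : C) (h y : nat -> C) (N k : nat) : C :=
  comp_sum (fun ks => hmon h y ks * ztrunc t ks N)%C k.

Definition jgen (t : C) (y : nat -> C) (N k : nat) : C :=
  comp_sum (fun ks => mon y ks * zjoin t ks N)%C k.

Lemma zgen_0 t h y N : zgen t h y N 0 = RtoC 0.
Proof. unfold zgen; rewrite comp_sum_0; simpl; ring. Qed.

Lemma zgen_1 t h y k : zgen t h y 1 k = RtoC 0.
Proof.
unfold zgen; rewrite (comp_sum_ext _ (fun _ => 0 * 0)%C).
- rewrite comp_sum_scal; ring.
- intros [|k1 ks] _ _; [simpl; ring|rewrite ztrunc_1; ring].
Qed.

(** Splitting off the first part turns the increment into a Cauchy product in the weight [k]. After
    summation over [k] it becomes multiplication by the generating function of [h j / m ^ j]. *)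
Lemma zgen_S t h y m k : (1 <= m)%nat ->
  zgen t h y (S m) k =
  (zgen t h y m k + Csum (fun j => (h j * RtoC (/ INR m ^ j)) * jgen t y m (k - j)) (seq 1 k))%C.
Proof.
intros Hm; destruct k as [|k]; [rewrite !zgen_0; unfold Csum; simpl; ring|].
unfold zgen; rewrite !comp_sum_S, <- Csum_plus; apply Csum_ext; intros j _.
unfold jgen; rewrite <- comp_sum_scal, <- comp_sum_plus; apply comp_sum_ext; intros ks _ _.
rewrite ztrunc_S by assumption; simpl hmon; ring.
Qed.

Lemma jgen_0 t y N : jgen t y N 0 = RtoC 1.
Proof. unfold jgen; rewrite comp_sum_0; unfold zjoin; simpl; ring. Qed.

Lemma jgen_S t y N k :
  jgen t y N (S k) =
  (zgen t y y N (S k) + t * (zgen t y y (S N) (S k) - zgen t y y N (S k)))%C.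
Proof.
unfold jgen, zgen.
rewrite (comp_sum_ext _ (fun ks => hmon y y ks * ztrunc t ks N + (t * (hmon y y ks * ztrunc t ks (S N)) + (- t) * (hmon y y ks * ztrunc t ks N)))%C).
- rewrite !comp_sum_plus, !comp_sum_scal; ring.
- intros [|j ks] _ Hs; [discriminate Hs|]; unfold zjoin; simpl hmon; simpl mon; ring.
Qed.

Lemma geom_conv (c rho : R) k :
  fold_right Rplus 0 (map (fun j => rho ^ j * (c * rho) ^ (k - j)) (seq 1 k)) * (c - 1)
  = rho ^ k * (c ^ k - 1).
Proof.
induction k as [|k IH]; [simpl; ring|].
rewrite seq_S, map_app, Rfold_app; cbn [map fold_right].
replace (1 + k)%nat with (S k) by lia; rewrite Nat.sub_diag.
rewrite (map_ext_in _ (fun j => (c * rho) * (rho ^ j * (c * rho) ^ (k - j)))).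
2:{ intros j Hj; apply in_seq in Hj; replace (S k - j)%nat with (S (k - j)) by lia; simpl; ring. }
assert (E : forall (g : nat -> R) l, fold_right Rplus 0 (map (fun j => (c * rho) * g j) l) = (c * rho) * fold_right Rplus 0 (map g l)).
{ intros g l; induction l as [|x l IHl]; simpl; [ring|rewrite IHl; ring]. }
rewrite (E (fun j => rho ^ j * (c * rho) ^ (k - j))).
replace ((c * rho * fold_right Rplus 0 (map (fun j => rho ^ j * (c * rho) ^ (k - j)) (seq 1 k)) +
 (rho ^ S k * (c * rho) ^ 0 + 0)) * (c - 1)) with
 (c * rho * (fold_right Rplus 0 (map (fun j => rho ^ j * (c * rho) ^ (k - j)) (seq 1 k)) * (c - 1)) + rho ^ S k * (c - 1)) by (simpl; ring).
rewrite IH; simpl; ring.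
Qed.

(** Convolution with [rho ^ j] reproduces the geometric growth [(c * rho) ^ k] up to the factor
    [1 / (c - 1)]. Since [j >= 1], only [E i] with [i < k] occurs, so the bound fits a strong
    induction on the weight. *)
Lemma conv_bound (x E : nat -> C) (c rho kappa sigma : R) (k : nat) :
  1 < c -> 0 <= rho -> 0 <= kappa -> 0 <= sigma ->
  (forall j, (1 <= j)%nat -> Cmod (x j) <= kappa * rho ^ j) ->
  (forall i, (i < k)%nat -> Cmod (E i) <= (c * rho) ^ i * sigma) ->
  Cmod (Csum (fun j => x j * E (k - j)%nat)%C (seq 1 k)) <= kappa * sigma * ((c * rho) ^ k / (c - 1)).
Proof.
intros Hc Hr Hk Hs Hx HE.
eapply Rle_trans; [apply Csum_Cmod_le|].
apply (Rle_trans _ (kappa * sigma * fold_right Rplus 0 (map (fun j => rho ^ j * (c * rho) ^ (k - j)) (seq 1 k)))).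
- apply (Rle_trans _ (fold_right Rplus 0 (map (fun j => (kappa * sigma) * (rho ^ j * (c * rho) ^ (k - j))) (seq 1 k)))).
  + apply Rfold_le; intros j Hj; apply in_seq in Hj; rewrite Cmod_mult.
    replace (kappa * sigma * (rho ^ j * (c * rho) ^ (k - j))) with ((kappa * rho ^ j) * ((c * rho) ^ (k - j) * sigma)) by ring.
    apply Rmult_le_compat; [apply Cmod_ge_0|apply Cmod_ge_0|apply Hx; lia|apply HE; lia].
  + apply Req_le; generalize (seq 1 k); intros l; induction l as [|j l IHl]; simpl; [ring|rewrite IHl; ring].
- apply Rmult_le_compat_l; [now apply Rmult_le_pos|].
  apply (Rmult_le_reg_r (c - 1)); [lra|].
  rewrite geom_conv; replace ((c * rho) ^ k / (c - 1) * (c - 1)) with ((c * rho) ^ k) by (field; lra).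
  rewrite Rpow_mult_distr; pose proof (pow_le rho k Hr); nra.
Qed.

(** The constant [c = Cmod t + 3] is the one that closes the induction: by [conv_bound] the part
    [zgen] costs [2 / (c - 1)] and the joined part at most [Cmod t / (c - 1)], which add up to 1. *)
Lemma jgen_bound t y rho :
  0 <= rho -> (forall j, (1 <= j)%nat -> Cmod (y j) <= rho ^ j) ->
  forall k N, (1 <= N)%nat ->
  Cmod (jgen t y N k) <= ((Cmod t + 3) * rho) ^ k * sqrt (INR N).
Proof.
intros Hr Hy; set (c := Cmod t + 3).
pose proof (Cmod_ge_0 t) as Ht.
assert (Hc : 1 < c) by (unfold c; lra).
intros k; induction k as [k IH] using (well_founded_induction lt_wf); intros N HN.
destruct k as [|k].
{ rewrite jgen_0, Cmod_1; simpl; rewrite Rmult_1_l, <- sqrt_1; apply sqrt_le_1_alt.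
  apply le_INR in HN; exact HN. }
assert (Hq : 0 <= (c * rho) ^ S k / (c - 1)).
{ apply Rmult_le_pos; [apply pow_le, Rmult_le_pos; lra|apply Rlt_le, Rinv_0_lt_compat; lra]. }
assert (HD : forall m, (1 <= m)%nat ->
  Cmod (Csum (fun j => (y j * RtoC (/ INR m ^ j)) * jgen t y m (S k - j))%C (seq 1 (S k)))
   <= (c * rho) ^ S k / (c - 1) * (/ INR m * sqrt (INR m))).
{ intros m Hm.
  rewrite (Rmult_comm ((c * rho) ^ S k / (c - 1))).
  apply (conv_bound (fun j => y j * RtoC (/ INR m ^ j))%C (jgen t y m)); try assumption.
  - rewrite <- (pow_1 (INR m)); apply (inv_pow_le m 1 1 Hm); lia.
  - apply sqrt_pos.
  - intros j Hj; rewrite Cmod_mult, Cmod_R, Rmult_comm.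
    destruct (inv_pow_le m j 1 Hm Hj) as [I1 I2]; rewrite pow_1 in I2.
    rewrite Rabs_pos_eq by exact I1.
    apply Rmult_le_compat; [exact I1|apply Cmod_ge_0|exact I2|now apply Hy].
  - intros i Hi; now apply IH. }
rewrite jgen_S.
assert (HZ : Cmod (zgen t y y N (S k)) <= 2 * ((c * rho) ^ S k / (c - 1)) * sqrt (INR N)).
{ destruct N as [|N]; [lia|].
  eapply Rle_trans.
  - apply (sqrt_growth (fun N => Cmod (zgen t y y N (S k))) _ Hq).
    + rewrite zgen_1, Cmod_0; lra.
    + intros m Hm; rewrite zgen_S by assumption; eapply Rle_trans; [apply Cmod_triangle|].
      apply Rplus_le_compat_l, HD, Hm.
  - apply Rmult_le_compat_l; [lra|apply sqrt_le_1_alt, le_INR; lia]. }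
eapply Rle_trans; [apply Cmod_triangle|]; rewrite Cmod_mult.
replace (zgen t y y (S N) (S k) - zgen t y y N (S k))%C with
  (Csum (fun j => (y j * RtoC (/ INR N ^ j)) * jgen t y N (S k - j))%C (seq 1 (S k))).
2:{ rewrite (zgen_S t y y N) by assumption; ring. }
specialize (HD N HN).
assert (HD' : (c * rho) ^ S k / (c - 1) * (/ INR N * sqrt (INR N)) <= (c * rho) ^ S k / (c - 1) * sqrt (INR N)).
{ apply Rmult_le_compat_l; [exact Hq|].
  rewrite <- (Rmult_1_l (sqrt (INR N))) at 2; apply Rmult_le_compat_r; [apply sqrt_pos|].
  destruct (inv_pow_le N 1 0 HN ltac:(lia)) as [_ I]; simpl in I; rewrite Rinv_1, Rmult_1_r in I; exact I. }
apply (Rle_trans _ (2 * ((c * rho) ^ S k / (c - 1)) * sqrt (INR N) + Cmod t * ((c * rho) ^ S k / (c - 1) * sqrt (INR N)))).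
{ apply Rplus_le_compat; [exact HZ|apply Rmult_le_compat_l; [exact Ht|lra]]. }
apply Req_le; unfold c; field; fold c; lra.
Qed.

(** Because [h 1] vanishes, every first entry supplies at least [1 / m ^ 2], and the sum against the
    [sqrt m] of [jgen_bound] stays bounded uniformly in [N]. The denominator [Cmod t + 2] is [c - 1]
    for the [c] used there. *)
Lemma zgen_bound t h y rho kappa :
  0 < rho -> 0 <= kappa -> h 1%nat = RtoC 0 ->
  (forall j, (2 <= j)%nat -> Cmod (h j) <= kappa * rho ^ j) ->
  (forall j, (1 <= j)%nat -> Cmod (y j) <= rho ^ j) ->
  forall k N, Cmod (zgen t h y (S N) k) <= 4 * (kappa * (((Cmod t + 3) * rho) ^ k / (Cmod t + 2))).
Proof.
intros Hr Hkap Hh1 Hh Hy k N.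
pose proof (Cmod_ge_0 t) as Ht.
assert (Hq : 0 <= kappa * (((Cmod t + 3) * rho) ^ k / (Cmod t + 2))).
{ apply Rmult_le_pos; [exact Hkap|].
  apply Rmult_le_pos; [apply pow_le, Rmult_le_pos; lra|apply Rlt_le, Rinv_0_lt_compat; lra]. }
apply (sqrt_bounded (fun N => Cmod (zgen t h y N k)) _ Hq); [rewrite zgen_1, Cmod_0; lra|].
intros m Hm; rewrite zgen_S by assumption; eapply Rle_trans; [apply Cmod_triangle|].
apply Rplus_le_compat_l.
replace (kappa * (((Cmod t + 3) * rho) ^ k / (Cmod t + 2)) * (/ INR m ^ 2 * sqrt (INR m)))
  with ((kappa * / INR m ^ 2) * sqrt (INR m) * (((Cmod t + 3) * rho) ^ k / (Cmod t + 3 - 1))).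
2:{ replace (Cmod t + 3 - 1) with (Cmod t + 2) by ring; ring. }
destruct (inv_pow_le m 2 2 Hm (le_n 2)) as [I0 _].
apply (conv_bound (fun j => h j * RtoC (/ INR m ^ j))%C (jgen t y m)); try lra.
- apply Rmult_le_pos; assumption.
- apply sqrt_pos.
- intros j Hj; rewrite Cmod_mult, Cmod_R.
  destruct (Nat.eq_dec j 1) as [->|Hj1].
  + rewrite Hh1, Cmod_0, Rmult_0_l.
    apply Rmult_le_pos; [now apply Rmult_le_pos|apply pow_le; lra].
  + destruct (inv_pow_le m j 2 Hm ltac:(lia)) as [I1 I2].
    rewrite Rabs_pos_eq by exact I1.
    replace (kappa * / INR m ^ 2 * rho ^ j) with (kappa * rho ^ j * / INR m ^ 2) by ring.
    apply Rmult_le_compat; [apply Cmod_ge_0|exact I1|apply Hh; lia|exact I2].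
- intros i _; apply jgen_bound; [lra|exact Hy|exact Hm].
Qed.

(** * The coefficients of the generating function *)

(* Weight of an entry j: over an index of weight k, depth n and height s the product is
   u^(k-n-s) v^(n-s) w^(2s). *)
Definition yw (u v w : C) (j : nat) : C :=
  match j with O => RtoC 0 | S O => v | S (S i) => (u ^ i * w ^ 2)%C end.

(* Weight of the first entry of an admissible index, a factor w^2 being removed. *)
Definition ya (u : C) (j : nat) : C :=
  match j with S (S i) => (u ^ i)%C | _ => RtoC 0 end.

Definition phi (t u v w : C) (k : nat) : C :=
  comp_sum (fun ks => hmon (ya u) (yw u v w) ks * mzv_t t ks)%C k.

(** The two inequalities make the truncated subtractions in the exponents exact. *)
Lemma mon_monomial u v w ks : pos_index ks ->
  (length ks + height ks <= list_sum ks)%nat /\ (height ks <= length ks)%nat /\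
  mon (yw u v w) ks =
  (u ^ (list_sum ks - length ks - height ks) * v ^ (length ks - height ks) * w ^ (2 * height ks))%C.
Proof.
induction 1 as [|j ks Hj Hp (IH1 & IH2 & IH3)].
- unfold height; simpl; repeat split; try lia; ring.
- destruct j as [|[|j]]; [lia| |].
  + change (height (1 :: ks)%nat) with (height ks).
    change (length (1%nat :: ks)) with (S (length ks)); change (list_sum (1%nat :: ks)) with (S (list_sum ks)).
    repeat split; try lia.
    change (mon (yw u v w) (1%nat :: ks)) with (v * mon (yw u v w) ks)%C; rewrite IH3.
    replace (S (length ks) - height ks)%nat with (S (length ks - height ks)) by lia.
    replace (S (list_sum ks) - S (length ks) - height ks)%nat with (list_sum ks - length ks - height ks)%nat by lia.
    simpl Cpow; ring.
  + change (height (S (S j) :: ks)) with (S (height ks)).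
    change (length (S (S j) :: ks)) with (S (length ks)); change (list_sum (S (S j) :: ks)) with (S (S j) + list_sum ks)%nat.
    repeat split; try lia.
    change (mon (yw u v w) (S (S j) :: ks)) with (u ^ j * w ^ 2 * mon (yw u v w) ks)%C; rewrite IH3.
    replace (S (S j) + list_sum ks - S (length ks) - S (height ks))%nat with (j + (list_sum ks - length ks - height ks))%nat by lia.
    replace (S (length ks) - S (height ks))%nat with (length ks - height ks)%nat by lia.
    replace (2 * S (height ks))%nat with (2 + 2 * height ks)%nat by lia.
    rewrite !Cpow_add_r; ring.
Qed.

Lemma Csum_single {A} (f : A -> C) x l : NoDup l -> In x l ->
  (forall y, In y l -> y <> x -> f y = RtoC 0) -> Csum f l = f x.
Proof.
induction 1 as [|y l Hy Hl IH]; intros Hx H0; [destruct Hx|].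
rewrite Csum_cons; destruct Hx as [->|Hx].
- rewrite Csum_zero; [ring|]; intros z Hz; apply H0; [now right|intros ->; contradiction].
- rewrite IH, H0; [ring|now left|intros ->; contradiction|assumption|].
  intros z Hz; apply H0; now right.
Qed.

Lemma Csum_list_prod {A B} (f : A * B -> C) la lb :
  Csum f (list_prod la lb) = Csum (fun x => Csum (fun y => f (x, y)) lb) la.
Proof.
induction la as [|x la IH]; [reflexivity|].
simpl list_prod; now rewrite Csum_app, Csum_cons, Csum_map, IH.
Qed.

(** Each admissible index is counted once, at its own depth and height, and then the constraints of
    [depth_heights] hold automatically. Its first entry carries no [w ^ 2], which accounts for the
    exponent [2 * s - 2]. *)
Lemma Phi0_coef t u v w k :
  Csum (fun p => Phi0_term t u v w k (fst p) (snd p)) (depth_heights k) = phi t u v w k.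
Proof.
unfold depth_heights; rewrite Csum_filter, Csum_list_prod; cbn [fst snd].
unfold phi, comp_sum; change (seq 0 (S k)) with (0%nat :: seq 1 k).
rewrite Csum_cons.
rewrite (Csum_zero _ (indices k 0)).
2:{ intros ks Hks; apply in_indices in Hks; destruct ks; [simpl; ring|destruct Hks as (_ & _ & H); discriminate H]. }
rewrite Cplus_0_l; apply Csum_ext; intros n Hn; apply in_seq in Hn.
rewrite (Csum_ext _ (fun s => Csum (fun ks =>
  if (admissible ks && (height ks =? s)%nat && ((n + s <=? k)%nat && (s <=? n)%nat))%bool
  then (mzv_t t ks * (u ^ (k - n - s) * v ^ (n - s) * w ^ (2 * s - 2)))%C else RtoC 0) (indices k n))).
2:{ intros s _; destruct ((n + s <=? k)%nat && (s <=? n)%nat)%bool.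
  - unfold Phi0_term, X0, adm_indices; rewrite Csum_filter.
    rewrite <- !Cmult_assoc, Cmult_comm, <- Csum_scal; apply Csum_ext; intros ks _.
    rewrite Bool.andb_true_r; destruct (_ && _)%bool; ring.
  - symmetry; apply Csum_zero; intros; now rewrite Bool.andb_false_r. }
rewrite Csum_swap; apply Csum_ext; intros ks Hks.
apply in_indices in Hks; destruct Hks as (Hp & Hs & Hl).
destruct (admissible ks) eqn:Ha.
- destruct ks as [|k1 ks]; [discriminate Ha|].
  destruct (mon_monomial u v w _ Hp) as (M1 & M2 & _).
  assert (Hh : height (k1 :: ks) = S (height ks)).
  { unfold height; cbn [filter]; unfold admissible in Ha; now rewrite Ha. }
  rewrite (Csum_single _ (height (k1 :: ks))).
  + rewrite Nat.eqb_refl.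
    replace (n + height (k1 :: ks) <=? k)%nat with true by (symmetry; apply Nat.leb_le; lia).
    replace (height (k1 :: ks) <=? n)%nat with true by (symmetry; apply Nat.leb_le; lia).
    cbn [andb]; rewrite Cmult_comm; f_equal.
    inversion Hp; subst; destruct (mon_monomial u v w ks) as (N1 & N2 & N3); [assumption|].
    apply Nat.leb_le in Ha; destruct k1 as [|[|j]]; [lia|lia|].
    simpl hmon; rewrite N3, Hh; simpl length; simpl list_sum.
    replace (S (S (j + list_sum ks)) - S (length ks) - S (height ks))%nat with (j + (list_sum ks - length ks - height ks))%nat by lia.
    replace (S (length ks) - S (height ks))%nat with (length ks - height ks)%nat by lia.
    replace (2 * S (height ks) - 2)%nat with (2 * height ks)%nat by lia.
    rewrite Cpow_add_r; ring.
  + apply seq_NoDup.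
  + apply in_seq; lia.
  + intros s _ Hne; destruct (Nat.eqb_spec (height (k1 :: ks)) s); [congruence|reflexivity].
- rewrite Csum_zero by reflexivity.
  destruct ks as [|[|[|j]] ks]; simpl; try ring; discriminate Ha.
Qed.

Lemma Phi0_phi t u v w : Phi0 t u v w = CSeries (phi t u v w).
Proof. apply CSeries_ext; intros k; apply Phi0_coef. Qed.

(** Indices starting with 1 may have divergent truncations, but their weight [ya u 1] is 0. *)
Lemma phi_limit t u v w k :
  filterlim (fun N => zgen t (ya u) (yw u v w) N k) eventually (locally (phi t u v w k)).
Proof.
apply (filterlim_Csum eventually (fun N n => Csum (fun ks => (hmon (ya u) (yw u v w) ks * ztrunc t ks N)%C) (indices k n))).
intros n _; apply (filterlim_Csum eventually (fun N ks => (hmon (ya u) (yw u v w) ks * ztrunc t ks N)%C)).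
intros ks Hks; apply in_indices in Hks; destruct Hks as (Hp & _).
assert (Z : forall (x b : C) (f : nat -> C), x = RtoC 0 ->
  filterlim (fun N => x * f N)%C eventually (locally (x * b)%C)).
{ intros x b f ->; rewrite Cmult_0_l; apply (filterlim_ext (fun _ => RtoC 0)); [intros; ring|apply filterlim_const]. }
destruct ks as [|[|[|j]] ks]; [apply Z; reflexivity|apply Z; simpl; ring|apply Z; simpl; ring|].
- inversion Hp; subst.
  apply filterlim_Cmult; [apply eventually_filter|apply filterlim_const|].
  apply ztrunc_cv; [lia|assumption].
Qed.

(** The last condition makes [((Cmod t + 3) * rho) ^ k] summable over the weight. *)
Definition small (t u v w : C) (rho : R) : Prop :=
  0 < rho /\ Cmod u <= rho /\ Cmod v <= rho /\ Cmod w <= rho /\ (Cmod t + 3) * rho <= 1 / 2.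

Lemma small_lt_1 t u v w rho : small t u v w rho -> rho < 1.
Proof. intros (Hrho & _ & _ & _ & Hs); pose proof (Cmod_ge_0 t); nra. Qed.

Lemma small_u t u v w rho : small t u v w rho -> Cmod u < 1.
Proof. intros H; pose proof (small_lt_1 _ _ _ _ _ H); destruct H as (_ & H & _); lra. Qed.

Lemma yw_bound t u v w rho j : small t u v w rho -> (1 <= j)%nat -> Cmod (yw u v w j) <= rho ^ j.
Proof.
intros (Hrho & Hu & Hv & Hw & _).
destruct j as [|[|j]]; intros Hj; [lia|simpl; lra|].
change (yw u v w (S (S j))) with (u ^ j * w ^ 2)%C; rewrite Cmod_mult, !Cmod_pow.
replace (rho ^ S (S j)) with (rho ^ j * rho ^ 2) by (simpl; ring).
apply Rmult_le_compat; try (apply pow_le, Cmod_ge_0); apply pow_incr; (split; [apply Cmod_ge_0|assumption]).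
Qed.

Lemma ya_bound t u v w rho j : small t u v w rho -> (2 <= j)%nat -> Cmod (ya u j) <= / rho ^ 2 * rho ^ j.
Proof.
intros (Hrho & Hu & _).
destruct j as [|[|j]]; intros Hj; [lia|lia|].
simpl ya; rewrite Cmod_pow.
replace (/ rho ^ 2 * rho ^ S (S j)) with (rho ^ j) by (simpl; field; lra).
apply pow_incr; (split; [apply Cmod_ge_0|assumption]).
Qed.

(** The bound of [zgen_bound] with [kappa = / rho ^ 2], which compensates the [w ^ 2] missing from
    the first entry. *)
Definition coef_bound (t : C) (rho : R) (k : nat) : R :=
  4 * (/ rho ^ 2 * (((Cmod t + 3) * rho) ^ k / (Cmod t + 2))).

Lemma zgen_ya_bound t u v w rho N k : small t u v w rho ->
  Cmod (zgen t (ya u) (yw u v w) (S N) k) <= coef_bound t rho k.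
Proof.
intros H; apply zgen_bound; [apply H| |reflexivity| |].
- apply Rlt_le, Rinv_0_lt_compat, pow_lt, H.
- intros j; now apply (ya_bound t u v w).
- intros j; now apply (yw_bound t u v w).
Qed.

Lemma ex_series_small t u v w rho (c : R) : small t u v w rho ->
  ex_series (fun k => c * ((Cmod t + 3) * rho) ^ k).
Proof.
intros (Hrho & _ & _ & _ & Hs).
apply (ex_series_scal_l (V := R_NormedModule) c), ex_series_geom.
pose proof (Cmod_ge_0 t); assert (0 <= (Cmod t + 3) * rho) by (apply Rmult_le_pos; lra).
rewrite Rabs_pos_eq; lra.
Qed.

Lemma ex_series_coef_bound t u v w rho : small t u v w rho -> ex_series (coef_bound t rho).
Proof.
intros H; eapply ex_series_ext; [|apply (ex_series_small _ _ _ _ _ (4 * / rho ^ 2 / (Cmod t + 2)) H)].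
intros k; unfold coef_bound, Rdiv; simpl; ring.
Qed.

Lemma phi_bound t u v w rho k : small t u v w rho -> Cmod (phi t u v w k) <= coef_bound t rho k.
Proof.
intros H.
apply (filterlim_le (F := eventually) (fun N => Cmod (zgen t (ya u) (yw u v w) (S N) k)) (fun _ => coef_bound t rho k)
  (Cmod (phi t u v w k)) (coef_bound t rho k)).
- exists 0%nat; intros; now apply zgen_ya_bound.
- apply (filterlim_comp _ _ _ (fun N => zgen t (ya u) (yw u v w) (S N) k) Cmod _ (locally (phi t u v w k))).
  + intros P HP; destruct (phi_limit t u v w k P HP) as [N HN]; exists N; intros n Hn; apply HN; lia.
  + apply (filterlim_norm (V := C_NormedModule)).
- apply filterlim_const.
Qed.

Lemma is_Cseries_geom (x : C) : Cmod x < 1 -> is_Cseries (fun n => x ^ n)%C (1 / (1 - x))%C.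
Proof.
intros Hx.
assert (H1 : (1 - x <> 0)%C).
{ intros E; assert (x = 1%C) as -> by (replace x with (1 - (1 - x))%C by ring; rewrite E; ring).
  rewrite Cmod_1 in Hx; lra. }
apply is_Cseries_Csum.
replace (1 / (1 - x))%C with (1 / (1 - x) + (- (1 / (1 - x))) * RtoC 0)%C by (field; exact H1).
apply (filterlim_ext (fun n => 1 / (1 - x) + (- (1 / (1 - x))) * x ^ n)%C).
- intros n; induction n as [|n IH]; [unfold Csum; simpl; field; exact H1|].
  rewrite Csum_seq_S, <- IH; simpl Cpow; field; exact H1.
- apply filterlim_Cplus; [apply eventually_filter|apply filterlim_const|].
  apply filterlim_Cmult; [apply eventually_filter|apply filterlim_const|].
  apply filterlim_C_0; [apply eventually_filter|].
  apply (filterlim_ext (fun n => Cmod x ^ n)); [intros; symmetry; apply Cmod_pow|].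
  apply (is_lim_seq_geom (Cmod x)); rewrite Rabs_pos_eq; [exact Hx|apply Cmod_ge_0].
Qed.

Lemma is_Cseries_cons (a : nat -> C) (l x : C) :
  a 0%nat = x -> is_Cseries (fun n => a (S n)) l -> is_Cseries a (x + l)%C.
Proof.
intros <- H; apply (is_series_decr_1 (V := C_NormedModule)).
replace (plus _ _) with l; [exact H|].
change (@eq C l ((a 0%nat + l) + - a 0%nat)%C); ring.
Qed.

Lemma is_Cseries_0 (a : nat -> C) : (forall n, a n = RtoC 0) -> is_Cseries a (RtoC 0).
Proof.
intros H; apply is_Cseries_Csum; apply (filterlim_ext (fun _ => RtoC 0)); [|apply filterlim_const].
intros n; symmetry; now apply Csum_zero.
Qed.

Lemma INR_S_neq_0 n : RtoC (INR (S n)) <> 0%C.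
Proof. intros E; apply RtoC_inj in E; now apply not_0_INR in E. Qed.

Lemma INR_minus_neq_0 n z : Cmod z < 1 -> (RtoC (INR (S n)) - z <> 0)%C.
Proof.
intros Hz E; replace z with (RtoC (INR (S n))) in Hz.
- rewrite Cmod_R, Rabs_pos_eq, S_INR in Hz by apply pos_INR; pose proof (pos_INR n); lra.
- replace z with (RtoC (INR (S n)) - (RtoC (INR (S n)) - z))%C by ring; rewrite E; ring.
Qed.

Lemma RtoC_inv_pow n j : RtoC (/ INR (S n) ^ j) = (/ RtoC (INR (S n)) ^ j)%C.
Proof. rewrite RtoC_inv, RtoC_pow; [reflexivity|apply pow_nonzero, not_0_INR; lia]. Qed.

Lemma geom_over_INR (u c : C) n : Cmod u < 1 ->
  is_Cseries (fun i => c * u ^ i * RtoC (/ INR (S n) ^ S (S i)))%C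
    (c / (RtoC (INR (S n)) * (RtoC (INR (S n)) - u)))%C.
Proof.
intros Hu; set (m := RtoC (INR (S n))).
assert (Hm : m <> 0%C) by apply INR_S_neq_0.
assert (Hmu : (m - u <> 0)%C) by now apply INR_minus_neq_0.
replace (c / (m * (m - u)))%C with (c / m ^ 2 * (1 / (1 - u / m)))%C.
2:{ simpl; field; repeat split; assumption. }
apply (is_Cseries_ext (fun i => c / m ^ 2 * (u / m) ^ i)%C).
- intros i; rewrite RtoC_inv_pow; fold m.
  unfold Cdiv; rewrite Cpow_mult_l, Cpow_inv by exact Hm; simpl; field; split; [now apply Cpow_nz|exact Hm].
- apply is_Cseries_scal, is_Cseries_geom.
  rewrite Cmod_div by exact Hm; unfold m; rewrite Cmod_R, Rabs_pos_eq by apply pos_INR.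
  pose proof (pos_INR n); pose proof (lt_0_INR (S n) ltac:(lia)).
  apply (Rmult_lt_reg_r (INR (S n))); [assumption|].
  unfold Rdiv; rewrite Rmult_assoc, Rinv_l, S_INR; lra.
Qed.

Lemma ya_series u n : Cmod u < 1 ->
  is_Cseries (fun j => ya u j * RtoC (/ INR (S n) ^ j))%C
    (1 / (RtoC (INR (S n)) * (RtoC (INR (S n)) - u)))%C.
Proof.
intros Hu.
replace (1 / (RtoC (INR (S n)) * (RtoC (INR (S n)) - u)))%C
  with (0 + (0 + 1 / (RtoC (INR (S n)) * (RtoC (INR (S n)) - u))))%C by ring.
apply is_Cseries_cons; [simpl; ring|]; apply is_Cseries_cons; [simpl; ring|].
eapply is_Cseries_ext; [|apply (geom_over_INR u 1 n Hu)].
intros i; change (ya u (S (S i))) with (u ^ i)%C; cbv beta; ring.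
Qed.

Lemma yw_series u v w n : Cmod u < 1 ->
  is_Cseries (fun j => yw u v w j * RtoC (/ INR (S n) ^ j))%C
    (v / RtoC (INR (S n)) + w ^ 2 / (RtoC (INR (S n)) * (RtoC (INR (S n)) - u)))%C.
Proof.
intros Hu.
replace (v / RtoC (INR (S n)) + w ^ 2 / (RtoC (INR (S n)) * (RtoC (INR (S n)) - u)))%C
  with (0 + (v / RtoC (INR (S n)) + w ^ 2 / (RtoC (INR (S n)) * (RtoC (INR (S n)) - u))))%C by ring.
apply is_Cseries_cons; [simpl; ring|]; apply is_Cseries_cons.
- simpl yw; rewrite RtoC_inv_pow; simpl Cpow; rewrite Cmult_1_r; reflexivity.
- eapply is_Cseries_ext; [|apply (geom_over_INR u (w ^ 2) n Hu)].
  intros i; change (yw u v w (S (S i))) with (u ^ i * w ^ 2)%C; cbv beta; ring.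
Qed.

Lemma Csum_conv (x E : nat -> C) k : x 0%nat = RtoC 0 ->
  Csum (fun j => x j * E (k - j)%nat)%C (seq 1 k) = Cconv x E k.
Proof.
intros Hx; unfold Cconv; change (seq 0 (S k)) with (0%nat :: seq 1 k).
rewrite Csum_cons, Hx; ring.
Qed.

Lemma abs_series_y t u v w rho (c : R) (y : nat -> C) n : small t u v w rho -> y 0%nat = RtoC 0 ->
  (forall j, (1 <= j)%nat -> Cmod (y j) <= c * rho ^ j) -> 0 <= c ->
  ex_series (fun j => Cmod (y j * RtoC (/ INR (S n) ^ j))%C).
Proof.
intros H Hy0 Hy Hc; apply (ex_series_pos_le _ (fun j => c * rho ^ j)).
- intros j; split; [apply Cmod_ge_0|].
  destruct H as (Hrho & _).
  destruct j as [|j]; [rewrite Hy0, Cmult_0_l, Cmod_0; simpl; lra|].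
  rewrite Cmod_mult, Cmod_R.
  destruct (inv_pow_le (S n) (S j) 0 ltac:(lia) ltac:(lia)) as [I1 I2].
  rewrite Rabs_pos_eq by exact I1.
  simpl in I2; rewrite Rinv_1 in I2.
  rewrite <- (Rmult_1_r (c * rho ^ S j)); apply Rmult_le_compat; [apply Cmod_ge_0|exact I1|apply Hy; lia|exact I2].
- apply (ex_series_scal_l (V := R_NormedModule) c), ex_series_geom.
  pose proof (small_lt_1 _ _ _ _ _ H); destruct H as (Hrho & _); rewrite Rabs_pos_eq; lra.
Qed.

Lemma abs_series_jgen t u v w rho n : small t u v w rho ->
  ex_series (fun k => Cmod (jgen t (yw u v w) (S n) k)).
Proof.
intros H; apply (ex_series_pos_le _ (fun k => sqrt (INR (S n)) * ((Cmod t + 3) * rho) ^ k)).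
- intros k; split; [apply Cmod_ge_0|]; rewrite Rmult_comm.
  apply jgen_bound; [apply Rlt_le, H|intros j; now apply (yw_bound t u v w)|lia].
- now apply (ex_series_small t u v w).
Qed.

(** * The generating function as a [3F2] series *)

Definition root_relations (t u v w alpha beta gamma1 gamma2 : C) : Prop :=
  (alpha + beta = u + v * t)%C /\ (alpha * beta = t * (u * v - w ^ 2))%C /\
  (gamma1 + gamma2 = - u - (t - 1) * v)%C /\ (gamma1 * gamma2 = (t - 1) * (u * v - w ^ 2))%C.

Lemma denominator_factor t u v w alpha beta gamma1 gamma2 m :
  root_relations t u v w alpha beta gamma1 gamma2 ->
  ((m - alpha) * (m - beta) = m * (m - u) - t * (v * (m - u) + w ^ 2))%C.
Proof.
intros (H1 & H2 & _).
replace ((m - alpha) * (m - beta))%C with (m * m - (alpha + beta) * m + alpha * beta)%C by ring.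
rewrite H1, H2; ring.
Qed.

Lemma numerator_factor t u v w alpha beta gamma1 gamma2 m :
  root_relations t u v w alpha beta gamma1 gamma2 ->
  ((m + gamma1) * (m + gamma2) = m * (m - u) + (1 - t) * (v * (m - u) + w ^ 2))%C.
Proof.
intros (_ & _ & H1 & H2).
replace ((m + gamma1) * (m + gamma2))%C with (m * m + (gamma1 + gamma2) * m + gamma1 * gamma2)%C by ring.
rewrite H1, H2; ring.
Qed.

(** The summand at weight 0 restores the empty index, whose truncated sum is 1 but which [hmon]
    discards. *)
Definition zall (t u v w : C) (N k : nat) : C :=
  (zgen t (yw u v w) (yw u v w) N k + (if (k =? 0)%nat then 1 else 0))%C.

Lemma jgen_zall t u v w N k :
  jgen t (yw u v w) N k =
  (zall t u v w N k + t * (zall t u v w (S N) k - zall t u v w N k))%C.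
Proof.
unfold zall; destruct k as [|k].
- rewrite jgen_0, !zgen_0; simpl; ring.
- rewrite jgen_S; simpl Nat.eqb; cbv iota; ring.
Qed.

(** For the sum [e] of [jgen], [jgen_zall] and [zgen_S] give [e = z + t * f(m) * e]. Solving for [e]
    divides [z] by [1 - t * f(m)]. *)
Lemma jgen_sum t u v w rho alpha beta gamma1 gamma2 n z : small t u v w rho ->
  root_relations t u v w alpha beta gamma1 gamma2 -> Cmod alpha < 1 -> Cmod beta < 1 ->
  is_Cseries (zall t u v w (S n)) z ->
  let m := RtoC (INR (S n)) in
  is_Cseries (jgen t (yw u v w) (S n)) (m * (m - u) * z / ((m - alpha) * (m - beta)))%C.
Proof.
intros Hs Hroot Ha Hb Hz m.
assert (Hm : m <> 0%C) by apply INR_S_neq_0.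
assert (Hu := small_u _ _ _ _ _ Hs).
assert (Hmu : (m - u <> 0)%C) by now apply INR_minus_neq_0.
assert (Hma : (m - alpha <> 0)%C) by now apply INR_minus_neq_0.
assert (Hmb : (m - beta <> 0)%C) by now apply INR_minus_neq_0.
assert (HE := Cseries_correct _ (abs_series_jgen t u v w rho n Hs)).
set (e := CSeries _) in HE.
assert (HD := is_Cseries_conv _ _ _ _
   (abs_series_y t u v w rho 1 (yw u v w) n Hs eq_refl ltac:(intros j Hj; rewrite Rmult_1_l; now apply (yw_bound t u v w)) ltac:(lra))
   (abs_series_jgen t u v w rho n Hs) (yw_series u v w n Hu) HE).
assert (HE' := is_Cseries_plus _ _ _ _ Hz (is_Cseries_scal t _ _ HD)).
assert (E : e = (z + t * ((v / m + w ^ 2 / (m * (m - u))) * e))%C).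
{ apply (is_Cseries_eq _ _ _ HE); revert HE'; apply is_Cseries_ext; intros k.
  rewrite jgen_zall; f_equal; f_equal; unfold zall; rewrite zgen_S by lia.
  rewrite (Csum_conv (fun j => yw u v w j * RtoC (/ INR (S n) ^ j))%C) by (simpl; ring); ring. }
replace (m * (m - u) * z / ((m - alpha) * (m - beta)))%C with e; [exact HE|].
assert (Z : (m * (m - u) * z = e * ((m - alpha) * (m - beta)))%C).
{ rewrite (denominator_factor t u v w alpha beta gamma1 gamma2 m Hroot).
  replace z with (e - t * ((v / m + w ^ 2 / (m * (m - u))) * e))%C by (rewrite E at 1; ring).
  field; tauto. }
rewrite Z; field; tauto.
Qed.

Lemma no_pole_1_minus z : Cmod z < 1 -> no_pole (1 - z).
Proof.
intros H; apply no_pole_Re; pose proof (Rle_abs (Re z)); pose proof (re_le_Cmod z).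
destruct z; simpl in *; lra.
Qed.

(** Passing from [m] to [m + 1] adds [f(m) * e] with [e] from [jgen_sum], so the sum is multiplied
    by [(1 + (1 - t) * f(m)) / (1 - t * f(m))]. Truncation at [S n] admits the indices 1 to [n],
    hence [n] factors. *)
Lemma zall_sum t u v w rho alpha beta gamma1 gamma2 n : small t u v w rho ->
  root_relations t u v w alpha beta gamma1 gamma2 -> Cmod alpha < 1 -> Cmod beta < 1 ->
  is_Cseries (zall t u v w (S n)) (hyp_term (1 + gamma1) (1 + gamma2) (1 - beta) (1 - alpha) n).
Proof.
intros Hs Hroot Ha Hb; induction n as [|n IH].
- replace (hyp_term _ _ _ _ 0) with (1 + 0)%C by (unfold hyp_term; simpl; field).
  apply is_Cseries_cons; [unfold zall; rewrite zgen_0; simpl; ring|].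
  apply is_Cseries_0; intros k; unfold zall; rewrite zgen_1; simpl Nat.eqb; cbv iota; ring.
- assert (HE := jgen_sum _ _ _ _ _ _ _ _ _ n _ Hs Hroot Ha Hb IH); cbv zeta in HE.
  assert (Hu := small_u _ _ _ _ _ Hs).
  assert (HD := is_Cseries_conv _ _ _ _
   (abs_series_y t u v w rho 1 (yw u v w) n Hs eq_refl ltac:(intros j Hj; rewrite Rmult_1_l; now apply (yw_bound t u v w)) ltac:(lra))
   (abs_series_jgen t u v w rho n Hs) (yw_series u v w n Hu) HE).
  rewrite hyp_term_S by now apply no_pole_1_minus.
  set (z := hyp_term _ _ _ _ n) in *.
  set (m := RtoC (INR (S n))) in *.
  assert (Em : m = (1 + RtoC (INR n))%C) by (unfold m; rewrite S_INR, RtoC_plus; ring).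
  assert (Hm : m <> 0%C) by apply INR_S_neq_0.
  assert (Hmu : (m - u <> 0)%C) by now apply INR_minus_neq_0.
  assert (Hma : (m - alpha <> 0)%C) by now apply INR_minus_neq_0.
  assert (Hmb : (m - beta <> 0)%C) by now apply INR_minus_neq_0.
  replace (1 + gamma1 + RtoC (INR n))%C with (m + gamma1)%C by (rewrite Em; ring).
  replace (1 + gamma2 + RtoC (INR n))%C with (m + gamma2)%C by (rewrite Em; ring).
  replace (1 - beta + RtoC (INR n))%C with (m - beta)%C by (rewrite Em; ring).
  replace (1 - alpha + RtoC (INR n))%C with (m - alpha)%C by (rewrite Em; ring).
  rewrite (numerator_factor t u v w alpha beta gamma1 gamma2 m Hroot).
  replace (z * ((m * (m - u) + (1 - t) * (v * (m - u) + w ^ 2)) / ((m - beta) * (m - alpha))))%C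
    with (z + (v / m + w ^ 2 / (m * (m - u))) * (m * (m - u) * z / ((m - alpha) * (m - beta))))%C.
  2:{ replace (m * (m - u) + (1 - t) * (v * (m - u) + w ^ 2))%C with
       ((m - alpha) * (m - beta) + (v * (m - u) + w ^ 2))%C
        by (rewrite (denominator_factor t u v w alpha beta gamma1 gamma2 m Hroot); ring).
      field; tauto. }
  generalize (is_Cseries_plus _ _ _ _ IH HD); apply is_Cseries_ext; intros k.
  unfold zall; rewrite (zgen_S t (yw u v w) (yw u v w) (S n)) by lia.
  rewrite (Csum_conv (fun j => yw u v w j * RtoC (/ INR (S n) ^ j))%C) by (simpl; ring); ring.
Qed.

(** The weight [1 / (m * (m - u))] of the first entry cancels the numerator in [jgen_sum]. The
    denominators left over, with [m = n + 1], raise the lower parameters from [1 - beta],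
    [1 - alpha] to [2 - beta], [2 - alpha]. *)
Lemma zgen_ya_sum t u v w rho alpha beta gamma1 gamma2 n : small t u v w rho ->
  root_relations t u v w alpha beta gamma1 gamma2 -> Cmod alpha < 1 -> Cmod beta < 1 ->
  is_Cseries (zgen t (ya u) (yw u v w) (S n))
    (1 / ((1 - alpha) * (1 - beta)) *
      Csum (hyp_term (1 + gamma1) (1 + gamma2) (2 - beta) (2 - alpha)) (seq 0 n))%C.
Proof.
intros Hs Hroot Ha Hb.
assert (Pa := no_pole_1_minus _ Ha); assert (Pb := no_pole_1_minus _ Hb).
induction n as [|n IH].
- replace (_ * Csum _ _)%C with (RtoC 0) by (unfold Csum; simpl; ring).
  apply is_Cseries_0; intros k; apply zgen_1.
- assert (HE := jgen_sum _ _ _ _ _ _ _ _ _ n _ Hs Hroot Ha Hb (zall_sum _ _ _ _ _ _ _ _ _ n Hs Hroot Ha Hb)); cbv zeta in HE.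
  assert (Hu := small_u _ _ _ _ _ Hs).
  assert (HD := is_Cseries_conv _ _ _ _
   (abs_series_y t u v w rho (/ rho ^ 2) (ya u) n Hs eq_refl
     ltac:(intros [|[|j]] Hj; [lia| |now apply (ya_bound t u v w); [|lia]];
        simpl ya; rewrite Cmod_0; apply Rmult_le_pos;
        [apply Rlt_le, Rinv_0_lt_compat, pow_lt, Hs|apply pow_le, Rlt_le, Hs])
     ltac:(apply Rlt_le, Rinv_0_lt_compat, pow_lt, Hs))
   (abs_series_jgen t u v w rho n Hs) (ya_series u n Hu) HE).
  rewrite Csum_seq_S, Nat.add_0_l.
  replace (1 / ((1 - alpha) * (1 - beta)) * (Csum (hyp_term (1 + gamma1) (1 + gamma2) (2 - beta) (2 - alpha)) (seq 0 n) +
     hyp_term (1 + gamma1) (1 + gamma2) (2 - beta) (2 - alpha) n))%C with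
   (1 / ((1 - alpha) * (1 - beta)) * Csum (hyp_term (1 + gamma1) (1 + gamma2) (2 - beta) (2 - alpha)) (seq 0 n) +
    1 / (RtoC (INR (S n)) * (RtoC (INR (S n)) - u)) *
      (RtoC (INR (S n)) * (RtoC (INR (S n)) - u) * hyp_term (1 + gamma1) (1 + gamma2) (1 - beta) (1 - alpha) n /
       ((RtoC (INR (S n)) - alpha) * (RtoC (INR (S n)) - beta))))%C.
  + generalize (is_Cseries_plus _ _ _ _ IH HD); apply is_Cseries_ext; intros k.
    rewrite (zgen_S t (ya u) (yw u v w) (S n)) by lia.
    rewrite (Csum_conv (fun j => ya u j * RtoC (/ INR (S n) ^ j))%C) by (simpl; ring); ring.
  + rewrite Cmult_plus_distr_l; f_equal.
    unfold hyp_term.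
    replace (2 - beta)%C with (1 - beta + 1)%C by ring.
    replace (2 - alpha)%C with (1 - alpha + 1)%C by ring.
    assert (Hma : (RtoC (INR (S n)) - alpha <> 0)%C) by now apply INR_minus_neq_0.
    assert (Hmb : (RtoC (INR (S n)) - beta <> 0)%C) by now apply INR_minus_neq_0.
    assert (Hm : RtoC (INR (S n)) <> 0%C) by apply INR_S_neq_0.
    assert (Hmu : (RtoC (INR (S n)) - u <> 0)%C) by now apply INR_minus_neq_0.
    assert (Qa := poch_shift (1 - alpha) n); assert (Qb := poch_shift (1 - beta) n).
    replace (1 - alpha + RtoC (INR n))%C with (RtoC (INR (S n)) - alpha)%C in Qa by (rewrite S_INR, RtoC_plus; ring).
    replace (1 - beta + RtoC (INR n))%C with (RtoC (INR (S n)) - beta)%C in Qb by (rewrite S_INR, RtoC_plus; ring).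
    assert (Ra : poch (1 - alpha) n = (poch (1 - alpha + 1) n * (1 - alpha) / (RtoC (INR (S n)) - alpha))%C) by (rewrite Qa; field; assumption).
    assert (Rb : poch (1 - beta) n = (poch (1 - beta + 1) n * (1 - beta) / (RtoC (INR (S n)) - beta))%C) by (rewrite Qb; field; assumption).
    rewrite Ra, Rb.
    pose proof (poch_neq_0 _ n (no_pole_S _ Pa)); pose proof (poch_neq_0 _ n (no_pole_S _ Pb)).
    pose proof (no_pole_0 _ Pa); pose proof (no_pole_0 _ Pb).
    field; tauto.
Qed.

(** This relation turns the parameter excess into [1 - v] for the original series and into
    [1 - alpha] for the required one. *)
Lemma root_relations_sum t u v w alpha beta gamma1 gamma2 :
  root_relations t u v w alpha beta gamma1 gamma2 -> (gamma1 + gamma2 = v - alpha - beta)%C.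
Proof.
intros (H1 & _ & H3 & _); rewrite H3.
replace (v - alpha - beta)%C with (v - (alpha + beta))%C by ring; rewrite H1; ring.
Qed.

Lemma Phi0_small t u v w rho alpha beta gamma1 gamma2 : small t u v w rho ->
  root_relations t u v w alpha beta gamma1 gamma2 -> Cmod alpha < 1 -> Cmod beta < 1 ->
  Phi0 t u v w = (1 / ((1 - alpha) * (1 - beta)) *
    CSeries (hyp_term (1 + gamma1) (1 + gamma2) (2 - beta) (2 - alpha)))%C.
Proof.
intros Hs Hroot Ha Hb.
(* The truncated sums have two limits to be compared: term by term in the weight, by domination, and
   as partial sums of the hypergeometric series. *)
assert (L1 : filterlim (fun N => CSeries (zgen t (ya u) (yw u v w) (S N))) eventually
  (locally (CSeries (phi t u v w)))).
{ apply (Ctannery eventually (fun N => zgen t (ya u) (yw u v w) (S N)) _ (coef_bound t rho)).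
  - intros k P HP; destruct (phi_limit t u v w k P HP) as [N HN]; exists N; intros n Hn; apply HN; lia.
  - exists 0%nat; intros; now apply zgen_ya_bound.
  - now apply (ex_series_coef_bound t u v w). }
assert (Hsum := root_relations_sum _ _ _ _ _ _ _ _ Hroot).
assert (Hre : Re gamma1 + Re gamma2 = Re v - Re alpha - Re beta).
{ apply (f_equal Re) in Hsum; destruct gamma1, gamma2, v, alpha, beta; simpl in *; lra. }
assert (Hv : Re v < 1).
{ pose proof (Rle_abs (Re v)); pose proof (re_le_Cmod v); pose proof (small_lt_1 _ _ _ _ _ Hs).
  destruct Hs as (_ & _ & Hv & _); lra. }
destruct (hyp_term_raabe (1 + gamma1) (1 + gamma2) (2 - beta) (2 - alpha)) as [Hex _].
{ replace (2 - beta)%C with (1 - beta + 1)%C by ring; now apply no_pole_S, no_pole_1_minus. }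
{ replace (2 - alpha)%C with (1 - alpha + 1)%C by ring; now apply no_pole_S, no_pole_1_minus. }
{ destruct gamma1, gamma2, v, alpha, beta; simpl in *; lra. }
assert (L2 := proj1 (is_Cseries_Csum _ _) (Cseries_correct _ Hex)).
assert (L3 := filterlim_Cmult _ _ _ _ _ (filterlim_const (1 / ((1 - alpha) * (1 - beta)))%C) L2).
rewrite Phi0_phi; apply (filterlim_locally_unique _ _ _ L1).
eapply filterlim_ext; [|exact L3].
intros n; symmetry; apply CSeries_unique, (zgen_ya_sum t u v w rho); assumption.
Qed.

(** * Absolute convergence for small variables *)

(** The majorant is kept in [C] so that the same expression, evaluated at real majorants of its
    variables, can serve as the bound. *)
Definition dominated (z z' : C) : Prop := exists r : R, z' = RtoC r /\ Cmod z <= r.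

Lemma dominated_mult a a' b b' : dominated a a' -> dominated b b' -> dominated (a * b)%C (a' * b')%C.
Proof.
intros (r & -> & Hr) (s & -> & Hs); exists (r * s); split; [now rewrite RtoC_mult|].
rewrite Cmod_mult; apply Rmult_le_compat; try apply Cmod_ge_0; assumption.
Qed.

Lemma dominated_pow a a' n : dominated a a' -> dominated (a ^ n)%C (a' ^ n)%C.
Proof.
intros H; induction n as [|n IH]; [exists 1; split; [reflexivity|simpl; rewrite Cmod_1; lra]|].
now apply dominated_mult.
Qed.

Lemma dominated_Csum {A} (f g : A -> C) l : (forall x, dominated (f x) (g x)) ->
  exists r, Csum g l = RtoC r /\ fold_right Rplus 0 (map (fun x => Cmod (f x)) l) <= r.
Proof.
intros H; induction l as [|x l (r & Hr & IH)]; [exists 0; split; [reflexivity|simpl; lra]|].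
destruct (H x) as (s & Hs & Hf); exists (s + r); split.
- rewrite Csum_cons, Hs, Hr, RtoC_plus; reflexivity.
- simpl; lra.
Qed.

Lemma dominated_Csum_total {A} (f g : A -> C) l : (forall x, dominated (f x) (g x)) ->
  dominated (Csum f l) (Csum g l).
Proof.
intros H; destruct (dominated_Csum f g l H) as (r & Hr & Hf); exists r; split; [exact Hr|].
eapply Rle_trans; [apply Csum_Cmod_le|exact Hf].
Qed.

Lemma dominated_RtoC x : 0 <= x -> dominated (RtoC x) (RtoC x).
Proof. intros H; exists x; split; [reflexivity|]; rewrite Cmod_R, Rabs_pos_eq; lra. Qed.

Lemma mzv_pos ks : 0 <= mzv ks.
Proof.
unfold mzv; assert (H : Rbar_le 0 (Lim_seq (mzv_trunc ks))).
{ rewrite <- (Lim_seq_const 0); apply Lim_seq_le_loc; exists 0%nat; intros; apply mzv_trunc_pos. }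
destruct (Lim_seq (mzv_trunc ks)); simpl in *; lra.
Qed.

Lemma dominated_mzv_t t ks : dominated (mzv_t t ks) (mzv_t (RtoC (Cmod t)) ks).
Proof.
assert (Ht : dominated t (RtoC (Cmod t))) by (exists (Cmod t); split; [reflexivity|lra]).
destruct ks as [|k ks]; [apply dominated_RtoC; lra|].
apply dominated_Csum_total; intros p; apply dominated_mult; [now apply dominated_pow|].
apply dominated_RtoC, mzv_pos.
Qed.

(** [phi_bound] controls only the total of each weight, where cancellation is possible. With [t]
    replaced by [Cmod t] and [u], [v], [w] by [rho] all terms are nonnegative, so the total
    dominates the sum of moduli. *)
Lemma Phi0_abs_conv_small t u v w rho : small t u v w rho -> Phi0_abs_conv t u v w.
Proof.
intros Hs; pose proof Hs as (Hrho & Hu & Hv & Hw & Ht).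
set (T := RtoC (Cmod t)); set (r := RtoC rho).
assert (ET : Cmod T = Cmod t) by (unfold T; rewrite Cmod_R, Rabs_pos_eq; [reflexivity|apply Cmod_ge_0]).
assert (Er : Cmod r = rho) by (unfold r; rewrite Cmod_R, Rabs_pos_eq; lra).
assert (Hs' : small T r r r rho) by (unfold small; rewrite ET, Er; lra).
apply (ex_series_pos_le _ (coef_bound T rho)); [|now apply (ex_series_coef_bound T r r r)].
intros k; split.
- induction (depth_heights k) as [|p l IH]; simpl; [lra|].
  pose proof (Cmod_ge_0 (Phi0_term t u v w k (fst p) (snd p))); lra.
- destruct (dominated_Csum (fun p => Phi0_term t u v w k (fst p) (snd p))
    (fun p => Phi0_term T r r r k (fst p) (snd p)) (depth_heights k)) as (x & Hx & Hle).
  + intros p; unfold Phi0_term, X0.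
    assert (Du : dominated u r) by now exists rho.
    assert (Dv : dominated v r) by now exists rho.
    assert (Dw : dominated w r) by now exists rho.
    repeat apply dominated_mult; try now apply dominated_pow.
    apply dominated_Csum_total, dominated_mzv_t.
  + eapply Rle_trans; [exact Hle|].
    rewrite Phi0_coef in Hx.
    pose proof (phi_bound T r r r rho k Hs') as Hb; rewrite Hx, Cmod_R in Hb.
    pose proof (Rle_abs x); lra.
Qed.

(** * Absolutely summable power series on [-1, 1] *)

(** The endpoint [x = 1] is included, with no convergence demanded beyond it. The bound [B] on the
    l1 norm is recorded so that infinite sums of such functions can be formed. *)
Definition wiener (f : R -> C) (B : R) : Prop :=
  exists a : nat -> C, ex_series (fun n => Cmod (a n)) /\ Series (fun n => Cmod (a n)) <= B /\
    forall x, Rabs x <= 1 -> is_Cseries (fun n => a n * RtoC x ^ n)%C (f x).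

Lemma Cmod_mult_pow_le (c : C) x n : Rabs x <= 1 -> Cmod (c * RtoC x ^ n)%C <= Cmod c.
Proof.
intros Hx; rewrite Cmod_mult, Cmod_pow, Cmod_R.
rewrite <- (Rmult_1_r (Cmod c)) at 2; apply Rmult_le_compat_l; [apply Cmod_ge_0|].
rewrite <- (pow1 n); apply pow_incr; split; [apply Rabs_pos|exact Hx].
Qed.

Lemma ex_series_Cmod_pow (a : nat -> C) x : Rabs x <= 1 ->
  ex_series (fun n => Cmod (a n)) -> ex_series (fun n => Cmod (a n * RtoC x ^ n)%C).
Proof.
intros Hx; apply ex_series_pos_le; intros n; split; [apply Cmod_ge_0|now apply Cmod_mult_pow_le].
Qed.

Lemma wiener_ext f g B : (forall x, Rabs x <= 1 -> f x = g x) -> wiener f B -> wiener g B.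
Proof.
intros H (a & Ha & HB & Hs); exists a; repeat split; try assumption.
intros x Hx; rewrite <- H by exact Hx; now apply Hs.
Qed.

Lemma wiener_affine (c g : C) : wiener (fun x => c + g * RtoC x)%C (Cmod c + Cmod g).
Proof.
set (a := fun n => match n with O => c | S O => g | _ => RtoC 0 end).
assert (Hr : is_series (fun n => Cmod (a n)) (Cmod c + Cmod g)).
{ apply (is_series_decr_1 (V := R_NormedModule)), (is_series_decr_1 (V := R_NormedModule)).
  replace (plus _ _) with 0 by (unfold plus, opp; simpl; ring).
  apply (filterlim_ext (fun _ => 0)); [|apply filterlim_const].
  intros n; simpl; rewrite Cmod_0; symmetry; induction n as [|n IH]; [apply sum_O|].
  rewrite sum_Sn, IH; unfold plus; simpl; ring. }
exists a; repeat split; [eexists; exact Hr|rewrite (is_series_unique _ _ Hr); lra|].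
intros x _; replace (c + g * RtoC x)%C with (c + (g * RtoC x + 0))%C by ring.
apply is_Cseries_cons; [simpl; ring|]; apply is_Cseries_cons; [simpl; ring|].
apply is_Cseries_0; intros n; simpl; ring.
Qed.

Lemma wiener_plus f g B D : wiener f B -> wiener g D -> wiener (fun x => f x + g x)%C (B + D).
Proof.
intros (a & Ha & HB & Hf) (b & Hb & HD & Hg).
assert (E : ex_series (fun n => Cmod (a n) + Cmod (b n))) by now apply (ex_series_plus (V := R_NormedModule)).
assert (L : forall n, 0 <= Cmod (a n + b n)%C <= Cmod (a n) + Cmod (b n)).
{ intros n; split; [apply Cmod_ge_0|apply Cmod_triangle]. }
exists (fun n => a n + b n)%C; repeat split.
- exact (ex_series_pos_le _ _ L E).
- eapply Rle_trans; [apply (Series_le _ _ L E)|]; rewrite Series_plus by assumption; lra.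
- intros x Hx; generalize (is_Cseries_plus _ _ _ _ (Hf x Hx) (Hg x Hx)); apply is_Cseries_ext; intros; ring.
Qed.

Lemma wiener_mult f g B D : wiener f B -> wiener g D -> wiener (fun x => f x * g x)%C (B * D).
Proof.
intros (a & Ha & HB & Hf) (b & Hb & HD & Hg).
destruct (ex_series_Cmod_conv a b Ha Hb) as [E L].
assert (P : forall c : nat -> C, ex_series (fun n => Cmod (c n)) -> 0 <= Series (fun n => Cmod (c n))).
{ intros c Hc; rewrite <- (Rmult_0_l (Series (fun n => Cmod (c n)))), <- Series_scal_l.
  apply Series_le; [|exact Hc]; intros n; pose proof (Cmod_ge_0 (c n)); lra. }
exists (Cconv a b); repeat split; [exact E| |].
- eapply Rle_trans; [exact L|apply Rmult_le_compat; auto].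
- intros x Hx.
  generalize (is_Cseries_conv _ _ _ _ (ex_series_Cmod_pow a x Hx Ha) (ex_series_Cmod_pow b x Hx Hb) (Hf x Hx) (Hg x Hx)).
  apply is_Cseries_ext; intros n; unfold Cconv; rewrite Cmult_comm, <- Csum_scal; apply Csum_ext.
  intros k Hk; apply in_seq in Hk; replace n with (k + (n - k))%nat at 3 by lia; rewrite Cpow_add_r; ring.
Qed.

Lemma wiener_inv (c al : C) : Cmod al < Cmod c ->
  wiener (fun x => 1 / (c - al * RtoC x))%C (/ (Cmod c - Cmod al)).
Proof.
intros H; pose proof (Cmod_ge_0 al) as H0.
assert (Hc : c <> 0%C) by (intros ->; rewrite Cmod_0 in H; lra).
assert (Hq : forall n, Cmod (/ c * (al / c) ^ n)%C = / Cmod c * (Cmod al / Cmod c) ^ n).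
{ intros n; rewrite Cmod_mult, Cmod_pow, Cmod_inv, Cmod_div by exact Hc; reflexivity. }
assert (Hlt : Cmod al / Cmod c < 1).
{ apply (Rmult_lt_reg_r (Cmod c)); [lra|]; unfold Rdiv; rewrite Rmult_assoc, Rinv_l; lra. }
assert (Hge : 0 <= Cmod al / Cmod c) by (apply Rmult_le_pos; [exact H0|apply Rlt_le, Rinv_0_lt_compat; lra]).
assert (Hs : is_series (fun n => Cmod (/ c * (al / c) ^ n)%C) (/ (Cmod c - Cmod al))).
{ replace (/ (Cmod c - Cmod al)) with (/ Cmod c * / (1 - Cmod al / Cmod c)) by (field; lra).
  apply (is_series_ext (fun n => / Cmod c * (Cmod al / Cmod c) ^ n)); [intros; now rewrite Hq|].
  apply (is_series_scal_l (V := R_NormedModule)), is_series_geom; rewrite Rabs_pos_eq; assumption. }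
exists (fun n => / c * (al / c) ^ n)%C; repeat split.
- eexists; exact Hs.
- rewrite (is_series_unique _ _ Hs); lra.
- intros x Hx.
  assert (Hax : Cmod (al * RtoC x / c) < 1).
  { rewrite Cmod_div, Cmod_mult, Cmod_R by exact Hc.
    eapply Rle_lt_trans; [|exact Hlt]; apply Rmult_le_compat_r; [apply Rlt_le, Rinv_0_lt_compat; lra|].
    rewrite <- (Rmult_1_r (Cmod al)) at 2; now apply Rmult_le_compat_l. }
  assert (Hcx : (c - al * RtoC x <> 0)%C).
  { intros E; assert (E' : (al * RtoC x = c)%C) by (replace c with ((c - al * RtoC x) + al * RtoC x)%C by ring; rewrite E; ring).
    rewrite E' in Hax; unfold Cdiv in Hax; rewrite Cinv_r, Cmod_1 in Hax by exact Hc; lra. }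
  replace (1 / (c - al * RtoC x))%C with (/ c * (1 / (1 - al * RtoC x / c)))%C by (field; tauto).
  generalize (is_Cseries_scal (/ c) _ _ (is_Cseries_geom _ Hax)); apply is_Cseries_ext; intros n.
  unfold Cdiv; rewrite !Cpow_mult_l; ring.
Qed.

Lemma Series_sum_n (a : nat -> nat -> R) K : (forall k, ex_series (fun n => a n k)) ->
  ex_series (fun n => sum_n (a n) K) /\
  Series (fun n => sum_n (a n) K) = sum_n (fun k => Series (fun n => a n k)) K.
Proof.
intros H; induction K as [|K [IH1 IH2]].
- split; [apply (ex_series_ext (fun n => a n O)); [intros; now rewrite sum_O|apply H]|].
  rewrite sum_O; apply Series_ext; intros; apply sum_O.
- split.
  + apply (ex_series_ext (fun n => plus (sum_n (a n) K) (a n (S K)))); [intros; now rewrite sum_Sn|].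
    now apply (ex_series_plus (V := R_NormedModule)).
  + rewrite sum_Sn, <- IH2; unfold plus; simpl; rewrite <- Series_plus by (try assumption; apply H).
    apply Series_ext; intros; now rewrite sum_Sn.
Qed.

Lemma term_le_Series (a : nat -> R) k : (forall n, 0 <= a n) -> ex_series a -> a k <= Series a.
Proof.
intros H0 Ha.
assert (Hs := Series_correct _ Ha).
assert (Hk : forall n, (k <= n)%nat -> a k <= sum_n a n).
{ assert (P : forall n, 0 <= sum_n a n).
  { induction n as [|n IH]; [rewrite sum_O; apply H0|rewrite sum_Sn; apply Rplus_le_le_0_compat; [exact IH|apply H0]]. }
  intros n Hn; induction Hn as [|n Hn IH].
  - destruct k; [rewrite sum_O; lra|]; rewrite sum_Sn; specialize (P k); unfold plus; simpl; lra.
  - rewrite sum_Sn; specialize (H0 (S n)); unfold plus; simpl; lra. }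
apply (filterlim_le (F := eventually) (fun _ => a k) (sum_n a) (a k) (Series a)).
- exists k; exact Hk.
- apply filterlim_const.
- exact Hs.
Qed.

(** Completeness of l1: the coefficients form an absolutely summable double array, so they may be
    summed over [n] first. *)
Lemma wiener_series (f : nat -> R -> C) (B : nat -> R) :
  (forall n, wiener (f n) (B n)) -> ex_series B ->
  exists D, wiener (fun x => CSeries (fun n => f n x)) D.
Proof.
intros Hf HB.
destruct (functional_choice _ Hf) as [a Ha].
assert (Hak : forall n k, Cmod (a n k) <= B n).
{ intros n k; destruct (Ha n) as (E & L & _); eapply Rle_trans; [|exact L].
  apply (term_le_Series (fun k => Cmod (a n k))); [intros; apply Cmod_ge_0|exact E]. }
assert (Hcol : forall k, ex_series (fun n => Cmod (a n k))).
{ intros k; apply (ex_series_pos_le _ B); [|exact HB]; intros n; split; [apply Cmod_ge_0|apply Hak]. }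
set (M := fun k => Series (fun n => Cmod (a n k))).
assert (HM : ex_series M).
{ apply (ex_series_bounded M (Series B)).
  - intros k; rewrite <- (Rmult_0_l (M k)); unfold M; rewrite <- Series_scal_l.
    apply Series_le; [|apply Hcol]; intros n; pose proof (Cmod_ge_0 (a n k)); lra.
  - intros K; destruct (Series_sum_n (fun n k => Cmod (a n k)) K Hcol) as [_ E]; unfold M; rewrite <- E.
    apply Series_le; [|exact HB]; intros n; split.
    + apply (Rle_trans _ (sum_n (fun _ => 0) K)); [|apply sum_n_m_le; intros; apply Cmod_ge_0].
      apply Req_le; symmetry; apply (sum_n_m_const_zero (G := R_AbelianMonoid)).
    + destruct (Ha n) as (Ea & La & _); eapply Rle_trans; [|exact La].
      apply (filterlim_le (F := eventually) (fun _ => sum_n (fun k => Cmod (a n k)) K) (sum_n (fun k => Cmod (a n k))) (sum_n (fun k => Cmod (a n k)) K) (Series (fun k => Cmod (a n k)))).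
      * exists K; intros N HN; induction HN as [|N HN IH]; [lra|].
        rewrite sum_Sn; pose proof (Cmod_ge_0 (a n (S N))); unfold plus; simpl; lra.
      * apply filterlim_const.
      * exact (Series_correct _ Ea). }
set (A := fun k => CSeries (fun n => a n k)).
assert (HA : forall k, Cmod (A k) <= 2 * M k).
{ intros k; apply Cmod_CSeries_le; [intros; lra|apply Hcol]. }
assert (EA : ex_series (fun k => Cmod (A k))).
{ apply (ex_series_pos_le _ (fun k => 2 * M k)); [intros; split; [apply Cmod_ge_0|apply HA]|].
  now apply (ex_series_scal_l (V := R_NormedModule) 2). }
exists (Series (fun k => Cmod (A k))), A; repeat split; [exact EA|lra|].
intros x Hx.
assert (Hser : forall N, is_Cseries (fun k => Csum (fun n => a n k) (seq 0 N) * RtoC x ^ k)%C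
   (Csum (fun n => f n x) (seq 0 N))).
{ induction N as [|N IH]; [apply is_Cseries_0; intros; unfold Csum; simpl; ring|].
  rewrite Csum_seq_S; destruct (Ha N) as (_ & _ & HN).
  generalize (is_Cseries_plus _ _ _ _ IH (HN x Hx)); apply is_Cseries_ext; intros k.
  rewrite Csum_seq_S, Nat.add_0_l; ring. }
(* The exchange of summations is dominated convergence in the number [N] of functions, with the
   column sums [M] as majorant. *)
assert (L1 : filterlim (fun N => CSeries (fun k => Csum (fun n => a n k) (seq 0 N) * RtoC x ^ k)%C) eventually
   (locally (CSeries (fun k => A k * RtoC x ^ k)%C))).
{ apply (Ctannery eventually (fun N k => Csum (fun n => a n k) (seq 0 N) * RtoC x ^ k)%C _ M); [| |exact HM].
  - intros k; apply filterlim_Cmult; [apply eventually_filter| |apply filterlim_const].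
    apply is_Cseries_Csum, Cseries_correct, Hcol.
  - exists 0%nat; intros N _ k; rewrite Cmod_mult, Cmod_pow, Cmod_R.
    rewrite <- (Rmult_1_r (M k)); apply Rmult_le_compat; [apply Cmod_ge_0|apply pow_le, Rabs_pos| |].
    + eapply Rle_trans; [apply Csum_Cmod_le|].
      destruct N as [|N].
      * simpl; eapply Rle_trans; [apply (Cmod_ge_0 (a O k))|].
        apply (term_le_Series (fun n => Cmod (a n k))); [intros; apply Cmod_ge_0|apply Hcol].
      * rewrite fold_seq_sum, <- sum_n_Reals.
        apply (filterlim_le (F := eventually) (fun _ => sum_n (fun n => Cmod (a n k)) N) (sum_n (fun n => Cmod (a n k))) (sum_n (fun n => Cmod (a n k)) N) (M k)).
        -- exists N; intros N' HN; induction HN as [|N' HN IH]; [lra|].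
           rewrite sum_Sn; pose proof (Cmod_ge_0 (a (S N') k)); unfold plus; simpl; lra.
        -- apply filterlim_const.
        -- exact (Series_correct _ (Hcol k)).
    + rewrite <- (pow1 k); apply pow_incr; split; [apply Rabs_pos|exact Hx]. }
assert (Hfx : ex_series (fun n => Cmod (f n x))).
{ apply (ex_series_pos_le _ (fun n => 2 * B n)); [|now apply (ex_series_scal_l (V := R_NormedModule) 2)].
  intros n; split; [apply Cmod_ge_0|]; destruct (Ha n) as (E & L & Hn).
  rewrite <- (CSeries_unique _ _ (Hn x Hx)).
  eapply Rle_trans; [apply (Cmod_CSeries_le _ (fun k => Cmod (a n k)))|lra]; [|exact E].
  intros k; now apply Cmod_mult_pow_le. }
assert (L2 := proj1 (is_Cseries_Csum _ _) (Cseries_correct _ Hfx)).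
assert (L3 : filterlim (fun N => CSeries (fun k => Csum (fun n => a n k) (seq 0 N) * RtoC x ^ k)%C) eventually
   (locally (CSeries (fun n => f n x)))).
{ eapply filterlim_ext; [|exact L2]; intros N; symmetry; apply CSeries_unique, Hser. }
rewrite (filterlim_locally_unique _ _ _ L3 L1).
apply Cseries_correct, ex_series_Cmod_pow; assumption.
Qed.

Lemma PSeries_zero_near_0 (a : nat -> R) (delta : R) : 0 < delta ->
  ex_series (fun n => Rabs (a n)) ->
  (forall x, Rabs x < delta -> Series (fun n => a n * x ^ n) = 0) -> forall n, a n = 0.
Proof.
intros Hd Ha H n.
assert (Hcv : Rbar_lt 0 (CV_radius a)).
{ apply (Rbar_lt_le_trans _ (Finite 1)); [simpl; lra|].
  apply Rbar_not_lt_le; intros Hlt.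
  apply (CV_disk_outside a 1); [rewrite Rabs_R1; exact Hlt|].
  apply (is_lim_seq_ext a); [intros k; rewrite pow1; ring|].
  apply ex_series_lim_0, ex_series_Rabs, Ha. }
apply (PSeries_ext_recip a (fun _ => 0) n Hcv); [rewrite CV_radius_const_0; exact I|].
exists (mkposreal _ Hd); intros x Hx.
assert (Hx' : Rabs (x - 0) < delta) by exact Hx; rewrite Rminus_0_r in Hx'.
rewrite PSeries_const_0; apply H, Hx'.
Qed.

(** Vanishing near 0 annihilates every coefficient, hence also the value at the endpoint, although 1
    may lie on the circle of convergence. *)
Lemma wiener_unique f B delta : wiener f B -> 0 < delta -> delta <= 1 ->
  (forall x, Rabs x < delta -> f x = RtoC 0) -> f 1 = RtoC 0.
Proof.
intros (a & Ha & _ & Hs) Hd Hd1 H0.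
assert (Hre : forall n, Re (a n) = 0 /\ Im (a n) = 0).
{ assert (HH : forall x, Rabs x < delta ->
    Series (fun n => Re (a n) * x ^ n) = 0 /\ Series (fun n => Im (a n) * x ^ n) = 0).
  { intros x Hx; pose proof (Hs x ltac:(lra)) as Hx'; rewrite H0 in Hx' by exact Hx.
    apply is_Cseries_iff in Hx'; destruct Hx' as [R1 R2].
    split; apply is_series_unique.
    - revert R1; apply is_series_ext; intros n; rewrite <- RtoC_pow; destruct (a n); simpl; ring.
    - revert R2; apply is_series_ext; intros n; rewrite <- RtoC_pow; destruct (a n); simpl; ring. }
  intros n; split.
  - apply (PSeries_zero_near_0 (fun n => Re (a n)) delta); [exact Hd| |intros x Hx; now apply HH].
    exact (ex_series_Rabs_le _ _ (fun n => re_le_Cmod (a n)) Ha).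
  - apply (PSeries_zero_near_0 (fun n => Im (a n)) delta); [exact Hd| |intros x Hx; now apply HH].
    exact (ex_series_Rabs_le _ _ (fun n => im_le_Cmod (a n)) Ha). }
apply (is_Cseries_eq _ _ _ (Hs 1 ltac:(rewrite Rabs_R1; lra))), is_Cseries_0.
intros n; destruct (Hre n) as [R1 R2]; replace (a n) with (RtoC 0); [ring|].
destruct (a n); simpl in *; now rewrite R1, R2.
Qed.

(** * Quotients of such series, compared near 0 and evaluated at 1 *)

(** The points at which denominators are checked: a factor such as [1 - v * x] may vanish in
    between. *)
Definition near_or_1 (delta x : R) : Prop := Rabs x < delta \/ x = 1.

(* [f 1] is determined by [f] near 0, although [f] is not controlled in between;
   [delta] is meant to be at most 1. *)
Definition regular (delta : R) (f : R -> C) : Prop :=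
  exists (g q : R -> C) (B D : R), wiener g B /\ wiener q D /\ q 1 <> RtoC 0 /\
    forall x, near_or_1 delta x -> (f x * q x = g x)%C.

Lemma regular_ext delta f g : (forall x, near_or_1 delta x -> f x = g x) ->
  regular delta f -> regular delta g.
Proof.
intros H (p & q & B & D & Hp & Hq & Hq1 & E); exists p, q, B, D; repeat split; try assumption.
intros x Hx; rewrite <- H by exact Hx; now apply E.
Qed.

Lemma regular_wiener delta f B : wiener f B -> regular delta f.
Proof.
intros H; exists f, (fun x => 1 + 0 * RtoC x)%C, B, (Cmod 1 + Cmod 0); repeat split.
- exact H.
- apply wiener_affine.
- replace (1 + 0 * RtoC 1)%C with (RtoC 1) by ring; apply C1_nz.
- intros x _; ring.
Qed.

Lemma regular_affine delta c g : regular delta (fun x => c + g * RtoC x)%C.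
Proof. eapply regular_wiener, wiener_affine. Qed.

Lemma regular_const delta c : regular delta (fun _ => c).
Proof. apply (regular_ext _ (fun x => c + 0 * RtoC x)%C); [intros; ring|apply regular_affine]. Qed.

Lemma regular_plus delta f g : regular delta f -> regular delta g -> regular delta (fun x => f x + g x)%C.
Proof.
intros (p & q & B & D & Hp & Hq & Hq1 & E) (p' & q' & B' & D' & Hp' & Hq' & Hq1' & E').
exists (fun x => p x * q' x + p' x * q x)%C, (fun x => q x * q' x)%C, (B * D' + B' * D), (D * D'); repeat split.
- apply wiener_plus; now apply wiener_mult.
- now apply wiener_mult.
- now apply Cmult_neq_0.
- intros x Hx; rewrite <- E, <- E' by exact Hx; ring.
Qed.

Lemma regular_mult delta f g : regular delta f -> regular delta g -> regular delta (fun x => f x * g x)%C.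
Proof.
intros (p & q & B & D & Hp & Hq & Hq1 & E) (p' & q' & B' & D' & Hp' & Hq' & Hq1' & E').
exists (fun x => p x * p' x)%C, (fun x => q x * q' x)%C, (B * B'), (D * D'); repeat split.
- now apply wiener_mult.
- now apply wiener_mult.
- now apply Cmult_neq_0.
- intros x Hx; rewrite <- E, <- E' by exact Hx; ring.
Qed.

Lemma regular_inv delta f : (forall x, near_or_1 delta x -> f x <> RtoC 0) ->
  regular delta f -> regular delta (fun x => / f x)%C.
Proof.
intros H0 (p & q & B & D & Hp & Hq & Hq1 & E).
exists q, p, D, B; repeat split; [exact Hq|exact Hp| |].
- rewrite <- E by now right.
  apply Cmult_neq_0; [apply H0; now right|exact Hq1].
- intros x Hx; rewrite <- E by exact Hx; field; now apply H0.
Qed.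

Lemma regular_div delta f g : (forall x, near_or_1 delta x -> g x <> RtoC 0) ->
  regular delta f -> regular delta g -> regular delta (fun x => f x / g x)%C.
Proof. intros H0 Hf Hg; apply regular_mult; [exact Hf|now apply regular_inv]. Qed.

Lemma regular_poch delta f n : regular delta f -> regular delta (fun x => poch (f x) n).
Proof.
intros H; induction n as [|n IH]; [exact (regular_const delta (RtoC 1))|].
simpl; apply regular_mult; [exact IH|apply regular_plus; [exact H|apply regular_const]].
Qed.

Lemma regular_Csum delta (f : nat -> R -> C) l : (forall k, regular delta (f k)) ->
  regular delta (fun x => Csum (fun k => f k x) l).
Proof.
intros H; induction l as [|k l IH]; [exact (regular_const delta (RtoC 0))|].
apply (regular_ext _ (fun x => f k x + Csum (fun k => f k x) l)%C); [reflexivity|].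
now apply regular_plus.
Qed.

Lemma regular_unique delta f h : 0 < delta -> delta <= 1 -> regular delta f -> regular delta h ->
  (forall x, Rabs x < delta -> f x = h x) -> f 1 = h 1.
Proof.
intros Hd Hd1 (p & q & B & D & Hp & Hq & Hq1 & E) (p' & q' & B' & D' & Hp' & Hq' & Hq1' & E') H.
assert (W := wiener_plus _ _ _ _ (wiener_mult _ _ _ _ Hp Hq')
  (wiener_mult _ _ _ _ (wiener_affine (- (1)) 0) (wiener_mult _ _ _ _ Hp' Hq))).
assert (Z := wiener_unique _ _ delta W Hd Hd1); cbv beta in Z.
specialize (E 1 (or_intror eq_refl)) as E1; specialize (E' 1 (or_intror eq_refl)) as E1'.
rewrite <- E1, <- E1' in Z.
assert (Z' : ((f 1 - h 1) * (q 1 * q' 1) = 0)%C).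
{ rewrite <- Z; [ring|]; intros x Hx.
  rewrite <- (E x), <- (E' x), (H x Hx) by now left. ring. }
destruct (Ceq_dec (f 1) (h 1)) as [e|ne]; [exact e|exfalso].
apply (Cmult_neq_0 (f 1 - h 1) (q 1 * q' 1)); [|now apply Cmult_neq_0|exact Z'].
intros e; apply ne; replace (f 1) with ((f 1 - h 1) + h 1)%C by ring; rewrite e; ring.
Qed.

(** * Identification at the given point *)

Lemma regular_minus delta f g : regular delta f -> regular delta g -> regular delta (fun x => f x - g x)%C.
Proof.
intros Hf Hg; apply (regular_ext _ (fun x => f x + (- (1)) * g x)%C); [intros; ring|].
apply regular_plus; [exact Hf|apply regular_mult; [apply regular_const|exact Hg]].
Qed.

Lemma regular_id delta : regular delta RtoC.
Proof. apply (regular_ext _ (fun x => 0 + 1 * RtoC x)%C); [intros; ring|apply regular_affine]. Qed.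

Ltac regular_ring := repeat match goal with
  | |- regular _ (fun x => (_ - _)%C) => apply regular_minus
  | |- regular _ (fun x => (_ + _)%C) => apply regular_plus
  | |- regular _ (fun x => (_ * _)%C) => apply regular_mult
  | |- regular _ (fun x => poch _ _) => apply regular_poch
  | |- regular _ _ => first [apply regular_const | apply regular_id]
  end.

Lemma poch_add (b : C) m n : poch b (m + n) = (poch b m * poch (b + RtoC (INR m)) n)%C.
Proof.
induction n as [|n IH]; [rewrite Nat.add_0_r; simpl; ring|].
rewrite Nat.add_succ_r; simpl; rewrite IH, plus_INR, RtoC_plus; ring.
Qed.

Lemma hyp_term_add b c d e m n : no_pole d -> no_pole e ->
  hyp_term b c d e (m + n) = (hyp_term b c d e m *
   hyp_term (b + RtoC (INR m)) (c + RtoC (INR m)) (d + RtoC (INR m)) (e + RtoC (INR m)) n)%C.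
Proof.
intros Hd He; unfold hyp_term; rewrite !poch_add.
pose proof (poch_neq_0 _ m Hd); pose proof (poch_neq_0 _ m He).
pose proof (poch_neq_0 _ n (no_pole_plus _ m Hd)); pose proof (poch_neq_0 _ n (no_pole_plus _ m He)).
field; tauto.
Qed.

Lemma CSeries_split (h : nat -> C) L : ex_series (fun n => Cmod (h n)) ->
  CSeries h = (Csum h (seq 0 L) + CSeries (fun n => h (L + n)%nat))%C.
Proof.
intros H; induction L as [|L IH]; [unfold Csum; simpl; rewrite Cplus_0_l; now apply CSeries_ext|].
rewrite IH, Csum_seq_S, Nat.add_0_l, <- Cplus_assoc; f_equal.
apply CSeries_unique, is_Cseries_cons; [f_equal; lia|].
apply (is_Cseries_ext (fun n => h (S L + n)%nat)); [intros; f_equal; lia|].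
apply Cseries_correct, (ex_series_incr_n (V := R_NormedModule) (fun n => Cmod (h n)) (S L)), H.
Qed.

Lemma Re_mult_RtoC (z : C) x : Re (z * RtoC x)%C = Re z * x.
Proof. destruct z; simpl; ring. Qed.

Lemma Re_mult_le (z : C) x : Rabs x <= 1 -> Rabs (Re z * x) <= Cmod z.
Proof.
intros Hx; rewrite Rabs_mult, <- (Rmult_1_r (Cmod z)).
apply Rmult_le_compat; try apply Rabs_pos; [apply re_le_Cmod|exact Hx].
Qed.

Lemma Cmod_RtoC_pos x : 0 <= x -> Cmod (RtoC x) = x.
Proof. intros H; rewrite Cmod_R; now apply Rabs_pos_eq. Qed.

Lemma no_pole_minus (d : R) (z : C) x : Cmod z < d -> Rabs x <= 1 -> no_pole (RtoC d - z * RtoC x).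
Proof.
intros Hd Hx; apply no_pole_Re.
pose proof (Re_mult_le z x Hx); pose proof (Rle_abs (Re z * x)).
replace (Re (RtoC d - z * RtoC x)) with (d - Re z * x); [lra|destruct z; simpl; ring].
Qed.

(** Norm bounds multiply: a numerator factor [c + gamma * x] has norm at most [c + Cmod gamma], an
    inverse factor [1 / (d - beta * x)] at most [1 / (d - Cmod beta)]. The bound is thus again a
    hypergeometric term, to which Raabe's test applies. *)
Lemma wiener_hyp_term (c1 c2 d e : R) (gamma1 gamma2 beta alpha : C) n :
  0 <= c1 -> 0 <= c2 -> Cmod beta < d -> Cmod alpha < e ->
  wiener (fun x => hyp_term (RtoC c1 + gamma1 * RtoC x) (RtoC c2 + gamma2 * RtoC x)
                     (RtoC d - beta * RtoC x) (RtoC e - alpha * RtoC x) n)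
    (Cmod (hyp_term (RtoC (c1 + Cmod gamma1)) (RtoC (c2 + Cmod gamma2))
                    (RtoC (d - Cmod beta)) (RtoC (e - Cmod alpha)) n)).
Proof.
intros H1 H2 Hd He; induction n as [|n IH].
- replace (Cmod (hyp_term _ _ _ _ 0)) with (Cmod 1 + Cmod 0).
  2:{ unfold hyp_term; simpl; rewrite Cmod_0, Cmod_div, !Cmult_1_r, Cmod_1 by (rewrite Cmult_1_r; apply C1_nz); field. }
  apply (wiener_ext (fun x => 1 + 0 * RtoC x)%C); [|apply wiener_affine].
  intros x _; unfold hyp_term; simpl; field.
- pose proof (Cmod_ge_0 gamma1); pose proof (Cmod_ge_0 gamma2).
  pose proof (Cmod_ge_0 alpha); pose proof (Cmod_ge_0 beta); pose proof (pos_INR n) as Hn.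
  rewrite hyp_term_S by (apply no_pole_Re; simpl; lra).
  rewrite Cmod_mult, Cmod_div, !Cmod_mult, <- !RtoC_plus, !Cmod_RtoC_pos by
   (try lra; rewrite <- ?RtoC_plus, <- RtoC_mult; intros E; apply RtoC_inj in E;
    apply Rmult_integral in E; destruct E; lra).
  apply (wiener_ext (fun x => hyp_term (RtoC c1 + gamma1 * RtoC x) (RtoC c2 + gamma2 * RtoC x)
       (RtoC d - beta * RtoC x) (RtoC e - alpha * RtoC x) n *
      (((RtoC (c1 + INR n) + gamma1 * RtoC x) * (RtoC (c2 + INR n) + gamma2 * RtoC x)) *
       ((1 / (RtoC (d + INR n) - beta * RtoC x)) * (1 / (RtoC (e + INR n) - alpha * RtoC x)))))%C).
  + intros x Hx.
    assert (Pd := no_pole_minus d beta x Hd Hx); assert (Pe := no_pole_minus e alpha x He Hx).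
    rewrite hyp_term_S by assumption; rewrite !RtoC_plus.
    specialize (Pd n); specialize (Pe n).
    replace (RtoC d + RtoC (INR n) - beta * RtoC x)%C with (RtoC d - beta * RtoC x + RtoC (INR n))%C by ring.
    replace (RtoC e + RtoC (INR n) - alpha * RtoC x)%C with (RtoC e - alpha * RtoC x + RtoC (INR n))%C by ring.
    field; tauto.
  + apply wiener_mult; [exact IH|].
    unfold Rdiv; apply wiener_mult.
    * replace (c1 + Cmod gamma1 + INR n) with (Cmod (RtoC (c1 + INR n)) + Cmod gamma1) by (rewrite Cmod_RtoC_pos; lra).
      replace (c2 + Cmod gamma2 + INR n) with (Cmod (RtoC (c2 + INR n)) + Cmod gamma2) by (rewrite Cmod_RtoC_pos; lra).
      apply wiener_mult; apply wiener_affine.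
    * rewrite Rinv_mult.
      replace (d - Cmod beta + INR n) with (Cmod (RtoC (d + INR n)) - Cmod beta) by (rewrite Cmod_RtoC_pos; lra).
      replace (e - Cmod alpha + INR n) with (Cmod (RtoC (e + INR n)) - Cmod alpha) by (rewrite Cmod_RtoC_pos; lra).
      apply wiener_mult; apply wiener_inv; rewrite Cmod_RtoC_pos; lra.
Qed.

Lemma near_or_1_le delta x : delta <= 1 -> near_or_1 delta x -> Rabs x <= 1.
Proof. intros Hd [H| ->]; [lra|rewrite Rabs_R1; lra]. Qed.

Lemma near_or_1_Re delta z x : delta * (1 + Cmod z) <= 1 -> Re z < 1 -> near_or_1 delta x -> Re (z * RtoC x) < 1.
Proof.
intros Hd Hz [H| ->]; rewrite Re_mult_RtoC; [|lra].
eapply Rle_lt_trans; [apply Rle_abs|]; rewrite Rabs_mult.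
pose proof (re_le_Cmod z); pose proof (Rabs_pos (Re z)); pose proof (Rabs_pos x); nra.
Qed.

(** The geometric expansion of [1 / (d - beta * x)] on the whole interval needs [Cmod beta < d],
    which can fail for the first factors. So the first [L] terms and the common factor of the rest
    are treated as rational functions, and only the tail, with parameters shifted by [L], is
    expanded. The condition on [K] gives the majorant of the tail a positive excess. *)
Lemma regular_hyp delta K alpha beta gamma1 gamma2 :
  delta <= 1 -> delta * (1 + Cmod alpha) <= 1 -> delta * (1 + Cmod beta) <= 1 ->
  Re alpha < 1 -> Re beta < 1 ->
  Cmod alpha + Cmod beta + Cmod gamma1 + Cmod gamma2 <= INR K ->
  regular delta (fun x => CSeries (hyp_term (1 + gamma1 * RtoC x) (1 + gamma2 * RtoC x)
    (2 - beta * RtoC x + RtoC (INR K)) (2 - alpha * RtoC x))).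
Proof.
intros Hd Hda Hdb Ha Hb HK.
pose proof (Cmod_ge_0 gamma1); pose proof (Cmod_ge_0 gamma2).
pose proof (Cmod_ge_0 alpha); pose proof (Cmod_ge_0 beta); pose proof (pos_INR K).
destruct (INR_ge_eventually (Cmod alpha + Cmod beta)) as [L HL]; specialize (HL L (le_n L)).
pose proof (pos_INR L).
set (h := fun x => hyp_term (1 + gamma1 * RtoC x) (1 + gamma2 * RtoC x)
    (2 - beta * RtoC x + RtoC (INR K)) (2 - alpha * RtoC x)).
set (tl := fun n x => hyp_term (RtoC (1 + INR L) + gamma1 * RtoC x) (RtoC (1 + INR L) + gamma2 * RtoC x)
    (RtoC (2 + INR K + INR L) - beta * RtoC x) (RtoC (2 + INR L) - alpha * RtoC x) n).
assert (Pd : forall x, near_or_1 delta x -> no_pole (2 - beta * RtoC x + RtoC (INR K))).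
{ intros x Hx; apply no_pole_plus, no_pole_Re; pose proof (near_or_1_Re _ _ _ Hdb Hb Hx).
  destruct (beta * RtoC x)%C; simpl in *; lra. }
assert (Pe : forall x, near_or_1 delta x -> no_pole (2 - alpha * RtoC x)).
{ intros x Hx; apply no_pole_Re; pose proof (near_or_1_Re _ _ _ Hda Ha Hx).
  destruct (alpha * RtoC x)%C; simpl in *; lra. }
destruct (wiener_series tl (fun n => Cmod (hyp_term (RtoC (1 + INR L + Cmod gamma1)) (RtoC (1 + INR L + Cmod gamma2))
     (RtoC (2 + INR K + INR L - Cmod beta)) (RtoC (2 + INR L - Cmod alpha)) n))) as [B HB].
{ intros n; apply wiener_hyp_term; lra. }
{ apply hyp_term_raabe; [apply no_pole_Re; simpl; lra|apply no_pole_Re; simpl; lra|simpl; lra]. }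
apply (regular_ext _ (fun x => Csum (fun n => h x n) (seq 0 L) + h x L * CSeries (fun n => tl n x))%C).
- intros x Hx; specialize (Pd x Hx); specialize (Pe x Hx).
  change (Csum (h x) (seq 0 L) + h x L * CSeries (fun n => tl n x) = CSeries (h x))%C.
  assert (Hx1 := near_or_1_le _ _ Hd Hx).
  assert (Eh : ex_series (fun n => Cmod (h x n))).
  { apply hyp_term_raabe; [exact Pd|exact Pe|].
    pose proof (Re_mult_le gamma1 x Hx1) as A1; pose proof (Re_mult_le gamma2 x Hx1) as A2.
    pose proof (Re_mult_le alpha x Hx1) as A3; pose proof (Re_mult_le beta x Hx1) as A4.
    apply Rabs_le_between in A1; apply Rabs_le_between in A2; apply Rabs_le_between in A3; apply Rabs_le_between in A4.
    rewrite <- Re_mult_RtoC in *.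
    destruct (gamma1 * RtoC x)%C, (gamma2 * RtoC x)%C, (alpha * RtoC x)%C, (beta * RtoC x)%C; simpl in *; lra. }
  rewrite (CSeries_split (h x) L Eh); f_equal.
  assert (Htl : ex_series (fun n => Cmod (tl n x))).
  { apply hyp_term_raabe; [apply no_pole_minus; [lra|exact Hx1]|apply no_pole_minus; [lra|exact Hx1]|].
    pose proof (Re_mult_le gamma1 x Hx1) as A1; pose proof (Re_mult_le gamma2 x Hx1) as A2.
    pose proof (Re_mult_le alpha x Hx1) as A3; pose proof (Re_mult_le beta x Hx1) as A4.
    apply Rabs_le_between in A1; apply Rabs_le_between in A2; apply Rabs_le_between in A3; apply Rabs_le_between in A4.
    rewrite <- Re_mult_RtoC in *.
    destruct (gamma1 * RtoC x)%C, (gamma2 * RtoC x)%C, (alpha * RtoC x)%C, (beta * RtoC x)%C; simpl in *; lra. }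
  symmetry; apply CSeries_unique.
  generalize (is_Cseries_scal (h x L) _ _ (Cseries_correct _ Htl)); apply is_Cseries_ext; intros n.
  unfold h; rewrite hyp_term_add by assumption; f_equal; unfold tl.
  rewrite !RtoC_plus; f_equal; ring.
- assert (Rh : forall n, regular delta (fun x => h x n)).
  { intros n; unfold h, hyp_term; apply regular_div.
    - intros x Hx; apply Cmult_neq_0; apply poch_neq_0; [now apply Pd|now apply Pe].
    - apply regular_mult; apply regular_poch, regular_affine.
    - regular_ring. }
  apply regular_plus; [apply (regular_Csum delta (fun n x => h x n)), Rh|].
  apply regular_mult; [apply Rh|exact (regular_wiener _ _ _ HB)].
Qed.

(** Left unsimplified to match [hyp_contiguous_iter] with [d = 2 - beta], [e = 2 - alpha] and excess
    [s = 1 - v]. *)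
Definition accelerated (K : nat) (v alpha beta gamma1 gamma2 : C) : C :=
  (1 / ((1 - alpha) * (1 - beta)) *
   ((2 - alpha - 1) * Csum (fun k => poch (2 - beta - (1 + gamma1)) k * poch (2 - beta - (1 + gamma2)) k
        / (poch (2 - beta) k * poch (1 - v) (S k))) (seq 0 K)
    + poch (2 - beta - (1 + gamma1)) K * poch (2 - beta - (1 + gamma2)) K / (poch (2 - beta) K * poch (1 - v) K)
      * CSeries (hyp_term (1 + gamma1) (1 + gamma2) (2 - beta + RtoC (INR K)) (2 - alpha))))%C.

Lemma Phi0_small_accelerated K t u v w rho alpha beta gamma1 gamma2 : small t u v w rho ->
  root_relations t u v w alpha beta gamma1 gamma2 -> Cmod alpha < 1 -> Cmod beta < 1 ->
  Phi0 t u v w = accelerated K v alpha beta gamma1 gamma2.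
Proof.
intros Hs Hroot Ha Hb.
rewrite (Phi0_small t u v w rho alpha beta gamma1 gamma2) by assumption.
unfold accelerated; f_equal.
assert (Hsum := root_relations_sum _ _ _ _ _ _ _ _ Hroot).
apply hyp_contiguous_iter.
- replace (2 - beta)%C with (1 - beta + 1)%C by ring; now apply no_pole_S, no_pole_1_minus.
- replace (2 - alpha)%C with (1 - alpha + 1)%C by ring; now apply no_pole_S, no_pole_1_minus.
- replace (2 - beta + (2 - alpha) - (1 + gamma1) - (1 + gamma2) - 1)%C with (1 - alpha - beta - (gamma1 + gamma2))%C by ring.
  rewrite Hsum; ring.
- pose proof (Rle_abs (Re v)); pose proof (re_le_Cmod v); pose proof (small_lt_1 _ _ _ _ _ Hs).
  destruct Hs as (_ & _ & Hv & _); destruct v; simpl in *; lra.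
Qed.

(** At weight [k + 2] the exponents [k + 2 - n - s], [n - s] and [2 * s - 2] add up to [k]. *)
Lemma phi_scale t u v w (x : C) k :
  phi t (u * x) (v * x) (w * x) (S (S k)) = (phi t u v w (S (S k)) * x ^ k)%C.
Proof.
rewrite <- !Phi0_coef, (Cmult_comm (Csum _ _) (x ^ k)), <- Csum_scal; apply Csum_ext; intros [n s] Hp.
unfold depth_heights in Hp; apply filter_In in Hp; destruct Hp as [H1 H2].
cbn [fst snd] in *; apply Bool.andb_true_iff in H2; destruct H2 as [H2 H3].
apply Nat.leb_le in H2; apply Nat.leb_le in H3.
apply in_prod_iff in H1; destruct H1 as [_ H1]; apply in_seq in H1.
unfold Phi0_term; rewrite !Cpow_mult_l.
assert (E : (x ^ k = x ^ (S (S k) - n - s) * x ^ (n - s) * x ^ (2 * s - 2))%C).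
{ rewrite <- !Cpow_add_r; f_equal; lia. }
rewrite E; ring.
Qed.

(** Absolute convergence at the point itself is exactly summability of the coefficients in [x];
    weights 0 and 1 contribute nothing, hence the shift by two. *)
Lemma Phi0_wiener t u v w : Phi0_abs_conv t u v w ->
  exists B, wiener (fun x => Phi0 t (u * RtoC x) (v * RtoC x) (w * RtoC x)) B.
Proof.
intros H.
assert (Ha : ex_series (fun k => Cmod (phi t u v w (S (S k))))).
{ apply (ex_series_incr_n (V := R_NormedModule) (fun k => Cmod (phi t u v w k)) 2).
  eapply ex_series_pos_le; [|exact H]; intros k; split; [apply Cmod_ge_0|].
  rewrite <- Phi0_coef; apply Csum_Cmod_le. }
exists (Series (fun k => Cmod (phi t u v w (S (S k))))), (fun k => phi t u v w (S (S k))).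
repeat split; [exact Ha|lra|].
intros x Hx; rewrite Phi0_phi.
assert (Hs := Cseries_correct _ (ex_series_Cmod_pow _ x Hx Ha)).
replace (CSeries (phi t (u * RtoC x) (v * RtoC x) (w * RtoC x))) with
  (CSeries (fun k => phi t u v w (S (S k)) * RtoC x ^ k)%C); [exact Hs|].
symmetry; apply CSeries_unique.
set (l := CSeries _) in *; replace l with (0 + (0 + l))%C by ring.
apply is_Cseries_cons; [rewrite <- Phi0_coef; reflexivity|].
apply is_Cseries_cons; [rewrite <- Phi0_coef; reflexivity|].
revert Hs; apply is_Cseries_ext; intros k; symmetry; apply phi_scale.
Qed.

Lemma root_relations_scale t u v w alpha beta gamma1 gamma2 x :
  root_relations t u v w alpha beta gamma1 gamma2 ->
  root_relations t (u * x) (v * x) (w * x) (alpha * x) (beta * x) (gamma1 * x) (gamma2 * x).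
Proof.
intros (H1 & H2 & H3 & H4); repeat split.
- replace (alpha * x + beta * x)%C with ((alpha + beta) * x)%C by ring; rewrite H1; ring.
- replace (alpha * x * (beta * x))%C with (alpha * beta * x ^ 2)%C by (simpl; ring); rewrite H2; simpl; ring.
- replace (gamma1 * x + gamma2 * x)%C with ((gamma1 + gamma2) * x)%C by ring; rewrite H3; ring.
- replace (gamma1 * x * (gamma2 * x))%C with (gamma1 * gamma2 * x ^ 2)%C by (simpl; ring); rewrite H4; simpl; ring.
Qed.

Lemma Phi0_accelerated K t u v w alpha beta gamma1 gamma2 :
  root_relations t u v w alpha beta gamma1 gamma2 -> Re alpha < 1 -> Re beta < 1 ->
  no_pole (1 - v) -> Phi0_abs_conv t u v w ->
  Cmod alpha + Cmod beta + Cmod gamma1 + Cmod gamma2 <= INR K ->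
  Phi0 t u v w = accelerated K v alpha beta gamma1 gamma2.
Proof.
intros Hroot Ha Hb Hv Hconv HK.
(* [rho] gives equality in the last condition of [small]. [S0] exceeds each of the moduli by at
   least 1, so for [Rabs x < delta] the scaled [u], [v], [w], [alpha], [beta] all have modulus below
   [rho <= 1]. *)
set (rho := / (2 * (Cmod t + 3))).
set (S0 := 1 + Cmod u + Cmod v + Cmod w + Cmod alpha + Cmod beta).
set (delta := rho / S0).
pose proof (Cmod_ge_0 t); pose proof (Cmod_ge_0 u); pose proof (Cmod_ge_0 v); pose proof (Cmod_ge_0 w).
pose proof (Cmod_ge_0 alpha); pose proof (Cmod_ge_0 beta).
assert (HS : 1 <= S0) by (unfold S0; lra).
assert (Hrho : 0 < rho) by (apply Rinv_0_lt_compat; lra).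
assert (Hrho2 : (Cmod t + 3) * rho = 1 / 2) by (unfold rho; field; lra).
assert (Hrho1 : rho <= 1) by nra.
assert (Hd : 0 < delta) by (apply Rdiv_lt_0_compat; lra).
assert (HdS : delta * S0 = rho) by (unfold delta; field; lra).
assert (Hd1 : delta <= 1) by nra.
assert (Hsc : forall z x, Cmod z <= S0 - 1 -> Rabs x < delta -> Cmod (z * RtoC x) < rho).
{ intros z x Hz Hx; rewrite Cmod_mult, Cmod_R; pose proof (Cmod_ge_0 z); pose proof (Rabs_pos x); nra. }
assert (Hda : delta * (1 + Cmod alpha) <= 1) by (unfold S0 in *; nra).
assert (Hdb : delta * (1 + Cmod beta) <= 1) by (unfold S0 in *; nra).
assert (Pv : forall x, near_or_1 delta x -> no_pole (1 - v * RtoC x)).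
{ intros x [Hx| ->]; [|now rewrite Cmult_1_r].
  apply no_pole_1_minus; pose proof (Hsc v x ltac:(unfold S0; lra) Hx); lra. }
assert (Pb : forall x, near_or_1 delta x -> no_pole (2 - beta * RtoC x)).
{ intros x Hx; apply no_pole_Re; pose proof (near_or_1_Re _ _ _ Hdb Hb Hx).
  destruct (beta * RtoC x)%C; simpl in *; lra. }
assert (N1 : forall z x, delta * (1 + Cmod z) <= 1 -> Re z < 1 -> near_or_1 delta x -> (1 - z * RtoC x <> 0)%C).
{ intros z x Hz Hz1 Hx; apply no_pole_0, no_pole_Re; pose proof (near_or_1_Re _ _ _ Hz Hz1 Hx).
  destruct (z * RtoC x)%C; simpl in *; lra. }
destruct (Phi0_wiener t u v w Hconv) as [B HB].
assert (Heq := regular_unique delta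
  (fun x => Phi0 t (u * RtoC x) (v * RtoC x) (w * RtoC x))
  (fun x => accelerated K (v * RtoC x) (alpha * RtoC x) (beta * RtoC x) (gamma1 * RtoC x) (gamma2 * RtoC x)) Hd Hd1).
cbv beta in Heq; rewrite !Cmult_1_r in Heq; apply Heq; clear Heq.
- exact (regular_wiener _ _ _ HB).
- assert (RP : forall k, regular delta (fun x => poch (2 - beta * RtoC x - (1 + gamma1 * RtoC x)) k *
      poch (2 - beta * RtoC x - (1 + gamma2 * RtoC x)) k)%C).
  { intros k; regular_ring. }
  assert (RQ : forall i k, regular delta (fun x => poch (2 - beta * RtoC x) i * poch (1 - v * RtoC x) k)%C).
  { intros i k; regular_ring. }
  assert (NQ : forall i k x, near_or_1 delta x -> (poch (2 - beta * RtoC x) i * poch (1 - v * RtoC x) k <> 0)%C).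
  { intros i k x Hx; apply Cmult_neq_0; apply poch_neq_0; auto. }
  unfold accelerated; apply regular_mult.
  + apply regular_div; [intros x Hx; apply Cmult_neq_0; now apply N1|apply regular_const|].
    regular_ring.
  + apply regular_plus; apply regular_mult.
    * regular_ring.
    * apply (regular_Csum delta (fun k x => poch (2 - beta * RtoC x - (1 + gamma1 * RtoC x)) k *
        poch (2 - beta * RtoC x - (1 + gamma2 * RtoC x)) k / (poch (2 - beta * RtoC x) k * poch (1 - v * RtoC x) (S k)))%C).
      intros k; apply regular_div; [apply NQ|apply RP|apply RQ].
    * apply regular_div; [apply NQ|apply RP|apply RQ].
    * apply regular_hyp; assumption.
- intros x Hx; apply (Phi0_small_accelerated K t _ _ _ rho).
  + repeat split; [exact Hrho|apply Rlt_le, Hsc|apply Rlt_le, Hsc|apply Rlt_le, Hsc|lra]; try exact Hx; unfold S0; lra.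
  + now apply root_relations_scale.
  + eapply Rlt_le_trans; [apply Hsc; [unfold S0; lra|exact Hx]|exact Hrho1].
  + eapply Rlt_le_trans; [apply Hsc; [unfold S0; lra|exact Hx]|exact Hrho1].
Qed.

(** * The limit of infinitely many contiguous steps *)

Lemma Cmod_plus_INR_mono (d : C) m n : 0 <= Re d -> (m <= n)%nat ->
  Cmod (d + RtoC (INR m)) <= Cmod (d + RtoC (INR n)).
Proof.
intros Hd Hmn; unfold Cmod; apply sqrt_le_1_alt.
apply le_INR in Hmn; pose proof (pos_INR m); destruct d as [x y]; simpl in *; nra.
Qed.

Lemma poch_mono (d : C) m n k : 0 <= Re d -> (m <= n)%nat ->
  Cmod (poch (d + RtoC (INR m)) k) <= Cmod (poch (d + RtoC (INR n)) k).
Proof.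
intros Hd Hmn; induction k as [|k IH]; [simpl; lra|].
simpl; rewrite !Cmod_mult; apply Rmult_le_compat; try apply Cmod_ge_0; [exact IH|].
rewrite <- !Cplus_assoc, <- !RtoC_plus, <- !plus_INR.
apply Cmod_plus_INR_mono; [exact Hd|lia].
Qed.

(** Shifting [d] to the right enlarges the modulus of every factor of its Pochhammer symbol. One
    convergent remainder series therefore dominates all later ones. *)
Lemma hyp_term_le_shift b c d e m n k : 0 < Re d -> no_pole e -> (m <= n)%nat ->
  Cmod (hyp_term b c (d + RtoC (INR n)) e k) <= Cmod (hyp_term b c (d + RtoC (INR m)) e k).
Proof.
intros Hd He Hmn; unfold hyp_term.
assert (Pd := no_pole_Re d Hd).
assert (Qm := poch_neq_0 _ k (no_pole_plus d m Pd)); assert (Qn := poch_neq_0 _ k (no_pole_plus d n Pd)).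
assert (Qe := poch_neq_0 _ k He).
rewrite !Cmod_div, !Cmod_mult by now apply Cmult_neq_0.
apply Rmult_le_compat_l; [apply Rmult_le_pos; apply Cmod_ge_0|].
apply Rinv_le_contravar.
- apply Rmult_lt_0_compat; now apply Cmod_gt_0.
- apply Rmult_le_compat_r; [apply Cmod_ge_0|apply poch_mono; [lra|exact Hmn]].
Qed.

Lemma F32_term_hyp p q d e n : no_pole d -> no_pole e ->
  F32_term p q 1 d e 1 n = hyp_term p q d e n.
Proof.
intros Hd He; unfold F32_term, hyp_term; rewrite poch_1, Cpow_1_l.
assert (Hf : RtoC (INR (fact n)) <> 0%C) by (intros E; apply RtoC_inj in E; now apply INR_fact_neq_0 in E).
pose proof (poch_neq_0 _ n Hd); pose proof (poch_neq_0 _ n He); field; tauto.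
Qed.

(** The excess of these parameters is [1 - alpha], so [Re alpha < 1] is precisely what Raabe's test
    asks. *)
Lemma F32_sum_conv t u v w alpha beta gamma1 gamma2 :
  root_relations t u v w alpha beta gamma1 gamma2 -> Re alpha < 1 -> Re beta < 1 -> no_pole (1 - v) ->
  ex_series (fun n => Cmod (hyp_term (1 - gamma1 - beta) (1 - gamma2 - beta) (2 - v) (2 - beta) n)) /\
  is_lim_seq (fun n => INR n * Cmod (hyp_term (1 - gamma1 - beta) (1 - gamma2 - beta) (2 - v) (2 - beta) n)) 0.
Proof.
intros Hroot Ha Hb Hv; apply hyp_term_raabe.
- replace (2 - v)%C with (1 - v + 1)%C by ring; now apply no_pole_S.
- apply no_pole_Re; destruct beta; simpl in *; lra.
- assert (Hsum := root_relations_sum _ _ _ _ _ _ _ _ Hroot); apply (f_equal Re) in Hsum.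
  destruct gamma1, gamma2, v, alpha, beta; simpl in *; lra.
Qed.

(** After [K] steps the remainder is a constant times [(1 - v + K) * h K * T K], where [h] is the
    summand of the required series. It vanishes in the limit because [K * h K] tends to 0 and [T K]
    stays bounded. *)
Lemma Phi0_F32 t u v w alpha beta gamma1 gamma2 :
  root_relations t u v w alpha beta gamma1 gamma2 -> Re alpha < 1 -> Re beta < 1 ->
  no_pole (1 - v) -> Phi0_abs_conv t u v w ->
  Phi0 t u v w = (1 / ((1 - v) * (1 - beta)) *
    CSeries (hyp_term (1 - gamma1 - beta) (1 - gamma2 - beta) (2 - v) (2 - beta)))%C.
Proof.
intros Hroot Ha Hb Hv Hconv.
destruct (F32_sum_conv _ _ _ _ _ _ _ _ Hroot Ha Hb Hv) as [E1 E2].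
set (h := hyp_term _ _ _ _) in *.
assert (L1 := proj1 (is_Cseries_Csum _ _) (Cseries_correct _ E1)).
assert (L2 := is_lim_seq_affine_0 h (1 - v) E1 E2).
assert (Hv0 := no_pole_0 _ Hv).
assert (Ha0 : (1 - alpha <> 0)%C) by (apply no_pole_0, no_pole_Re; destruct alpha; simpl in *; lra).
assert (Hb0 : (1 - beta <> 0)%C) by (apply no_pole_0, no_pole_Re; destruct beta; simpl in *; lra).
assert (Pb : no_pole (2 - beta)) by (apply no_pole_Re; destruct beta; simpl in *; lra).
assert (Pa : no_pole (2 - alpha)) by (apply no_pole_Re; destruct alpha; simpl in *; lra).
destruct (INR_ge_eventually (Cmod alpha + Cmod beta + Cmod gamma1 + Cmod gamma2)) as [K0 HK0].
set (T := fun K => CSeries (hyp_term (1 + gamma1) (1 + gamma2) (2 - beta + RtoC (INR K)) (2 - alpha))).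
set (M := 2 * Series (fun n => Cmod (hyp_term (1 + gamma1) (1 + gamma2) (2 - beta + RtoC (INR K0)) (2 - alpha) n))).
assert (HT : forall K, (K0 <= K)%nat -> Cmod (T K) <= M).
{ intros K HK; apply Cmod_CSeries_le.
  - intros n; apply hyp_term_le_shift; [destruct beta; simpl in *; lra|exact Pa|exact HK].
  - apply hyp_term_raabe; [now apply no_pole_plus|exact Pa|].
    specialize (HK0 K0 (le_n K0)).
    pose proof (re_le_Cmod gamma1) as A1; pose proof (re_le_Cmod gamma2) as A2.
    pose proof (re_le_Cmod alpha) as A3; pose proof (re_le_Cmod beta) as A4.
    apply Rabs_le_between in A1; apply Rabs_le_between in A2; apply Rabs_le_between in A3; apply Rabs_le_between in A4.
    destruct gamma1, gamma2, alpha, beta; simpl in *; lra. }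
assert (Hacc : forall K, (K0 <= K)%nat -> Phi0 t u v w =
  (1 / ((1 - v) * (1 - beta)) * Csum h (seq 0 K) + 1 / ((1 - alpha) * (1 - beta) * (1 - v)) * ((1 - v + RtoC (INR K)) * h K * T K))%C).
{ intros K HK; rewrite (Phi0_accelerated K t u v w alpha beta gamma1 gamma2) by (try assumption; now apply HK0).
  unfold accelerated; fold (T K).
  replace (2 - beta - (1 + gamma1))%C with (1 - gamma1 - beta)%C by ring.
  replace (2 - beta - (1 + gamma2))%C with (1 - gamma2 - beta)%C by ring.
  rewrite (Csum_ext _ (fun k => 1 / (1 - v) * h k)%C).
  2:{ intros k _; unfold h, hyp_term; rewrite poch_Sl.
      replace (1 - v + 1)%C with (2 - v)%C by ring.
      assert (Pv2 : no_pole (2 - v)) by (replace (2 - v)%C with (1 - v + 1)%C by ring; now apply no_pole_S).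
      pose proof (poch_neq_0 _ k Pb); pose proof (poch_neq_0 _ k Pv2); field; tauto. }
  rewrite Csum_scal.
  (* The remainder carries [(1 - v)_K] where [h K] has [(2 - v)_K]; their quotient produces the
     factor [1 - v + K]. *)
  assert (EK : (poch (1 - gamma1 - beta) K * poch (1 - gamma2 - beta) K / (poch (2 - beta) K * poch (1 - v) K) =
     (1 - v + RtoC (INR K)) * h K / (1 - v))%C).
  { unfold h, hyp_term.
    assert (Q := poch_shift (1 - v) K); replace (1 - v + 1)%C with (2 - v)%C in Q by ring.
    assert (Pv2 : no_pole (2 - v)) by (replace (2 - v)%C with (1 - v + 1)%C by ring; now apply no_pole_S).
    pose proof (poch_neq_0 _ K Pb); pose proof (poch_neq_0 _ K Pv2); pose proof (poch_neq_0 _ K Hv).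
    assert (Q' : poch (1 - v) K = (poch (2 - v) K * (1 - v) / (1 - v + RtoC (INR K)))%C) by (rewrite Q; field; apply Hv).
    rewrite Q'; specialize (Hv K); field; tauto. }
  rewrite EK; field; tauto. }
assert (L3 : filterlim (fun K => (1 - v + RtoC (INR K)) * h K * T K)%C eventually (locally (RtoC 0))).
{ apply filterlim_C_0; [apply eventually_filter|].
  change (is_lim_seq (fun K => Cmod ((1 - v + RtoC (INR K)) * h K * T K)) 0).
  apply (is_lim_seq_le_le_loc (fun _ => 0) _ (fun K => M * Cmod ((1 - v + RtoC (INR K)) * h K))).
  - exists K0; intros K HK; split; [apply Cmod_ge_0|]; rewrite Cmod_mult, Rmult_comm.
    apply Rmult_le_compat_r; [apply Cmod_ge_0|now apply HT].
  - apply is_lim_seq_const.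
  - replace (Finite 0) with (Finite (M * 0)) by (f_equal; ring).
    apply (is_lim_seq_scal_l _ M 0).
    rewrite <- Cmod_0; apply (filterlim_comp _ _ _ _ Cmod _ (locally (RtoC 0))); [exact L2|].
    apply (filterlim_norm (V := C_NormedModule)). }
assert (L4 := filterlim_Cplus _ _ _ _ _
  (filterlim_Cmult _ _ _ _ _ (filterlim_const (1 / ((1 - v) * (1 - beta)))%C) L1)
  (filterlim_Cmult _ _ _ _ _ (filterlim_const (1 / ((1 - alpha) * (1 - beta) * (1 - v)))%C) L3)).
rewrite Cmult_0_r, Cplus_0_r in L4.
apply (filterlim_locally_unique (F := eventually) (fun _ => Phi0 t u v w)); [apply filterlim_const|].
eapply filterlim_ext_loc; [|exact L4].
exists K0; intros K HK; symmetry; now apply Hacc.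
Qed.

(** * Complex powers and incomplete Beta integrals *)

Lemma Rcpow_eq x s : Rcpow x s = (exp (Re s * ln x) * cos (Im s * ln x), exp (Re s * ln x) * sin (Im s * ln x)).
Proof.
unfold Rcpow, Cexp; destruct s as [p q]; simpl.
now replace (p * ln x - q * 0) with (p * ln x) by ring; replace (p * 0 + q * ln x) with (q * ln x) by ring.
Qed.

Lemma Cmod_Rcpow x s : Cmod (Rcpow x s) = exp (Re s * ln x).
Proof.
rewrite Rcpow_eq; unfold Cmod; cbn [fst snd]; set (e := exp _).
replace ((e * cos (Im s * ln x)) ^ 2 + (e * sin (Im s * ln x)) ^ 2) with (e ^ 2).
- apply sqrt_pow2, Rlt_le, exp_pos.
- rewrite !Rpow_mult_distr, <- Rmult_plus_distr_l.
  replace (cos (Im s * ln x) ^ 2 + sin (Im s * ln x) ^ 2) with 1; [ring|].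
  rewrite <- (sin2_cos2 (Im s * ln x)); unfold Rsqr; ring.
Qed.

Lemma Rcpow_real x (s : R) : Rcpow x (RtoC s) = RtoC (exp (s * ln x)).
Proof. rewrite Rcpow_eq; simpl; rewrite Rmult_0_l, cos_0, sin_0; unfold RtoC; f_equal; ring. Qed.

Lemma Rcpow_plus_1 x s : 0 < x -> Rcpow x (s + 1) = (RtoC x * Rcpow x s)%C.
Proof.
intros Hx; rewrite !Rcpow_eq.
replace (Re (s + 1)) with (Re s + 1) by (destruct s; simpl; ring).
replace (Im (s + 1)) with (Im s) by (destruct s; simpl; ring).
rewrite Rmult_plus_distr_r, Rmult_1_l, exp_plus, exp_ln by exact Hx.
unfold RtoC, Cmult; simpl; f_equal; ring.
Qed.

Lemma Rcpow_1_l s : Rcpow 1 s = RtoC 1.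
Proof. rewrite Rcpow_eq, ln_1, !Rmult_0_r, exp_0, cos_0, sin_0; unfold RtoC; f_equal; ring. Qed.

Definition is_Cderive (f : R -> C) (x : R) (l : C) : Prop :=
  is_derive (fun z => Re (f z)) x (Re l) /\ is_derive (fun z => Im (f z)) x (Im l).

Lemma is_Cderive_eq f x l m : is_Cderive f x l -> l = m -> is_Cderive f x m.
Proof. now intros H <-. Qed.

Lemma is_Cderive_ext f g x l : (forall z, f z = g z) -> is_Cderive f x l -> is_Cderive g x l.
Proof.
intros H [H1 H2]; split; (eapply is_derive_ext; [|eassumption]); intros z; simpl; now rewrite H.
Qed.

Lemma is_Cderive_const c x : is_Cderive (fun _ => c) x 0.
Proof. split; exact (is_derive_const (V := R_NormedModule) _ x). Qed.

Lemma is_Cderive_plus f g x l m : is_Cderive f x l -> is_Cderive g x m ->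
  is_Cderive (fun z => f z + g z)%C x (l + m)%C.
Proof.
intros [f1 f2] [g1 g2]; split; apply (is_derive_plus (V := R_NormedModule)); assumption.
Qed.

Lemma is_Rderive_mult (f g : R -> R) x l m : is_derive f x l -> is_derive g x m ->
  is_derive (fun z => f z * g z) x (l * g x + f x * m).
Proof. intros Hf Hg; apply (is_derive_mult f g x l m Hf Hg); intros; apply Rmult_comm. Qed.

Lemma is_Cderive_mult f g x l m : is_Cderive f x l -> is_Cderive g x m ->
  is_Cderive (fun z => f z * g z)%C x (l * g x + f x * m)%C.
Proof.
intros [f1 f2] [g1 g2]; split.
- replace (Re (l * g x + f x * m)) with
   (minus (Re l * Re (g x) + Re (f x) * Re m) (Im l * Im (g x) + Im (f x) * Im m)).
  + exact (is_derive_minus _ _ _ _ _ (is_Rderive_mult _ _ _ _ _ f1 g1) (is_Rderive_mult _ _ _ _ _ f2 g2)).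
  + destruct l, (g x), (f x), m; unfold minus, plus, opp; simpl; ring.
- replace (Im (l * g x + f x * m)) with
   (plus (Re l * Im (g x) + Re (f x) * Im m) (Im l * Re (g x) + Im (f x) * Re m)).
  + exact (is_derive_plus _ _ _ _ _ (is_Rderive_mult _ _ _ _ _ f1 g2) (is_Rderive_mult _ _ _ _ _ f2 g1)).
  + destruct l, (g x), (f x), m; unfold plus; simpl; ring.
Qed.

Lemma is_Cderive_pow n x : is_Cderive (fun z => RtoC z ^ S n)%C x (RtoC (INR (S n)) * RtoC x ^ n)%C.
Proof.
assert (H1 : is_Cderive RtoC x 1).
{ split; [exact (is_derive_id (K := R_AbsRing) x)|exact (is_derive_const (V := R_NormedModule) 0 x)]. }
induction n as [|n IH].
- apply (is_Cderive_eq _ _ _ _ (is_Cderive_mult _ _ _ _ _ H1 (is_Cderive_const 1%C x))); simpl; ring.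
- apply (is_Cderive_eq _ _ _ _ (is_Cderive_mult _ _ _ _ _ H1 IH)).
  rewrite (S_INR (S n)), RtoC_plus; simpl; ring.
Qed.

Lemma is_Cderive_Rcpow s z : z < 1 ->
  is_Cderive (fun z => Rcpow (1 - z) (s + 1)) z (- (s + 1) * Rcpow (1 - z) s)%C.
Proof.
intros Hz.
(* With a single exponent [s + 1] on both sides, the derivative can be computed on real and
   imaginary parts. *)
assert (E : (- (s + 1) * Rcpow (1 - z) s)%C = (- (s + 1) * RtoC (/ (1 - z)) * Rcpow (1 - z) (s + 1))%C).
{ rewrite Rcpow_plus_1 by lra; rewrite RtoC_inv by lra; field.
  intros F; apply RtoC_inj in F; lra. }
rewrite E; clear E; set (s1 := (s + 1)%C); clearbody s1; split.
- apply (is_derive_ext (fun z => exp (Re s1 * ln (1 - z)) * cos (Im s1 * ln (1 - z)))).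
  { intros; now rewrite Rcpow_eq. }
  auto_derive; [lra|].
  rewrite Rcpow_eq; destruct s1 as [p q]; simpl; unfold Rminus; field; lra.
- apply (is_derive_ext (fun z => exp (Re s1 * ln (1 - z)) * sin (Im s1 * ln (1 - z)))).
  { intros; now rewrite Rcpow_eq. }
  auto_derive; [lra|].
  rewrite Rcpow_eq; destruct s1 as [p q]; simpl; unfold Rminus; field; lra.
Qed.

Definition beta_integrand (beta : C) (n : nat) (z : R) : C := (Rcpow (1 - z) (- beta) * RtoC z ^ n)%C.

(* [inc_beta beta n y] is the integral of [beta_integrand beta n] over [0, y]. *)
Fixpoint inc_beta (beta : C) (n : nat) (y : R) : C :=
  match n with
  | O => ((1 - Rcpow (1 - y) (1 - beta)) / (1 - beta))%C
  | S n' => ((RtoC (INR (S n')) * inc_beta beta n' y - RtoC y ^ S n' * Rcpow (1 - y) (1 - beta))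
             / (1 - beta + RtoC (INR (S n'))))%C
  end.

(** The recursion for [inc_beta] is integration by parts. In its derivative, [(1 - z)^(1 - beta) =
    (1 - z) * (1 - z)^(- beta)] collapses the terms to [1 - beta + N] times the next integrand. *)
Lemma inc_beta_derive beta n z : Re beta < 1 -> z < 1 ->
  is_Cderive (inc_beta beta n) z (beta_integrand beta n z).
Proof.
intros Hb Hz.
assert (Pb : no_pole (1 - beta)) by (apply no_pole_Re; destruct beta; simpl in *; lra).
assert (HR := is_Cderive_Rcpow (- beta) z Hz).
replace (- beta + 1)%C with (1 - beta)%C in HR by ring.
induction n as [|n IH].
- apply (is_Cderive_ext (fun z => (1 + (- (1)) * Rcpow (1 - z) (1 - beta)) * / (1 - beta))%C); [intros; simpl; field; now apply no_pole_0|].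
  apply (is_Cderive_eq _ _ _ _ (is_Cderive_mult _ _ _ _ _
    (is_Cderive_plus _ _ _ _ _ (is_Cderive_const 1%C z) (is_Cderive_mult _ _ _ _ _ (is_Cderive_const (- (1))%C z) HR))
     (is_Cderive_const (/ (1 - beta))%C z))).
  unfold beta_integrand; simpl; field; now apply no_pole_0.
- set (N := RtoC (INR (S n))) in *.
  assert (HN : (1 - beta + N <> 0)%C) by apply Pb.
  apply (is_Cderive_ext (fun z => (N * inc_beta beta n z + (- (1)) * (RtoC z ^ S n * Rcpow (1 - z) (1 - beta))) * / (1 - beta + N))%C).
  { intros x; change (inc_beta beta (S n) x) with ((N * inc_beta beta n x - RtoC x ^ S n * Rcpow (1 - x) (1 - beta)) / (1 - beta + N))%C.
    unfold Cdiv, Cminus; ring. }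
  apply (is_Cderive_eq _ _ _ _ (is_Cderive_mult _ _ _ _ _
    (is_Cderive_plus _ _ _ _ _ (is_Cderive_mult _ _ _ _ _ (is_Cderive_const N z) IH)
      (is_Cderive_mult _ _ _ _ _ (is_Cderive_const (- (1))%C z)
        (is_Cderive_mult _ _ _ _ _ (is_Cderive_pow n z) HR)))
     (is_Cderive_const (/ (1 - beta + N))%C z))).
  fold N; unfold beta_integrand.
  replace (1 - beta)%C with (- beta + 1)%C at 2 by ring; rewrite Rcpow_plus_1 by lra.
  rewrite RtoC_minus; simpl Cpow; field; exact HN.
Qed.

Lemma inc_beta_0 beta n : Re beta < 1 -> inc_beta beta n 0 = RtoC 0.
Proof.
intros Hb; assert (Pb : no_pole (1 - beta)) by (apply no_pole_Re; destruct beta; simpl in *; lra).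
induction n as [|n IH].
- simpl; rewrite Rminus_0_r, Rcpow_1_l; field; now apply no_pole_0.
- set (N := RtoC (INR (S n))) in *.
  change (inc_beta beta (S n) 0) with ((N * inc_beta beta n 0 - 0 ^ S n * Rcpow (1 - 0) (1 - beta)) / (1 - beta + N))%C.
  rewrite IH; simpl Cpow; field; apply Pb.
Qed.

Lemma beta_integrand_continuous beta n z : z < 1 ->
  filterlim (beta_integrand beta n) (locally z) (locally (beta_integrand beta n z)).
Proof.
intros Hz; unfold beta_integrand; apply filterlim_Cmult; [apply locally_filter| |].
- assert (HR := is_Cderive_Rcpow (- beta - 1) z Hz).
  replace (- beta - 1 + 1)%C with (- beta)%C in HR by ring; destruct HR as [R1 R2].
  apply filterlim_C; [apply locally_filter|]; split.
  + exact (ex_derive_continuous (V := R_NormedModule) (fun z => Re (Rcpow (1 - z) (- beta))) z (ex_intro _ _ R1)).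
  + exact (ex_derive_continuous (V := R_NormedModule) (fun z => Im (Rcpow (1 - z) (- beta))) z (ex_intro _ _ R2)).
- induction n as [|n IH]; [exact (filterlim_const (RtoC 1))|].
  simpl; apply filterlim_Cmult; [apply locally_filter| |exact IH].
  apply filterlim_RtoC; [apply locally_filter|intros P HP; exact HP].
Qed.

Lemma is_RInt_Cderive (f df : R -> C) a b : a <= b ->
  (forall z, a <= z <= b -> is_Cderive f z (df z)) ->
  (forall z, a <= z <= b -> filterlim df (locally z) (locally (df z))) ->
  is_RInt (V := C_R_CompleteNormedModule) df a b (f b - f a)%C.
Proof.
intros Hab Hd Hc.
assert (Hr : forall z, Rmin a b <= z <= Rmax a b -> a <= z <= b) by (intros z; rewrite Rmin_left, Rmax_right; lra).
assert (Hc' : forall z, a <= z <= b -> _) by (intros z Hz; exact (proj1 (filterlim_C _ _ _) (Hc z Hz))).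
replace (f b - f a)%C with (minus (Re (f b)) (Re (f a)), minus (Im (f b)) (Im (f a))) by reflexivity.
apply (is_RInt_fct_extend_pair (U := R_NormedModule) (V := R_NormedModule)).
- apply (is_RInt_derive (V := R_CompleteNormedModule) (fun z => Re (f z)) (fun z => Re (df z))).
  + intros z Hz; apply Hd, Hr, Hz.
  + intros z Hz; apply Hc', Hr, Hz.
- apply (is_RInt_derive (V := R_CompleteNormedModule) (fun z => Im (f z)) (fun z => Im (df z))).
  + intros z Hz; apply Hd, Hr, Hz.
  + intros z Hz; apply Hc', Hr, Hz.
Qed.

(** For [b < 1] this is the complete integral of [(1 - z)^(-b) * z^n] over [0, 1], that is
    [n! / (1 - b)_(n+1)], in the recursive form of [inc_beta]. *)
Fixpoint real_beta (b : R) (n : nat) : R :=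
  match n with O => / (1 - b) | S n' => INR (S n') * real_beta b n' / (1 - b + INR (S n')) end.

Lemma real_beta_pos b n : b < 1 -> 0 < real_beta b n.
Proof.
intros Hb; induction n as [|n IH]; [apply Rinv_0_lt_compat; lra|].
change (real_beta b (S n)) with (INR (S n) * real_beta b n / (1 - b + INR (S n))).
pose proof (lt_0_INR (S n) ltac:(lia)); apply Rdiv_lt_0_compat; [now apply Rmult_lt_0_compat|lra].
Qed.

(** For a real exponent the boundary terms are nonnegative and are dropped. *)
Lemma inc_beta_real_le b n y : b < 1 -> 0 <= y < 1 ->
  exists r, inc_beta (RtoC b) n y = RtoC r /\ r <= real_beta b n.
Proof.
intros Hb Hy; set (e := exp ((1 - b) * ln (1 - y))).
assert (He : Rcpow (1 - y) (1 - RtoC b) = RtoC e) by (rewrite <- RtoC_minus, Rcpow_real; reflexivity).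
pose proof (exp_pos ((1 - b) * ln (1 - y))) as Hpos; fold e in Hpos.
induction n as [|n (r & Hr & IH)].
- exists ((1 - e) / (1 - b)); split.
  + simpl; rewrite He, RtoC_div, !RtoC_minus by lra; reflexivity.
  + simpl; unfold Rdiv; rewrite <- (Rmult_1_l (/ (1 - b))) at 2.
    apply Rmult_le_compat_r; [apply Rlt_le, Rinv_0_lt_compat; lra|lra].
- pose proof (lt_0_INR (S n) ltac:(lia)) as HN; set (N := INR (S n)) in *.
  exists ((N * r - y ^ S n * e) / (1 - b + N)); split.
  + change (inc_beta (RtoC b) (S n) y) with ((RtoC N * inc_beta (RtoC b) n y - RtoC y ^ S n * Rcpow (1 - y) (1 - RtoC b)) / (1 - RtoC b + RtoC N))%C.
    rewrite Hr, He, RtoC_div, !RtoC_minus, RtoC_plus, !RtoC_mult, RtoC_minus, RtoC_pow by lra; reflexivity.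
  + change (real_beta b (S n)) with (N * real_beta b n / (1 - b + N)).
    unfold Rdiv; apply Rmult_le_compat_r; [apply Rlt_le, Rinv_0_lt_compat; lra|].
    pose proof (pow_le y (S n) ltac:(lra)).
    assert (0 <= y ^ S n * e) by (apply Rmult_le_pos; lra).
    assert (N * r <= N * real_beta b n) by (apply Rmult_le_compat_l; lra); lra.
Qed.

(** The modulus of the integrand is the integrand with exponent [Re beta], so the integrals are
    compared rather than the recursions. The bound does not depend on [y], as the limit at 1
    requires. *)
Lemma Cmod_inc_beta_le beta n y : Re beta < 1 -> 0 <= y < 1 ->
  Cmod (inc_beta beta n y) <= 2 * real_beta (Re beta) n.
Proof.
intros Hb Hy.
assert (HI : forall b : C, Re b < 1 -> is_RInt (V := C_R_CompleteNormedModule) (beta_integrand b n) 0 y (inc_beta b n y)).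
{ intros b Hb'; replace (inc_beta b n y) with (inc_beta b n y - inc_beta b n 0)%C by (rewrite inc_beta_0 by exact Hb'; ring).
  apply is_RInt_Cderive; [lra| |].
  - intros z Hz; apply inc_beta_derive; [exact Hb'|lra].
  - intros z Hz; apply beta_integrand_continuous; lra. }
destruct (inc_beta_real_le (Re beta) n y Hb Hy) as (r & Hr & Hrle).
assert (I1 := HI beta Hb).
assert (I2 := HI (RtoC (Re beta)) ltac:(simpl; lra)); rewrite Hr in I2.
assert (I2' : is_RInt (V := R_NormedModule) (fun z => Re (beta_integrand (RtoC (Re beta)) n z)) 0 y r).
{ exact (is_RInt_fct_extend_fst (U := R_NormedModule) (V := R_NormedModule) _ _ _ _ I2). }
assert (Hn : forall z, 0 <= z <= y -> Cmod (beta_integrand beta n z) = Re (beta_integrand (RtoC (Re beta)) n z)).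
{ intros z Hz; unfold beta_integrand; rewrite Cmod_mult, Cmod_Rcpow, Cmod_pow, Cmod_R, Rabs_pos_eq by lra.
  rewrite <- RtoC_opp, Rcpow_real, <- RtoC_pow; destruct beta; simpl; ring. }
assert (K1 : Rabs (Re (inc_beta beta n y)) <= r).
{ apply (norm_RInt_le (V := R_NormedModule) (fun z => Re (beta_integrand beta n z)) (fun z => Re (beta_integrand (RtoC (Re beta)) n z)) 0 y); [lra| | |exact I2'].
  - intros z Hz; rewrite <- Hn by exact Hz; apply re_le_Cmod.
  - exact (is_RInt_fct_extend_fst (U := R_NormedModule) (V := R_NormedModule) _ _ _ _ I1). }
assert (K2 : Rabs (Im (inc_beta beta n y)) <= r).
{ apply (norm_RInt_le (V := R_NormedModule) (fun z => Im (beta_integrand beta n z)) (fun z => Re (beta_integrand (RtoC (Re beta)) n z)) 0 y); [lra| | |exact I2'].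
  - intros z Hz; rewrite <- Hn by exact Hz; apply im_le_Cmod.
  - exact (is_RInt_fct_extend_snd (U := R_NormedModule) (V := R_NormedModule) _ _ _ _ I1). }
replace (inc_beta beta n y) with (RtoC (Re (inc_beta beta n y)) + Ci * RtoC (Im (inc_beta beta n y)))%C.
2:{ destruct (inc_beta beta n y); unfold Ci, RtoC, Cplus, Cmult; simpl; f_equal; ring. }
eapply Rle_trans; [apply Cmod_triangle|]; rewrite Cmod_mult, !Cmod_R.
replace (Cmod Ci) with 1 by (unfold Cmod, Ci; simpl; rewrite <- sqrt_1 at 1; f_equal; ring); lra.
Qed.

Lemma Rcpow_at_left_1 s : 0 < Re s ->
  filterlim (fun y => Rcpow (1 - y) s) (at_left 1) (locally (RtoC 0)).
Proof.
intros Hs; apply filterlim_C_0; [apply within_filter, locally_filter|].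
apply filterlim_locally; intros eps.
(* The radius is [eps] to the power [1 / Re s], since the modulus is [(1 - y)^(Re s)]. *)
exists (mkposreal _ (exp_pos (ln eps / Re s))); intros y Hy Hy1.
assert (Hy' : Rabs (y - 1) < exp (ln eps / Re s)) by exact Hy.
rewrite Rabs_left in Hy' by lra.
change (Rabs (Cmod (Rcpow (1 - y) s) - 0) < eps); rewrite Rminus_0_r, Rabs_pos_eq by apply Cmod_ge_0.
rewrite Cmod_Rcpow, <- (exp_ln eps) by apply eps; apply exp_increasing.
assert (ln (1 - y) < ln eps / Re s).
{ rewrite <- (ln_exp (ln eps / Re s)); apply ln_increasing; lra. }
replace (ln eps) with (Re s * (ln eps / Re s)) by (field; lra).
now apply Rmult_lt_compat_l.
Qed.

(** The boundary terms vanish at 1 because [Re (1 - beta) > 0]; what remains is the recursion of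
    [n! / (1 - beta)_(n+1)]. *)
Lemma inc_beta_limit beta n : Re beta < 1 ->
  filterlim (inc_beta beta n) (at_left 1) (locally (RtoC (INR (fact n)) / poch (1 - beta) (S n))%C).
Proof.
intros Hb.
assert (Pb : no_pole (1 - beta)) by (apply no_pole_Re; destruct beta; simpl in *; lra).
assert (FF : Filter (at_left 1)) by (apply within_filter, locally_filter).
assert (HR := Rcpow_at_left_1 (1 - beta) ltac:(destruct beta; simpl in *; lra)).
induction n as [|n IH].
- replace (RtoC (INR (fact 0)) / poch (1 - beta) 1)%C with ((1 + (- (1)) * 0) * / (1 - beta))%C by (simpl; field; now apply no_pole_0).
  apply (filterlim_ext (fun y => (1 + (- (1)) * Rcpow (1 - y) (1 - beta)) * / (1 - beta))%C); [intros; simpl; field; now apply no_pole_0|].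
  apply filterlim_Cmult; [exact FF| |apply filterlim_const].
  apply filterlim_Cplus; [exact FF|apply filterlim_const|].
  apply filterlim_Cmult; [exact FF|apply filterlim_const|exact HR].
- set (N := RtoC (INR (S n))) in *.
  replace (RtoC (INR (fact (S n))) / poch (1 - beta) (S (S n)))%C with
    ((N * (RtoC (INR (fact n)) / poch (1 - beta) (S n)) + (- (1)) * (1 ^ S n * 0)) * / (1 - beta + N))%C.
  2:{ rewrite fact_simpl, mult_INR, RtoC_mult; fold N.
      change (poch (1 - beta) (S (S n))) with (poch (1 - beta) (S n) * (1 - beta + N))%C.
      assert (Q1 := poch_neq_0 _ (S n) Pb); assert (Q2 : (1 - beta + N <> 0)%C) by apply Pb; field; tauto. }
  apply (filterlim_ext (fun y => (N * inc_beta beta n y + (- (1)) * (RtoC y ^ S n * Rcpow (1 - y) (1 - beta))) * / (1 - beta + N))%C).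
  { intros y; change (inc_beta beta (S n) y) with ((N * inc_beta beta n y - RtoC y ^ S n * Rcpow (1 - y) (1 - beta)) / (1 - beta + N))%C.
    unfold Cdiv, Cminus; ring. }
  apply filterlim_Cmult; [exact FF| |apply filterlim_const].
  apply filterlim_Cplus; [exact FF| |].
  + apply filterlim_Cmult; [exact FF|apply filterlim_const|exact IH].
  + apply filterlim_Cmult; [exact FF|apply filterlim_const|].
    apply filterlim_Cmult; [exact FF| |exact HR].
    assert (Hy : filterlim RtoC (at_left 1) (locally (RtoC 1))).
    { apply filterlim_RtoC; [exact FF|]; intros P [e He]; exists e; intros y Hy _; apply He, Hy. }
    generalize (S n); intros k; induction k as [|m IHm]; [exact (filterlim_const (RtoC 1))|].
    simpl; apply filterlim_Cmult; [exact FF|exact Hy|exact IHm].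
Qed.

(** * The integral representation *)

Lemma Series_tail_0 (M : nat -> R) : ex_series M ->
  is_lim_seq (fun N => Series (fun n => M (N + n)%nat)) 0.
Proof.
intros H; apply is_lim_seq_incr_1.
apply (is_lim_seq_ext (fun N => Series M - sum_n M N)).
- intros N; rewrite (Series_incr_n M (S N)) by (try lia; exact H); simpl Init.Nat.pred.
  rewrite <- sum_n_Reals; ring.
- replace (Finite 0) with (Finite (Series M - Series M)) by (f_equal; ring).
  apply is_lim_seq_minus'; [apply is_lim_seq_const|exact (Series_correct _ H)].
Qed.

Lemma Csum_Cderive (f df : nat -> R -> C) l z : (forall n, is_Cderive (f n) z (df n z)) ->
  is_Cderive (fun x => Csum (fun n => f n x) l) z (Csum (fun n => df n z) l).
Proof.
intros H; induction l as [|n l IH]; [exact (is_Cderive_const (RtoC 0) z)|].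
exact (is_Cderive_plus _ _ _ _ _ (H n) IH).
Qed.

(** The ratio [(n + 1) / (n + 2 - b)] of consecutive values of [real_beta] tends to 1 and so is
    eventually at least [y]. Summability against [real_beta] thus implies summability against
    [y ^ n]. *)
Lemma pow_le_real_beta b y : b < 1 -> 0 <= y < 1 ->
  exists N C, forall n, (N <= n)%nat -> y ^ n <= C * real_beta b n.
Proof.
intros Hb Hy.
(* Beyond this threshold [y * (n + 2 - b) <= n + 1]. *)
destruct (INR_ge_eventually (Rabs (y * (2 - b) - 1) / (1 - y))) as [N HN].
pose proof (real_beta_pos b N Hb) as HP.
set (c := y ^ N / real_beta b N).
assert (Hc : 0 <= c) by (apply Rmult_le_pos; [apply pow_le; lra|apply Rlt_le, Rinv_0_lt_compat, HP]).
exists N, c; intros n Hn; induction Hn as [|n Hn IH].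
- unfold c; apply Req_le; field; lra.
- specialize (HN n Hn); pose proof (real_beta_pos b n Hb) as HPn; pose proof (pos_INR n).
  change (real_beta b (S n)) with (INR (S n) * real_beta b n / (1 - b + INR (S n))).
  apply (Rle_trans _ (y * (c * real_beta b n))); [simpl; apply Rmult_le_compat_l; lra|].
  replace (y * (c * real_beta b n)) with (c * (y * real_beta b n)) by ring.
  apply Rmult_le_compat_l; [exact Hc|].
  rewrite S_INR; apply (Rmult_le_reg_r (1 - b + (INR n + 1))); [lra|].
  replace ((INR n + 1) * real_beta b n / (1 - b + (INR n + 1)) * (1 - b + (INR n + 1))) with ((INR n + 1) * real_beta b n) by (field; lra).
  replace (y * real_beta b n * (1 - b + (INR n + 1))) with ((y * (1 - b + (INR n + 1))) * real_beta b n) by ring.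
  apply Rmult_le_compat_r; [lra|].
  assert (Rabs (y * (2 - b) - 1) <= INR n * (1 - y)).
  { apply (Rmult_le_reg_r (/ (1 - y))); [apply Rinv_0_lt_compat; lra|].
    replace (INR n * (1 - y) * / (1 - y)) with (INR n) by (field; lra); exact HN. }
  pose proof (Rle_abs (y * (2 - b) - 1)); lra.
Qed.

(** [Re beta] may have either sign; the absolute values in the exponent cover both cases. *)
Lemma Cmod_beta_integrand_le beta n z y : 0 <= z <= y -> y < 1 ->
  Cmod (beta_integrand beta n z) <= exp (Rabs (Re beta) * Rabs (ln (1 - y))) * y ^ n.
Proof.
intros Hz Hy; unfold beta_integrand.
rewrite Cmod_mult, Cmod_Rcpow, Cmod_pow, Cmod_R, Rabs_pos_eq by lra.
apply Rmult_le_compat; [apply Rlt_le, exp_pos|apply pow_le; lra| |apply pow_incr; lra].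
assert (L1 : ln (1 - y) <= ln (1 - z)) by (apply ln_le; lra).
assert (L2 : ln (1 - z) <= 0) by (rewrite <- ln_1; apply ln_le; lra).
assert (Hle : Re (- beta) * ln (1 - z) <= Rabs (Re beta) * Rabs (ln (1 - y))).
{ eapply Rle_trans; [apply Rle_abs|]; rewrite Rabs_mult.
  replace (Rabs (Re (- beta))) with (Rabs (Re beta)) by (destruct beta; simpl; now rewrite Rabs_Ropp).
  apply Rmult_le_compat_l; [apply Rabs_pos|]; rewrite !Rabs_left1 by lra; lra. }
destruct Hle as [Hlt|Heq]; [now apply Rlt_le, exp_increasing|rewrite Heq; lra].
Qed.

Lemma ball_C_R (f g : C) (eps : posreal) : Cmod (g - f) < eps ->
  ball (M := CompleteNormedModule.UniformSpace _ C_R_CompleteNormedModule) f eps g.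
Proof.
intros H; split.
- exact (Rle_lt_trans _ _ _ (re_le_Cmod (g - f)) H).
- exact (Rle_lt_trans _ _ _ (im_le_Cmod (g - f)) H).
Qed.

(** Away from the singularity at 1 the series converges uniformly, by comparison with the geometric
    factor [y ^ n], and may be integrated term by term. *)
Lemma is_RInt_beta_series (A : nat -> C) beta y : Re beta < 1 -> 0 <= y < 1 ->
  ex_series (fun n => Cmod (A n) * real_beta (Re beta) n) ->
  is_RInt (V := C_R_CompleteNormedModule)
    (fun z => Rcpow (1 - z) (- beta) * CSeries (fun n => A n * RtoC z ^ n))%C 0 y
    (CSeries (fun n => A n * inc_beta beta n y)%C).
Proof.
intros Hb Hy HA.
assert (HAy : ex_series (fun n => Cmod (A n) * y ^ n)).
{ destruct (pow_le_real_beta (Re beta) y Hb Hy) as (N & c & Hc).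
  apply (ex_series_incr_n (V := R_NormedModule) _ N).
  apply (ex_series_pos_le _ (fun n => c * (Cmod (A (N + n)%nat) * real_beta (Re beta) (N + n)))).
  - intros n; split; [apply Rmult_le_pos; [apply Cmod_ge_0|apply pow_le; lra]|].
    replace (c * (Cmod (A (N + n)%nat) * real_beta (Re beta) (N + n))) with
      (Cmod (A (N + n)%nat) * (c * real_beta (Re beta) (N + n))) by ring.
    apply Rmult_le_compat_l; [apply Cmod_ge_0|apply Hc; lia].
  - apply (ex_series_scal_l (V := R_NormedModule) c).
    apply (ex_series_incr_n (V := R_NormedModule) (fun n => Cmod (A n) * real_beta (Re beta) n) N), HA. }
set (E := exp (Rabs (Re beta) * Rabs (ln (1 - y)))).
set (M := fun n => E * (Cmod (A n) * y ^ n)).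
assert (HM : ex_series M) by (apply (ex_series_scal_l (V := R_NormedModule) E), HAy).
set (phi := fun z => (Rcpow (1 - z) (- beta) * CSeries (fun n => A n * RtoC z ^ n))%C).
assert (Hterm : forall z n, 0 <= z <= y -> Cmod (A n * beta_integrand beta n z) <= M n).
{ intros z n Hz; rewrite Cmod_mult; unfold M.
  replace (E * (Cmod (A n) * y ^ n)) with (Cmod (A n) * (E * y ^ n)) by ring.
  apply Rmult_le_compat_l; [apply Cmod_ge_0|apply Cmod_beta_integrand_le; lra]. }
assert (Hphi : forall z, 0 <= z <= y -> phi z = CSeries (fun n => A n * beta_integrand beta n z)%C).
{ intros z Hz; symmetry; apply CSeries_unique; unfold phi.
  assert (Hz' : ex_series (fun n => Cmod (A n * RtoC z ^ n))).
  { apply (ex_series_pos_le _ (fun n => Cmod (A n) * y ^ n)); [|exact HAy].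
    intros n; split; [apply Cmod_ge_0|]; rewrite Cmod_mult, Cmod_pow, Cmod_R, Rabs_pos_eq by lra.
    apply Rmult_le_compat_l; [apply Cmod_ge_0|apply pow_incr; lra]. }
  generalize (is_Cseries_scal (Rcpow (1 - z) (- beta)) _ _ (Cseries_correct _ Hz')).
  apply is_Cseries_ext; intros n; unfold beta_integrand; ring. }
(* [filterlim_RInt] takes uniform convergence on the whole line, so the functions are extended by 0
   outside [0, y]. *)
set (cut := fun (g : R -> C) z => if Rle_dec 0 z then if Rle_dec z y then g z else RtoC 0 else RtoC 0).
assert (Hcut : forall g z, 0 < z < y -> cut g z = g z).
{ intros g z Hz; unfold cut; destruct (Rle_dec 0 z); [|lra]; destruct (Rle_dec z y); [reflexivity|lra]. }
set (S_ := fun N z => Csum (fun n => A n * beta_integrand beta n z)%C (seq 0 N)).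
set (I_ := fun N z => Csum (fun n => A n * inc_beta beta n z)%C (seq 0 N)).
assert (HI : forall N, is_RInt (V := C_R_CompleteNormedModule) (cut (S_ N)) 0 y (I_ N y)).
{ intros N; apply (is_RInt_ext (V := C_R_NormedModule) (S_ N)).
  - intros z; rewrite Rmin_left, Rmax_right by lra; intros Hz; symmetry; now apply Hcut.
  - replace (I_ N y) with (I_ N y - I_ N 0)%C.
    2:{ unfold I_ at 2; rewrite (Csum_zero _ (seq 0 N)); [ring|]; intros n _; rewrite inc_beta_0 by exact Hb; ring. }
    apply is_RInt_Cderive; [lra| |].
    + intros z Hz; apply (Csum_Cderive (fun n z => A n * inc_beta beta n z)%C (fun n z => A n * beta_integrand beta n z)%C).
      intros n; eapply is_Cderive_eq; [apply is_Cderive_mult; [apply is_Cderive_const|apply inc_beta_derive; [exact Hb|lra]]|].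
      cbv beta; ring.
    + intros z Hz; apply (filterlim_Csum _ (fun z n => A n * beta_integrand beta n z)%C).
      intros n _; apply filterlim_Cmult; [apply locally_filter|apply filterlim_const|].
      apply beta_integrand_continuous; lra. }
assert (Hunif : filterlim (fun N => cut (S_ N)) eventually
   (locally (T := fct_UniformSpace R C_R_CompleteNormedModule) (cut phi))).
{ apply filterlim_locally; intros eps.
  (* Half of [eps] makes up for the factor 2 of [Cmod_CSeries_le]. *)
  assert (e2 : 0 < eps / 2) by (destruct eps; simpl; lra).
  destruct (proj2 (is_lim_seq_spec _ _) (Series_tail_0 M HM) (mkposreal _ e2)) as [N0 HN0].
  exists N0; intros N HN z; apply ball_C_R.
  specialize (HN0 N HN); rewrite Rminus_0_r in HN0; simpl in HN0.
  unfold cut; destruct (Rle_dec 0 z) as [z0|z0]; [destruct (Rle_dec z y) as [z1|z1]|].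
  2,3: replace (RtoC 0 - RtoC 0)%C with (RtoC 0) by ring; rewrite Cmod_0; apply eps.
  rewrite Hphi by lra.
  assert (Hz : ex_series (fun n => Cmod (A n * beta_integrand beta n z))).
  { apply (ex_series_pos_le _ M); [|exact HM]; intros n; split; [apply Cmod_ge_0|apply Hterm; lra]. }
  rewrite (CSeries_split _ N Hz); fold (S_ N z).
  replace (S_ N z - (S_ N z + CSeries (fun n => A (N + n)%nat * beta_integrand beta (N + n) z)))%C with
    (- CSeries (fun n => A (N + n)%nat * beta_integrand beta (N + n) z))%C by ring.
  rewrite Cmod_opp; eapply Rle_lt_trans.
  - apply (Cmod_CSeries_le _ (fun n => M (N + n)%nat)); [intros n; apply Hterm; lra|].
    now apply (ex_series_incr_n (V := R_NormedModule) M N).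
  - pose proof (Rle_abs (Series (fun n => M (N + n)%nat))); lra. }
destruct (filterlim_RInt (V := C_R_CompleteNormedModule) (fun N => cut (S_ N)) 0 y eventually _ (cut phi) (fun N => I_ N y) HI Hunif)
  as (l & Hl & Hint).
assert (Habs : ex_series (fun n => Cmod (A n * inc_beta beta n y))).
{ apply (ex_series_pos_le _ (fun n => 2 * (Cmod (A n) * real_beta (Re beta) n))).
  - intros n; split; [apply Cmod_ge_0|]; rewrite Cmod_mult.
    pose proof (Cmod_inc_beta_le beta n y Hb Hy); pose proof (Cmod_ge_0 (A n)); nra.
  - apply (ex_series_scal_l (V := R_NormedModule) 2), HA. }
assert (L2 := proj1 (is_Cseries_Csum _ _) (Cseries_correct _ Habs)).
assert (El : l = CSeries (fun n => A n * inc_beta beta n y)%C).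
{ apply (filterlim_locally_unique (V := C_NormedModule) _ _ _ Hl L2). }
rewrite <- El; revert Hint; apply (is_RInt_ext (V := C_R_NormedModule)).
intros z; rewrite Rmin_left, Rmax_right by lra; intros Hz; now apply Hcut.
Qed.

(** The integrals over [0, y] are dominated uniformly in [y] by
    [2 * Cmod (A n) * real_beta (Re beta) n], so the limit at 1 can be taken termwise. *)
Lemma is_RInt_gen_Phi0_integrand t u v w alpha beta gamma1 gamma2 :
  root_relations t u v w alpha beta gamma1 gamma2 -> Re alpha < 1 -> Re beta < 1 -> no_pole (1 - v) ->
  is_RInt_gen (V := C_R_CompleteNormedModule) (Phi0_integrand v beta gamma1 gamma2) (at_point 0) (at_left 1)
    (1 / (1 - beta) * CSeries (hyp_term (1 - gamma1 - beta) (1 - gamma2 - beta) (2 - v) (2 - beta)))%C.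
Proof.
intros Hroot Ha Hb Hv.
set (p := (1 - gamma1 - beta)%C); set (q := (1 - gamma2 - beta)%C).
set (A := fun n => (poch p n * poch q n / (RtoC (INR (fact n)) * poch (2 - v) n))%C).
assert (Pv : no_pole (2 - v)) by (replace (2 - v)%C with (1 - v + 1)%C by ring; now apply no_pole_S).
assert (Pb : no_pole (2 - beta)) by (apply no_pole_Re; destruct beta; simpl in *; lra).
assert (Pb1 : no_pole (1 - beta)) by (apply no_pole_Re; destruct beta; simpl in *; lra).
assert (Hf : forall n, RtoC (INR (fact n)) <> 0%C) by (intros n E; apply RtoC_inj in E; now apply INR_fact_neq_0 in E).
assert (Hsum := root_relations_sum _ _ _ _ _ _ _ _ Hroot).
assert (HA : ex_series (fun n => Cmod (A n) * real_beta (Re beta) n)).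
(* The factor [n + 1] in the ratio of [real_beta] cancels the one from [n!] in [A], leaving the
   lower parameters [2 - v] and [2 - Re beta]. The excess has real part [1 - Re alpha]. *)
{ apply (raabe_ratio _ p q (2 - v) (RtoC (2 - Re beta))).
  - intros n; apply Rmult_le_pos; [apply Cmod_ge_0|apply Rlt_le, real_beta_pos, Hb].
  - intros n; change (real_beta (Re beta) (S n)) with (INR (S n) * real_beta (Re beta) n / (1 - Re beta + INR (S n))).
    pose proof (pos_INR n) as Hn.
    rewrite <- RtoC_plus, (Cmod_RtoC_pos (2 - Re beta + INR n)) by lra.
    assert (EA : (A (S n) * (RtoC (INR (S n)) * (2 - v + RtoC (INR n))) = A n * ((p + RtoC (INR n)) * (q + RtoC (INR n))))%C).
    { unfold A; rewrite fact_simpl, mult_INR, RtoC_mult; simpl poch.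
      assert (HN := INR_S_neq_0 n); assert (Qv := poch_neq_0 _ n Pv); specialize (Pv n); specialize (Hf n); field; tauto. }
    apply (f_equal Cmod) in EA; rewrite !Cmod_mult, (Cmod_RtoC_pos (INR (S n))) in EA by apply pos_INR.
    rewrite S_INR in *.
    replace (1 - Re beta + (INR n + 1)) with (2 - Re beta + INR n) by ring.
    transitivity (Cmod (A (S n)) * ((INR n + 1) * Cmod (2 - v + RtoC (INR n))) * real_beta (Re beta) n); [field; lra|].
    rewrite EA; ring.
  - apply (f_equal Re) in Hsum; unfold p, q; destruct gamma1, gamma2, v, alpha, beta; simpl in *; lra. }
set (G := fun y => CSeries (fun n => A n * inc_beta beta n y)%C).
assert (HI : forall y, 0 <= y < 1 -> is_RInt (V := C_R_CompleteNormedModule) (Phi0_integrand v beta gamma1 gamma2) 0 y (G y)).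
{ intros y Hy; exact (is_RInt_beta_series A beta y Hb Hy HA). }
assert (HP : at_left 1 (fun y => 0 <= y < 1)).
{ exists (mkposreal 1 Rlt_0_1); intros y Hy Hy1.
  assert (Hy' : Rabs (y - 1) < 1) by exact Hy; apply Rabs_def2 in Hy'; lra. }
assert (HG : filterlim G (at_left 1) (locally (CSeries (fun n => A n * (RtoC (INR (fact n)) / poch (1 - beta) (S n)))%C))).
{ apply (Ctannery (at_left 1) (fun y n => A n * inc_beta beta n y)%C _ (fun n => 2 * (Cmod (A n) * real_beta (Re beta) n))).
  - intros n; apply filterlim_Cmult; [apply within_filter, locally_filter|apply filterlim_const|now apply inc_beta_limit].
  - revert HP; apply filter_imp; intros y Hy n; rewrite Cmod_mult.
    pose proof (Cmod_inc_beta_le beta n y Hb Hy); pose proof (Cmod_ge_0 (A n)); nra.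
  - apply (ex_series_scal_l (V := R_NormedModule) 2), HA. }
assert (EG : CSeries (fun n => A n * (RtoC (INR (fact n)) / poch (1 - beta) (S n)))%C =
   (1 / (1 - beta) * CSeries (hyp_term p q (2 - v) (2 - beta)))%C).
{ apply CSeries_unique.
  generalize (is_Cseries_scal (1 / (1 - beta))%C _ _ (Cseries_correct _ (proj1 (F32_sum_conv _ _ _ _ _ _ _ _ Hroot Ha Hb Hv)))).
  apply is_Cseries_ext; intros n; unfold A, hyp_term; rewrite poch_Sl.
  replace (1 - beta + 1)%C with (2 - beta)%C by ring; fold p q.
  assert (Qv := poch_neq_0 _ n Pv); assert (Qb := poch_neq_0 _ n Pb); assert (Q1 := no_pole_0 _ Pb1); specialize (Hf n).
  field; tauto. }
rewrite EG in HG.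
intros P HPl; specialize (HG P HPl).
apply (Filter_prod _ _ _ (fun x => x = 0) (fun y => (0 <= y < 1) /\ P (G y))).
- reflexivity.
- apply filter_and; [exact HP|exact HG].
- intros x y -> [Hy HPy]; exists (G y); split; [now apply HI|exact HPy].
Qed.

Theorem theorem3p5 (t : C) :
  (exists r : R, 0 < r /\
     forall u v w : C, Cmod u < r -> Cmod v < r -> Cmod w < r ->
       Phi0_abs_conv t u v w) /\
  (forall u v w alpha beta gamma1 gamma2 : C,
     (alpha + beta = u + v * t)%C ->
     (alpha * beta = t * (u * v - w ^ 2))%C ->
     (gamma1 + gamma2 = - u - (t - 1) * v)%C ->
     (gamma1 * gamma2 = (t - 1) * (u * v - w ^ 2))%C ->
     Re alpha < 1 -> Re beta < 1 ->
     (forall m : nat, v <> RtoC (INR (S m))) ->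
     Phi0_abs_conv t u v w ->
     ex_RInt_gen (V := C_R_CompleteNormedModule)
       (Phi0_integrand v beta gamma1 gamma2) (at_point 0) (at_left 1) /\
     ex_series (V := C_NormedModule)
       (F32_term (1 - gamma1 - beta) (1 - gamma2 - beta) 1
                 (2 - v) (2 - beta) 1)%C /\
     Phi0 t u v w =
       (1 / (1 - v) *
          RInt_gen (V := C_R_CompleteNormedModule)
            (Phi0_integrand v beta gamma1 gamma2)
            (at_point 0%R) (at_left 1%R))%C /\
     Phi0 t u v w =
       (1 / ((1 - v) * (1 - beta)) *
          F32 (1 - gamma1 - beta) (1 - gamma2 - beta) 1
              (2 - v) (2 - beta) 1)%C).
Proof.
split.
- pose proof (Cmod_ge_0 t).
  (* This radius turns the last condition of [small] into an equality. *)
  exists (/ (2 * (Cmod t + 3))); split; [apply Rinv_0_lt_compat; lra|].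
  intros u v w Hu Hv Hw; apply (Phi0_abs_conv_small t u v w (/ (2 * (Cmod t + 3)))).
  repeat split; try lra; [apply Rinv_0_lt_compat; lra|apply Req_le; field; lra].
- intros u v w alpha beta gamma1 gamma2 R1 R2 R3 R4 Ha Hb Hm Hconv.
  assert (Hroot : root_relations t u v w alpha beta gamma1 gamma2) by now repeat split.
  assert (Hv : no_pole (1 - v)).
  { intros m E; apply (Hm m); rewrite S_INR, RtoC_plus.
    replace v with (RtoC (INR m) + 1 - (1 - v + RtoC (INR m)))%C by ring; rewrite E; ring. }
  assert (Pv : no_pole (2 - v)) by (replace (2 - v)%C with (1 - v + 1)%C by ring; now apply no_pole_S).
  assert (Pb : no_pole (2 - beta)) by (apply no_pole_Re; destruct beta; simpl in *; lra).
  assert (Hb0 : (1 - beta <> 0)%C) by (apply no_pole_0, no_pole_Re; destruct beta; simpl in *; lra).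
  assert (Hv0 := no_pole_0 _ Hv).
  assert (HI := is_RInt_gen_Phi0_integrand _ _ _ _ _ _ _ _ Hroot Ha Hb Hv).
  assert (HF : is_Cseries (F32_term (1 - gamma1 - beta) (1 - gamma2 - beta) 1 (2 - v) (2 - beta) 1)
     (CSeries (hyp_term (1 - gamma1 - beta) (1 - gamma2 - beta) (2 - v) (2 - beta)))).
  { generalize (Cseries_correct _ (proj1 (F32_sum_conv _ _ _ _ _ _ _ _ Hroot Ha Hb Hv))).
    apply is_Cseries_ext; intros n; symmetry; now apply F32_term_hyp. }
  assert (H0 := Phi0_F32 _ _ _ _ _ _ _ _ Hroot Ha Hb Hv Hconv).
  repeat split.
  + eexists; exact HI.
  + eexists; exact HF.
  + rewrite H0.
    rewrite (is_RInt_gen_unique (V := C_R_CompleteNormedModule) _ _ HI); field; tauto.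
  + rewrite H0; unfold F32; now rewrite (CSeries_unique _ _ HF).
Qed.
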